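(* Let $(\tilde{\mathcal M},\tilde{\mathbf c},\tilde K)$ be an optical geometry, and let $\tilde\sigma\in\Gamma(\tilde{\mathcal E}[1])$ be an almost Lorentzian scale, so that $\tilde g=\tilde\sigma^{-2}\tilde{\boldsymbol g}\in\tilde{\mathbf c}$ is a smooth metric off the zero set of $\tilde\sigma$. Then $\tilde\sigma$ is an almost pure radiation scale if and only if $\tilde g$ is a pure radiation metric (off the zero set of $\tilde\sigma$).
   Context: $(\tilde{\mathcal M},\tilde{\mathbf c})$ is an oriented, time-oriented Lorentzian conformal manifold of dimension $n+2$. $\tilde{\mathcal E}[w]$ are the conformal density bundles; $\tilde{\boldsymbol g}_{ab}$ is the conformal metric (weight $2$), so that nowhere vanishing $\tilde\sigma$ of weight $1$ correspond (up to sign) to metrics $\tilde g=\tilde\sigma^{-2}\tilde{\boldsymbol g}\in\tilde{\mathbf c}$; Levi-Civita connections $\tilde\nabla$ of metrics in $\tilde{\mathbf c}$ extend to densities and preserve $\tilde{\boldsymbol g}$. Indices are raised and lowered with $\tilde{\boldsymbol g}$; square brackets denote skew-symmetrisation; $(\cdot)_\circ$ is the trace-free part. The Schouten tensor is $\tilde{\mathsf P}_{ab}=\frac1n\big(\widetilde{\mathsf{Ric}}_{ab}-\frac1{2(n+1)}\widetilde{\mathsf{Sc}}\,\tilde{\boldsymbol g}_{ab}\big)$. An optical geometry $(\tilde{\mathcal M},\tilde{\mathbf c},\tilde K)$ is such a conformal manifold with an oriented null line distribution $\tilde K$; $\tilde K^\perp$ is its orthogonal complement. A metric $\tilde g\in\tilde{\mathbf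 c}$ is a pure radiation metric if its Ricci scalar is constant and $\tilde\kappa_{[a}(\widetilde{\mathsf{Ric}}_{b]c})_\circ=0$, where $\tilde\kappa_a=\tilde g_{ab}\tilde k^b$ for some (nowhere vanishing) $\tilde k\in\Gamma(\tilde K)$. An almost Lorentzian scale is $\tilde\sigma\in\Gamma(\tilde{\mathcal E}[1])$ with $\tilde\nabla\tilde\sigma\neq0$ on its zero set, $\tilde\nabla$ being the Levi-Civita connection of some (hence any) metric in $\tilde{\mathbf c}$. An almost Lorentzian scale $\tilde\sigma$ is an almost pure radiation scale if $$\big(\tilde\nabla_a\tilde\nabla_b\tilde\sigma+\tilde{\mathsf P}_{ab}\tilde\sigma\big)_\circ=\tfrac1n\tilde\Phi_{ab}\tilde\sigma,\qquad \tilde\Phi_a{}^b\tilde\nabla_b\tilde\sigma-\tfrac1n\tilde\sigma\tilde\nabla_b\tilde\Phi_a{}^b=0$$ for some trace-free symmetric tensor $\tilde\Phi_{ab}$ satisfying $\tilde\Phi_{ab}\tilde v^b=0$ for all $\tilde v\in\Gamma(\tilde K^\perp)$.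
   Formalization: The converse gives the almost pure radiation scale equations, with their tensor Φ, only off the zero set of σ: Φ may have a pole there (flat space, σ = u + u²), so the global converse fails. The manifold is taken connected, so that the Ricci scalar is one constant; n ≥ 1. *)

(* Defs.v *)
From HB Require Import structures.
From mathcomp Require Import all_boot all_order all_algebra.
From mathcomp Require Import all_classical all_reals all_analysis.

Set Implicit Arguments.
Unset Strict Implicit.
Unset Printing Implicit Defensive.

Import Order.TTheory GRing.Theory Num.Theory numFieldNormedType.Exports.
Local Open Scope classical_set_scope.
Local Open Scope ring_scope.

(* MathComp-Analysis has no manifolds.  Tensor fields are families of component
   functions, one for each chart of an atlas, related by the usual
   transformation laws on overlaps.  The components attached to a chart at a
   point outside its domain carry no information and are never constrained. *)

Fixpoint Ck (R : realType) (N k : nat) (U : set 'rV[R]_N) (f : 'rV[R]_N -> R)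
    : Prop :=
  (forall x, U x -> {for x, continuous f}) /\
  (if k is k'.+1 then
     forall a : 'I_N, (forall x, U x -> derivable f x (delta_mx 0 a)) /\
                      Ck k' U (fun x => 'D_(delta_mx 0 a) f x)
   else True).

Definition smooth (R : realType) (N : nat) (U : set 'rV[R]_N)
    (f : 'rV[R]_N -> R) : Prop := forall k, Ck k U f.

Record charted_space (R : realType) (N : nat) := ChartedSpace {
  carrier :> topologicalType;
  chart : Type;
  dom : chart -> set carrier;
  coord : chart -> carrier -> 'rV[R]_N;
  param : chart -> 'rV[R]_N -> carrier
}.
Arguments dom {R N c} _ _.
Arguments coord {R N c} _ _.
Arguments param {R N c} _ _.

(* Partial derivative of [f] with respect to the [a]-th coordinate of the
   chart [i]. *)
Definition pd (R : realType) (N : nat) (M : charted_space R N) (i : chart M)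
    (a : 'I_N) (f : M -> R) (p : M) : R :=
  'D_(delta_mx 0 a) (f \o param i) (coord i p).

(* The entry (a, b) is dy^b/dx^a, with x and y the coordinates of i and j. *)
Definition jacobian (R : realType) (N : nat) (M : charted_space R N)
    (i j : chart M) (p : M) : 'M[R]_N :=
  \matrix_(a, b) pd i a (fun q => coord j q 0 b) p.

(* The atlas need not be maximal; positivity of the Jacobians of all its
   transition maps is the orientation. *)
Record oriented_manifold (R : realType) (N : nat) := OrientedManifold {
  manifold_space :> charted_space R N;
  manifold_hausdorff : hausdorff_space manifold_space;
  manifold_second_countable : @second_countable manifold_space;
  manifold_connected : connected [set: manifold_space];
  chart_cover : forall p : manifold_space, exists i : chart manifold_space, dom i p;
  dom_open : forall i : chart manifold_space, open (dom i);
  image_open : forall i : chart manifold_space, open (coord i @` dom i);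
  coordK : forall (i : chart manifold_space) p, dom i p -> param i (coord i p) = p;
  coord_continuous : forall (i : chart manifold_space) p, dom i p ->
    {for p, continuous (coord i)};
  param_continuous : forall (i : chart manifold_space) p, dom i p ->
    {for coord i p, continuous (param i)};
  transition_smooth : forall (i j : chart manifold_space) (b : 'I_N),
    smooth (coord i @` (dom i `&` dom j)) (fun x => coord j (param i x) 0 b);
  orientation : forall (i j : chart manifold_space) p, dom i p -> dom j p ->
    0 < \det (jacobian i j p)
}.

Section Tensors.
Context {R : realType} {N : nat} {M : oriented_manifold R N}.

Definition smooth_in_chart (D : set M) (i : chart M) (f : M -> R) : Prop :=
  smooth (coord i @` (dom i `&` D)) (f \o param i).

Definition smooth_fun (D : set M) (f : M -> R) : Prop :=
  forall i, smooth_in_chart D i f.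

(* Component families of vector fields and of covariant 2-tensor fields. *)
Definition vfield := chart M -> M -> 'rV[R]_N.
Definition tensor2 := chart M -> M -> 'M[R]_N.

Definition is_vfield (D : set M) (X : vfield) : Prop :=
  (forall i j p, D p -> dom i p -> dom j p -> X j p = X i p *m jacobian i j p) /\
  (forall i a, smooth_in_chart D i (fun p => X i p 0 a)).

Definition is_tensor2 (D : set M) (T : tensor2) : Prop :=
  (forall i j p, D p -> dom i p -> dom j p ->
     T i p = jacobian i j p *m T j p *m (jacobian i j p)^T) /\
  (forall i a b, smooth_in_chart D i (fun p => T i p a b)).

(* [g(u, v)] for component row vectors. *)
Definition pairing (g : 'M[R]_N) (u v : 'rV[R]_N) : R := (u *m g *m v^T) 0 0.

(* Signature (-, +, ..., +). *)
Definition lorentz_form (g : 'M[R]_N) : Prop :=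
  exists P : 'M[R]_N, P \in unitmx /\
    P *m g *m P^T =
      diag_mx (\row_(a < N) (if (a : nat) == 0%N then -1 else 1)).

Definition lorentzian_metric (D : set M) (g : tensor2) : Prop :=
  is_tensor2 D g /\ forall i p, D p -> dom i p -> lorentz_form (g i p).

Definition inv_metric (g : tensor2) (i : chart M) (a b : 'I_N) (p : M) : R :=
  invmx (g i p) a b.

Definition trace (g T : tensor2) (i : chart M) (p : M) : R :=
  \sum_a \sum_b inv_metric g i a b p * T i p a b.

Definition tracefree (g T : tensor2) : tensor2 :=
  fun i p => T i p - (N%:R^-1 * trace g T i p) *: g i p.

(* Levi-Civita connection: [christoffel g i c a b] is Gamma^c_{ab}. *)
Definition christoffel (g : tensor2) (i : chart M) (c a b : 'I_N) (p : M) : R :=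
  2%:R^-1 * \sum_d inv_metric g i c d p *
    (pd i a (fun q => g i q d b) p + pd i b (fun q => g i q a d) p
     - pd i d (fun q => g i q a b) p).

(* nabla_a nabla_b f *)
Definition hessian (g : tensor2) (f : M -> R) : tensor2 := fun i p =>
  \matrix_(a, b) (pd i a (pd i b f) p - \sum_c christoffel g i c a b p * pd i c f p).

(* [cov_deriv2 g T i p c a b] is nabla_c T_{ab}. *)
Definition cov_deriv2 (g T : tensor2) (i : chart M) (p : M) (c a b : 'I_N) : R :=
  pd i c (fun q => T i q a b) p
  - \sum_d christoffel g i d c a p * T i p d b
  - \sum_d christoffel g i d c b p * T i p a d.

(* R_{ab} = d_c Gamma^c_{ab} - d_b Gamma^c_{ac}
            + Gamma^c_{cd} Gamma^d_{ab} - Gamma^c_{bd} Gamma^d_{ac},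
   which is positive definite on round spheres. *)
Definition ricci (g : tensor2) : tensor2 := fun i p =>
  \matrix_(a, b)
    (\sum_c (pd i c (christoffel g i c a b) p - pd i b (christoffel g i c a c) p)
     + \sum_c \sum_d
         (christoffel g i c c d p * christoffel g i d a b p
          - christoffel g i c b d p * christoffel g i d a c p)).

Definition scalar_curvature (g : tensor2) (i : chart M) (p : M) : R :=
  trace g (ricci g) i p.

Definition conformal_rescaling (Omega : M -> R) (g h : tensor2) : Prop :=
  forall i p, dom i p -> h i p = Omega p ^+ 2 *: g i p.

End Tensors.
Arguments vfield {R N} M.
Arguments tensor2 {R N} M.

(* P_{ab}, in dimension n + 2. *)
Definition schouten (R : realType) (n : nat) (M : oriented_manifold R n.+2)
    (g : tensor2 M) : tensor2 M := fun i p =>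
  n%:R^-1 *: (ricci g i p - ((2 * n.+1)%:R^-1 * scalar_curvature g i p) *: g i p).

(* [time_field] represents the time-orientation. *)
Record conformal_manifold (R : realType) (n : nat) := ConformalManifold {
  conformal_space :> oriented_manifold R n.+2;
  metrics : set (tensor2 conformal_space);
  metricsP : exists2 g0, lorentzian_metric setT g0 &
    metrics = [set g | exists Omega : conformal_space -> R,
      [/\ smooth_fun setT Omega, (forall p, 0 < Omega p) &
          conformal_rescaling Omega g0 g]];
  time_field : vfield conformal_space;
  time_fieldP : is_vfield setT time_field;
  time_field_timelike : forall g i p, metrics g -> dom i p ->
    pairing (g i p) (time_field i p) (time_field i p) < 0
}.

(* [ray i p] is the set of components, in the chart [i], of the positively
   oriented vectors of the oriented line K_p. *)
Record optical_geometry (R : realType) (n : nat) := OpticalGeometry {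
  optical_space :> conformal_manifold R n;
  ray : chart optical_space -> optical_space -> set 'rV[R]_(n.+2);
  ray_generated : forall p : optical_space, exists U : set optical_space,
    exists k : vfield optical_space,
    [/\ open U, U p, is_vfield U k &
        forall i q, U q -> dom i q ->
          k i q != 0 /\ ray i q = [set t *: k i q | t in [set t : R | 0 < t]]];
  ray_null : forall g i p u, metrics g -> dom i p -> ray i p u ->
    pairing (g i p) u u = 0
}.

Section Optical.
Context {R : realType} {n : nat} {X : optical_geometry R n}.

Definition null_line (i : chart X) (p : X) : set 'rV[R]_(n.+2) :=
  [set u | ray i p u \/ ray i p (- u) \/ u = 0].

(* Orthogonality does not depend on the metric of the conformal class. *)
Definition null_line_perp (i : chart X) (p : X) : set 'rV[R]_(n.+2) :=
  [set v | forall g u, metrics g -> null_line i p u -> pairing (g i p) v u = 0].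

Definition is_section (D : set X) (k : vfield X) : Prop :=
  is_vfield D k /\ forall i p, D p -> dom i p -> null_line i p (k i p).

Definition pure_radiation_metric (D : set X) (g : tensor2 X) : Prop :=
  [/\ lorentzian_metric D g,
      exists c : R, forall i p, D p -> dom i p -> scalar_curvature g i p = c &
      exists k : vfield X, [/\ is_section D k,
        forall i p, D p -> dom i p -> k i p != 0 &
        forall i p, D p -> dom i p ->
          let kappa := k i p *m g i p in
          let Ric0 := tracefree g (ricci g) i p in
          forall a b c, 2%:R^-1 * (kappa 0 a * Ric0 b c - kappa 0 b * Ric0 a c) = 0]].

(* A section of E[w] assigns to each metric of the conformal class the function
   that represents it in the trivialization of E[w] defined by that metric.  In
   the trivializations defined by g, the conformal metric is g, and the
   Levi-Civita connection of g acts on densities by partial derivatives. *)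
Record density (w : int) := Density {
  density_val :> tensor2 X -> X -> R;
  density_smooth : forall g, metrics g -> smooth_fun setT (density_val g);
  density_equivariant : forall g h Omega, metrics g -> metrics h ->
    (forall p, 0 < Omega p) -> conformal_rescaling Omega g h ->
    forall p, density_val h p = Omega p ^ w * density_val g p
}.

Definition zero_set (w : int) (s : density w) : set X :=
  [set p | exists2 g, metrics g & s g p = 0].

Definition almost_lorentzian_scale (s : density 1) : Prop :=
  exists2 g, metrics g &
    forall p, zero_set s p -> forall i, dom i p -> exists a, pd i a (s g) p != 0.

(* s^{-2} times the conformal metric, computed in the trivializations defined
   by [g]; by equivariance it does not depend on [g]. *)
Definition scale_metric (s : density 1) (g : tensor2 X) : tensor2 X :=
  fun i p => s g p ^- 2 *: g i p.

(* The two equations, with Phi a tensor field on the open set [D]; the notion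
   of almost pure radiation scale on the whole manifold is the case
   [D = setT]. *)
Definition almost_pure_radiation_scale (D : set X) (s : density 1) : Prop :=
  exists2 g, metrics g &
  exists Phi : tensor2 X,
  [/\ is_tensor2 D Phi,
      forall i p, D p -> dom i p ->
        [/\ (Phi i p)^T = Phi i p, trace g Phi i p = 0 &
            forall v, null_line_perp i p v -> Phi i p *m v^T = 0],
      forall i p, D p -> dom i p ->
        tracefree g (fun j q => hessian g (s g) j q + s g q *: schouten g j q) i p
        = (n%:R^-1 * s g p) *: Phi i p &
      forall i p a, D p -> dom i p ->
        \sum_c \sum_b inv_metric g i c b p * Phi i p a c * pd i b (s g) p
        - n%:R^-1 * s g p *
          \sum_b \sum_c inv_metric g i b c p * cov_deriv2 g Phi i p b a c = 0].

End Optical.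
Arguments density {R n} X w.

(* Main.v *)
From Pilot Require Import Defs.
From HB Require Import structures.
From mathcomp Require Import all_boot all_order all_algebra ring.
From mathcomp Require Import all_classical all_reals all_analysis.
Import Order.TTheory GRing.Theory Num.Theory numFieldNormedType.Exports.
Import Pilot.Defs.
Local Open Scope classical_set_scope.
Local Open Scope ring_scope.

Set Implicit Arguments.
Unset Strict Implicit.
Unset Printing Implicit Defensive.

(** Let gh = s^-2 g be the metric that the scale defines off its zeros. The
    conformal change of the Ricci tensor ([scaled_ricci]) shows that the
    trace-free part of nabla nabla s + s P is s/n times the trace-free Ricci
    tensor of gh ([first_equation]). So the first equation says no more and no
    less than that Phi is that tensor, and the remaining conditions on Phi are
    algebraic: a symmetric matrix annihilates the orthogonal complement of a
    null line exactly when its skew product with the covector of that line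
    vanishes ([radiation_annihilates], [annihilates_radiation]).

    For this Phi, the left-hand side of the second equation is, up to the factor
    -1/(n s), the divergence of Phi for gh ([divergence_bump]), and by the
    contracted Bianchi identity it equals -1/(2(n+2)s) times the differential of
    the scalar curvature of gh ([second_equation]). Hence the second equation
    says that this scalar curvature is locally constant off the zeros.

    The complement of the zeros may be disconnected, so one more argument is
    needed to obtain a single constant. The expression
      s^2 Sc + 2(n+1) s Lap s - (n+1)(n+2) |ds|^2
    in terms of g extends the scalar curvature of gh smoothly to the whole
    manifold. As ds has no zero on the zero set of s, the complement is dense;
    the differential of the extension vanishes there, hence everywhere, and the
    manifold is connected ([dense_locally_constant]).

    All the tensor calculus is carried out in a commutative ring with commuting
    derivations, the Christoffel symbols being matrices. The smooth functions
    on a coordinate patch form such a ring [sfun], and evaluation at a point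
    transports its identities to the component formulas of the definitions
    ([eval_connection], [eval_ricci], [eval_cov], [eval_hessian]). *)

(** * Levi-Civita connections over a ring with commuting derivations *)

(** The partial derivatives of a coordinate system. *)
Record derivations (A : comPzRingType) (N : nat) := Derivations {
  der :> 'I_N -> A -> A;
  derD : forall a x y, der a (x + y) = der a x + der a y;
  derM : forall a x y, der a (x * y) = der a x * y + x * der a y;
  derC : forall a b x, der a (der b x) = der b (der a x)
}.

Section Derivations.
Variables (A : comPzRingType) (N : nat) (d : derivations A N).

Lemma der0 a : d a 0 = 0.
Proof. by apply: (addrI (d a 0)); rewrite -derD !addr0. Qed.

Lemma der1 a : d a 1 = 0.
Proof.
have e : d a (1 * 1) = d a 1 + d a 1 by rewrite derM mulr1 mul1r.
by apply: (addrI (d a 1)); rewrite -e mulr1 addr0.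
Qed.

Lemma derN a x : d a (- x) = - d a x.
Proof. by apply: (addrI (d a x)); rewrite -derD !subrr der0. Qed.

Lemma der_natr a k : d a k%:R = 0.
Proof. by elim: k => [|k IH]; rewrite ?der0 // -natr1 derD IH der1 addr0. Qed.

Lemma der_sum a (I : Type) (r : seq I) (P : pred I) (F : I -> A) :
  d a (\sum_(i <- r | P i) F i) = \sum_(i <- r | P i) d a (F i).
Proof. by apply: (big_morph (d a)); [exact: derD | exact: der0]. Qed.

Definition dmx (a : 'I_N) (m k : nat) (M : 'M[A]_(m, k)) : 'M[A]_(m, k) :=
  map_mx (d a) M.

Lemma dmxE a m k (M : 'M[A]_(m, k)) i j : dmx a M i j = d a (M i j).
Proof. by rewrite mxE. Qed.

Lemma dmxD a m k (M L : 'M[A]_(m, k)) : dmx a (M + L) = dmx a M + dmx a L.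
Proof. by apply/matrixP => i j; rewrite !mxE derD. Qed.

Lemma dmxN a m k (M : 'M[A]_(m, k)) : dmx a (- M) = - dmx a M.
Proof. by apply/matrixP => i j; rewrite !mxE derN. Qed.

Lemma dmxB a m k (M L : 'M[A]_(m, k)) : dmx a (M - L) = dmx a M - dmx a L.
Proof. by rewrite dmxD dmxN. Qed.

Lemma dmxM a m k l (M : 'M[A]_(m, k)) (L : 'M[A]_(k, l)) :
  dmx a (M *m L) = dmx a M *m L + M *m dmx a L.
Proof.
apply/matrixP => i j; rewrite !mxE der_sum -big_split /=.
by apply: eq_bigr => c _; rewrite derM !mxE.
Qed.

Lemma dmxZ a m k x (M : 'M[A]_(m, k)) :
  dmx a (x *: M) = d a x *: M + x *: dmx a M.
Proof. by apply/matrixP => i j; rewrite !mxE derM. Qed.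

Lemma dmx_tr a m k (M : 'M[A]_(m, k)) : dmx a M^T = (dmx a M)^T.
Proof. by rewrite /dmx map_trmx. Qed.

Lemma dmxC a b m k (M : 'M[A]_(m, k)) : dmx a (dmx b M) = dmx b (dmx a M).
Proof. by apply/matrixP => i j; rewrite !mxE derC. Qed.

Lemma dmx_sum a m k (I : finType) (F : I -> 'M[A]_(m, k)) :
  dmx a (\sum_i F i) = \sum_i dmx a (F i).
Proof.
apply/matrixP => i j; rewrite !(mxE, summxE) der_sum.
by apply: eq_bigr => c _; rewrite mxE.
Qed.

Lemma dmx1 a m : dmx a (1%:M : 'M[A]_m) = 0.
Proof. by apply/matrixP => i j; rewrite !mxE; case: (_ == _); rewrite ?der1 ?der0. Qed.

End Derivations.

Lemma addmxE (A : pzRingType) m n (M L : 'M[A]_(m, n)) i j :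
  (M + L) i j = M i j + L i j.
Proof. by rewrite mxE. Qed.

Lemma oppmxE (A : pzRingType) m n (M : 'M[A]_(m, n)) i j : (- M) i j = - M i j.
Proof. by rewrite mxE. Qed.

Lemma scalemxE (A : pzRingType) m n x (M : 'M[A]_(m, n)) i j :
  (x *: M) i j = x * M i j.
Proof. by rewrite mxE. Qed.

Lemma trmxE (A : pzRingType) m n (M : 'M[A]_(m, n)) i j : M^T i j = M j i.
Proof. by rewrite mxE. Qed.

Lemma trmxD (A : pzRingType) m n (M L : 'M[A]_(m, n)) : (M + L)^T = M^T + L^T.
Proof. by rewrite linearD. Qed.

Lemma trmxN (A : pzRingType) m n (M : 'M[A]_(m, n)) : (- M)^T = - M^T.
Proof. by rewrite linearN. Qed.

Lemma mxtraceN (A : pzRingType) n (M : 'M[A]_n) : \tr (- M) = - \tr M.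
Proof. by rewrite linearN. Qed.

(* Linear identities between matrices, checked entrywise with the entries of
   products as atoms. *)
Ltac mxring :=
  let i := fresh in let j := fresh in
  apply/matrixP => i j; rewrite !(addmxE, oppmxE, scalemxE); ring.

Section Connections.
Variables (A : comPzRingType) (N : nat) (d : derivations A N).
Implicit Types (G : 'I_N -> 'M[A]_N) (g : 'M[A]_N).

(** The Christoffel symbols are collected into one matrix per direction: the
    entry (b, c) of [G a] is Gamma^c_{ab}. Contractions over the endomorphism
    indices are then matrix products. *)
Definition torsion_free G := forall a b c, G a b c = G b a c.

Definition metric_connection G g :=
  forall a, dmx d a g = G a *m g + g *m (G a)^T.

Definition curvature G (a b : 'I_N) : 'M[A]_N :=
  dmx d a (G b) - dmx d b (G a) - (G a *m G b - G b *m G a).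

Definition ricci_mx G : 'M[A]_N :=
  \matrix_(a, b) \sum_c curvature G c b a c.

Definition levi_civita (half : A) g (gi : 'M[A]_N) (a : 'I_N) : 'M[A]_N :=
  \matrix_(b, c) (half * \sum_e gi c e * (d a (g e b) + d b (g a e) - d e (g a b))).

Lemma curvatureC G a b : curvature G a b = - curvature G b a.
Proof. rewrite /curvature; mxring. Qed.

(** Bianchi: the covariant derivatives of the curvature act here on the
    endomorphism indices alone, the terms in the other two indices cancelling
    in the cyclic sum. *)
Definition dcurvature G (e a b : 'I_N) : 'M[A]_N :=
  dmx d e (curvature G a b) - (G e *m curvature G a b - curvature G a b *m G e).

Lemma second_bianchi G e a b :
  dcurvature G e a b + dcurvature G a b e + dcurvature G b e a = 0.
Proof.
rewrite /dcurvature /curvature !dmxB !dmxM (dmxC d e a) (dmxC d e b) (dmxC d a b).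
rewrite !(mulmxBl, mulmxBr, mulmxDl, mulmxDr, mulmxA).
by apply/matrixP => i j; rewrite !(addmxE, oppmxE) [RHS]mxE; ring.
Qed.

(** Every product G_x G_y, restricted to the row z, is symmetric in x and z. *)
Lemma first_bianchi G : torsion_free G -> forall a b c f,
  curvature G a b c f + curvature G b c a f + curvature G c a b f = 0.
Proof.
move=> Gs a b c f; rewrite /curvature !(addmxE, oppmxE) !dmxE.
rewrite (Gs b c) (Gs c a) (Gs a b).
have Gm x y z : (G x *m G y) z f = (G z *m G y) x f.
  by rewrite !mxE; apply: eq_bigr => e _; rewrite (Gs x z).
rewrite (Gm a b c) (Gm b a c) (Gm b c a); ring.
Qed.

Lemma ricci_mxE G a b : torsion_free G ->
  ricci_mx G a b =
  \sum_c (d c (G a b c) - d b (G a c c)) +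
  \sum_c \sum_e (G c e c * G a b e - G b e c * G a c e).
Proof.
move=> Gs; rewrite mxE -big_split /=; apply: eq_bigr => c _.
rewrite /curvature !(addmxE, oppmxE) !dmxE (Gs b a c) (Gs c a c); congr (_ + _).
rewrite opprB ![(_ *m _) _ _]mxE -sumrB; apply: eq_bigr => e _.
by rewrite (Gs b a e) (Gs c a e) mulrC [X in _ - X]mulrC.
Qed.

End Connections.

Section CovariantDerivative.
Variables (A : comPzRingType) (N : nat) (d : derivations A N).
Implicit Types (G : 'I_N -> 'M[A]_N) (g gi T : 'M[A]_N).

(** The entry (a, b) of [cov d G T e] is nabla_e T_{ab}. *)
Definition cov G T (e : 'I_N) : 'M[A]_N := dmx d e T - G e *m T - T *m (G e)^T.

Definition contract gi T : A := \sum_a \sum_b gi a b * T a b.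

Definition divergence gi G T (a : 'I_N) : A :=
  \sum_b \sum_c gi b c * cov G T b a c.

Lemma contract_tr gi T : contract gi T = \tr (gi *m T^T).
Proof.
apply: eq_bigr => a _; rewrite mxE; apply: eq_bigr => b _; by rewrite mxE.
Qed.

Lemma contractD gi T U : contract gi (T + U) = contract gi T + contract gi U.
Proof. by rewrite !contract_tr linearD mulmxDr mxtraceD. Qed.

Lemma contractZ gi x T : contract gi (x *: T) = x * contract gi T.
Proof. by rewrite !contract_tr linearZ -scalemxAr mxtraceZ. Qed.

Lemma cov_sym G T e : T^T = T -> (cov G T e)^T = cov G T e.
Proof.
move=> TS; rewrite /cov !linearB /= !trmx_mul trmxK -dmx_tr TS.
by rewrite addrAC.
Qed.

Lemma cov_metric G g e : metric_connection d G g -> cov G g e = 0.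
Proof. by move=> Gg; rewrite /cov Gg addrAC addrK subrr. Qed.

Lemma covB G T U e : cov G (T - U) e = cov G T e - cov G U e.
Proof. by rewrite /cov dmxB mulmxBl mulmxBr; mxring. Qed.

Lemma covZ G x T e : cov G (x *: T) e = d e x *: T + x *: cov G T e.
Proof. by rewrite /cov dmxZ -scalemxAl -scalemxAr; mxring. Qed.

Definition dcurvature_form G (e a b : 'I_N) : 'M[A]_N :=
  \sum_f G e a f *: curvature d G f b.

(** The full covariant derivative nabla_e R_{ab} of the curvature. *)
Definition cov_curvature G (e a b : 'I_N) : 'M[A]_N :=
  dcurvature d G e a b - dcurvature_form G e a b + dcurvature_form G e b a.

Lemma cov_curvatureC G e a b : cov_curvature G e a b = - cov_curvature G e b a.
Proof.
rewrite /cov_curvature /dcurvature (curvatureC d G a b) dmxN mulmxN mulNmx; mxring.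
Qed.

Lemma cov_bianchi G e a b : torsion_free G ->
  cov_curvature G e a b + cov_curvature G a b e + cov_curvature G b e a = 0.
Proof.
move=> Gs; have S x y z : dcurvature_form G x y z = dcurvature_form G y x z.
  by apply: eq_bigr => f _; rewrite Gs.
have := second_bianchi d G e a b; rewrite /cov_curvature (S a e) (S b a) (S b e).
move=> B; rewrite -[RHS]B; mxring.
Qed.

(** A contraction of an upper with a lower index is parallel: the two terms in
    the connection that act on them cancel. *)
Lemma cov_ricci G e a b :
  cov G (ricci_mx d G) e a b = \sum_c cov_curvature G e c b a c.
Proof.
set Rm := curvature d G.
transitivity (\sum_c ((d e (Rm c b a c) - (G e *m Rm c b) a c) +
    (Rm c b *m G e) a c - dcurvature_form G e c b a c + dcurvature_form G e b c a c));
  last by apply: eq_bigr => c _; rewrite /cov_curvature /dcurvature {}/Rm;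
    move: (curvature d G) => Rm; rewrite !(addmxE, oppmxE) dmxE; ring.
rewrite !big_split /= /cov !(addmxE, oppmxE) dmxE [X in d e X]mxE der_sum -/Rm.
have -> : \sum_c (Rm c b *m G e) a c = \sum_c dcurvature_form G e c b a c.
  transitivity (\sum_c \sum_f Rm c b a f * G e f c).
    by apply: eq_bigr => c _; rewrite mxE.
  rewrite exchange_big /=; apply: eq_bigr => c _.
  rewrite /dcurvature_form summxE; apply: eq_bigr => f _.
  by rewrite scalemxE mulrC.
rewrite ?sumrN.
have -> : (G e *m ricci_mx d G) a b = \sum_c (G e *m Rm c b) a c.
  rewrite mxE; under eq_bigr do rewrite mxE big_distrr /=.
  by rewrite exchange_big /=; apply: eq_bigr => c _; rewrite mxE.
have -> : (ricci_mx d G *m (G e)^T) a b = - \sum_c dcurvature_form G e b c a c.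
  rewrite mxE -sumrN.
  under eq_bigr do rewrite !mxE big_distrl /=.
  rewrite exchange_big /=; apply: eq_bigr => c _.
  rewrite /dcurvature_form summxE -sumrN.
  by apply: eq_bigr => f _; rewrite curvatureC scalemxE oppmxE; ring.
ring.
Qed.

End CovariantDerivative.

Lemma combine3 (A : comPzRingType) (k x y z t u : A) :
  y = u -> z = u -> t = u -> u = 0 -> x = y - z - k * t -> x = 0.
Proof. by move=> -> -> -> -> ->; rewrite mulr0 !subr0. Qed.

Section LeviCivita.
Variables (A : comPzRingType) (N : nat) (d : derivations A N).
Variables (half : A) (g gi : 'M[A]_N).
Hypothesis halfE : half + half = 1.
Hypothesis gS : g^T = g.
Hypothesis gK : g *m gi = 1%:M.
Implicit Types (G : 'I_N -> 'M[A]_N).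

Lemma inv_metric_sym : gi^T = gi.
Proof.
by rewrite -[LHS]mulmx1 -gK mulmxA -{1}gS -trmx_mul gK trmx1 mul1mx.
Qed.

Lemma inv_metricK : gi *m g = 1%:M.
Proof. by apply: trmx_inj; rewrite trmx_mul gS inv_metric_sym gK trmx1. Qed.

Let gC a b : g a b = g b a. Proof. by rewrite -{1}gS mxE. Qed.

Lemma half_double x : half * (x + x) = x.
Proof. by rewrite mulrDr -mulrDl halfE mul1r. Qed.

(** Koszul formula: lowering the last index, the three derivatives of the
    metric are sums of two symbols each, and all but two cancel. *)
Lemma levi_civita_unique G : torsion_free G -> metric_connection d G g ->
  forall a, G a = levi_civita d half g gi a.
Proof.
move=> Gs Gg a; apply/matrixP => b c; rewrite mxE.
pose L x y z := (G x *m g) y z.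
have Ls x y z : L x y z = L y x z.
  by rewrite /L !mxE; apply: eq_bigr => e _; rewrite Gs.
have dL x y z : d x (g y z) = L x y z + L x z y.
  rewrite -dmxE Gg addmxE; congr (_ + _).
  by rewrite /L !mxE; apply: eq_bigr => e _; rewrite mxE mulrC (gC y).
have -> : G a b c = ((G a *m g) *m gi) b c by rewrite -mulmxA gK mulmx1.
rewrite mxE big_distrr /=; apply: eq_bigr => e _.
rewrite !dL -[(G a *m g) b e]/(L a b e).
rewrite (Ls a e b) (Ls b e a) (Ls b a e) -{1}[L a b e]half_double.
rewrite -[in LHS]inv_metric_sym trmxE; ring.
Qed.

Let koszul a : 'M[A]_N :=
  \matrix_(b, e) (d a (g e b) + d b (g a e) - d e (g a b)).

Let lowered a : levi_civita d half g gi a *m g = half *: koszul a.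
Proof.
have -> : levi_civita d half g gi a = half *: (koszul a *m gi).
  apply/matrixP => b c; rewrite !mxE; congr (_ * _).
  by apply: eq_bigr => e _; rewrite !mxE mulrC -{1}inv_metric_sym mxE.
by rewrite -scalemxAl -mulmxA inv_metricK mulmx1.
Qed.

Lemma levi_civita_torsion_free : torsion_free (levi_civita d half g gi).
Proof.
move=> a b c; rewrite !mxE; congr (_ * _); apply: eq_bigr => e _.
by rewrite (gC b e) (gC a e) (gC b a); ring.
Qed.

Lemma levi_civita_metric : metric_connection d (levi_civita d half g gi) g.
Proof.
move=> a; set L := levi_civita _ _ _ _ _.
have -> : g *m L^T = (L *m g)^T by rewrite trmx_mul gS.
rewrite lowered; apply/matrixP => b c.
rewrite addmxE trmxE !scalemxE !mxE -[LHS]half_double (gC c b) (gC a b) (gC a c).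
by rewrite (gC b a) (gC c a); ring.
Qed.

Variable G : 'I_N -> 'M[A]_N.
Hypothesis Gs : torsion_free G.
Hypothesis Gg : metric_connection d G g.

(** The curvature is the commutator of covariant derivatives, which annihilate
    the metric. *)
Lemma curvature_antisym a b :
  curvature d G a b *m g + g *m (curvature d G a b)^T = 0.
Proof.
have := dmxC d a b g; rewrite {1}(Gg b) (Gg a) !dmxD !dmxM !dmx_tr !Gg => H.
rewrite /curvature !(trmxD, trmxN) !trmx_mul.
rewrite !(mulmxBl, mulmxBr, mulmxDl, mulmxDr, mulmxA) in H *.
apply/matrixP => i j; rewrite [RHS]mxE.
move/matrixP: H => /(_ i j) H; rewrite !(addmxE, oppmxE) in H *.
by move/eqP: H; rewrite -subr_eq0 => /eqP H; rewrite -[RHS]H; ring.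
Qed.

Lemma cov_curvature_antisym e a b :
  cov_curvature d G e a b *m g + g *m (cov_curvature d G e a b)^T = 0.
Proof.
have Rg := curvature_antisym.
have form x y z : dcurvature_form d G x y z *m g +
    g *m (dcurvature_form d G x y z)^T = 0.
  rewrite /dcurvature_form mulmx_suml linear_sum mulmx_sumr -big_split /=.
  apply: big1 => f _; rewrite linearZ /= -scalemxAl -scalemxAr -scalerDr.
  by rewrite Rg scaler0.
have dcurv : dcurvature d G e a b *m g + g *m (dcurvature d G e a b)^T = 0.
  have := congr1 (fun M => dmx d e M) (Rg a b); have := Rg a b.
  rewrite /dcurvature; move: (curvature d G a b) => W WA.
  rewrite !(trmxD, trmxN) !trmx_mul dmxD !dmxM !Gg dmx_tr.
  have -> : dmx d e (0 : 'M[A]_N) = 0 by apply/matrixP => i j; rewrite !mxE der0.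
  have E1 := congr1 (mulmx (G e)) WA; have E2 := congr1 (mulmxr (G e)^T) WA.
  rewrite /= in E1 E2; rewrite !(mulmxBl, mulmxBr, mulmxDl, mulmxDr, mulmxA, mulmx0, mul0mx) in E1 E2 *.
  move=> H; apply/matrixP => i j.
  move/matrixP: H => /(_ i j) H; move/matrixP: E1 => /(_ i j) E1.
  move/matrixP: E2 => /(_ i j) E2; rewrite !(addmxE, oppmxE) in H E1 E2 *.
  rewrite [RHS]mxE; apply: (combine3 (k := 1) H E1 E2); [by rewrite mxE | ring].
have F1 := form e a b; have F2 := form e b a.
rewrite /cov_curvature; move: (dcurvature d G e a b) (dcurvature_form d G e a b)
  (dcurvature_form d G e b a) dcurv F1 F2 => D1 D2 D3 dcurv F1 F2.
rewrite !(trmxD, trmxN) !(mulmxDl, mulmxDr, mulmxN, mulNmx).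
apply/matrixP => i j; rewrite [RHS]mxE.
move/matrixP: dcurv => /(_ i j) H; move/matrixP: F1 => /(_ i j) F1.
move/matrixP: F2 => /(_ i j) F2; rewrite !(addmxE, oppmxE, mulmxN, mulNmx) in H F1 F2 *.
by apply: (combine3 (k := -1) H F1 F2); [rewrite mxE | ring].
Qed.

Lemma raise_antisym (W : 'M[A]_N) : W *m g + g *m W^T = 0 ->
  forall a b, (gi *m W) a b = - (gi *m W) b a.
Proof.
move=> WA a b; have : gi *m (W *m g + g *m W^T) *m gi = 0.
  by rewrite WA mulmx0 mul0mx.
rewrite mulmxDr mulmxDl -!mulmxA gK mulmx1 (mulmxA gi g) inv_metricK mul1mx.
rewrite -{2}inv_metric_sym -trmx_mul => /matrixP/(_ a b).
by rewrite addmxE trmxE [RHS]mxE => /eqP; rewrite addr_eq0 => /eqP.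
Qed.

Lemma curvature_trace a b : \tr (curvature d G a b) = 0.
Proof.
set W := curvature d G a b.
have K : (gi *m W)^T = - (gi *m W).
  by apply/matrixP => i j; rewrite trmxE oppmxE (raise_antisym (curvature_antisym a b)).
have T : \tr W = - \tr W.
  rewrite -{1}[W]mul1mx -gK -mulmxA -mxtrace_tr trmx_mul K gS mulNmx.
  by rewrite mxtraceN mxtrace_mulC mulmxA gK mul1mx.
by rewrite -[LHS]half_double {1}T addNr mulr0.
Qed.

(** The trace of the first Bianchi identity; the term left over is a trace of an
    endomorphism that is skew for the metric. *)
Lemma ricci_mx_sym : (ricci_mx d G)^T = ricci_mx d G.
Proof.
apply/matrixP => b c; rewrite trmxE !mxE.
apply/eqP; rewrite -subr_eq0 -sumrB; apply/eqP.
transitivity (\sum_a (curvature d G a b c a + curvature d G b c a a +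
   curvature d G c a b a)); last by apply: big1 => a _; exact: first_bianchi.
rewrite !big_split /= [X in _ = _ + X + _](curvature_trace b c) addr0.
congr (_ + _); apply: eq_bigr => a _.
by rewrite (curvatureC d G c a) oppmxE.
Qed.

Lemma der_inv_metric e : dmx d e gi = - (gi *m G e) - (G e)^T *m gi.
Proof.
have := congr1 (mulmx gi) (congr1 (fun M => dmx d e M) gK).
rewrite dmxM dmx1 mulmx0 Gg mulmxDr (mulmxA gi g) inv_metricK mul1mx => /eqP.
rewrite addrC addr_eq0 => /eqP ->.
by rewrite !mulmxDl !mulmxDr -!mulmxA gK mulmx1 (mulmxA gi g) inv_metricK mul1mx opprD.
Qed.

Lemma der_contract T e : d e (contract gi T) = contract gi (cov d G T e).
Proof.
rewrite !contract_tr /mxtrace der_sum.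
transitivity (\tr (dmx d e (gi *m T^T))).
  by apply: eq_bigr => i _; rewrite dmxE.
rewrite dmxM der_inv_metric dmx_tr /cov !(trmxD, trmxN) !trmx_mul trmxK.
rewrite !(mulmxDl, mulmxDr, mulNmx, mulmxN, mxtraceD, mxtraceN) !mulmxA.
rewrite -(mulmxA _ gi) (mxtrace_mulC (G e)^T).
rewrite -[RHS]/(\tr _) !(mxtraceD, mxtraceN); ring.
Qed.

(** The second Bianchi identity traced twice. Skewness of the derivative of the
    curvature for the metric turns one of the three traces into a divergence. *)
Lemma contracted_bianchi e :
  d e (contract gi (ricci_mx d G)) =
  divergence d gi G (ricci_mx d G) e + divergence d gi G (ricci_mx d G) e.
Proof.
set Rc := ricci_mx d G.
have covS f a b : cov d G Rc f a b = cov d G Rc f b a.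
  by rewrite -[in LHS](cov_sym d G f ricci_mx_sym) trmxE.
rewrite der_contract.
apply/eqP; rewrite -subr_eq0 opprD addrA; apply/eqP.
transitivity (\sum_a \sum_b gi a b * \sum_c (cov_curvature d G e c b +
    cov_curvature d G c b e + cov_curvature d G b e c) a c); last first.
  apply: big1 => a _; apply: big1 => b _; rewrite big1 ?mulr0 // => c _.
  by rewrite cov_bianchi // mxE.
have term a b : \sum_c (cov_curvature d G e c b + cov_curvature d G c b e +
    cov_curvature d G b e c) a c =
    cov d G Rc e a b + \sum_c cov_curvature d G c b e a c - cov d G Rc b a e.
  rewrite !cov_ricci -sumrN -!big_split /=; apply: eq_bigr => c _.
  by rewrite (cov_curvatureC d G b e c) !(addmxE, oppmxE).
under [RHS]eq_bigr => a _ do (under eq_bigr => b _ do rewrite term !mulrDr;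
  rewrite !big_split /=).
rewrite !big_split /= -/(contract gi (cov d G Rc e)); congr (_ + _ + _).
  under [RHS]eq_bigr => a _ do under eq_bigr => b _ do rewrite big_distrr /=.
  transitivity (\sum_c \sum_b (gi *m cov_curvature d G c b e) b c); last first.
    rewrite [in RHS]exchange_big /=.
    under eq_bigr => c _ do under eq_bigr => b _ do rewrite mxE.
    rewrite [LHS]exchange_big /=; apply: eq_bigr => b _.
    rewrite exchange_big /=; apply: eq_bigr => a _; apply: eq_bigr => c _.
    by rewrite -{1}inv_metric_sym mxE.
  rewrite -sumrN; apply: eq_bigr => c _.
  under [RHS]eq_bigr => b _ do
    rewrite (raise_antisym (cov_curvature_antisym c b e)) mxE -sumrN.
  rewrite [RHS]exchange_big /= -sumrN; apply: eq_bigr => a _.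
  by rewrite covS sumrN -big_distrr /= -cov_ricci covS.
under [RHS]eq_bigr => a _ do under eq_bigr => b _ do rewrite mulrN.
rewrite exchange_big /= -sumrN; apply: eq_bigr => b _.
rewrite sumrN; congr (- _); apply: eq_bigr => a _.
by rewrite -{1}inv_metric_sym mxE covS.
Qed.

End LeviCivita.

(** * Change of coordinates *)

Lemma mulmx_inverse_unique (A : pzRingType) n (X Y Z : 'M[A]_n) :
  X *m Y = 1%:M -> Y *m Z = 1%:M -> X = Z.
Proof. by move=> XY YZ; rewrite -[X]mulmx1 -YZ mulmxA XY mul1mx. Qed.

Lemma congruence_inverse (A : comPzRingType) n (J Ji g gi : 'M[A]_n) :
  J *m Ji = 1%:M -> Ji *m J = 1%:M -> g *m gi = 1%:M ->
  (J *m g *m J^T) *m (Ji^T *m gi *m Ji) = 1%:M.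
Proof.
move=> JK JiK gK; have JT : J^T *m Ji^T = 1%:M by rewrite -trmx_mul JiK trmx1.
by rewrite !mulmxA -(mulmxA _ J^T) JT mulmx1 -(mulmxA J) gK mulmx1.
Qed.

Section ChangeOfFrame.
Variables (A : comPzRingType) (N : nat) (d d' : derivations A N).
Variables (J Ji : 'M[A]_N).
Hypothesis JK : J *m Ji = 1%:M.
Hypothesis JiK : Ji *m J = 1%:M.
Hypothesis der_frame : forall a x, d a x = \sum_b J a b * d' b x.
Hypothesis frame_closed : forall a b c, d a (J b c) = d b (J a c).

Lemma dmx_frame a m k (M : 'M[A]_(m, k)) :
  dmx d a M = \sum_b J a b *: dmx d' b M.
Proof.
apply/matrixP => i j; rewrite dmxE der_frame summxE.
by apply: eq_bigr => b _; rewrite scalemxE dmxE.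
Qed.

Variables (half : A) (g gi : 'M[A]_N).
Hypothesis halfE : half + half = 1.
Hypothesis gS : g^T = g.
Hypothesis gK : g *m gi = 1%:M.

Let H (G : 'I_N -> 'M[A]_N) a : 'M[A]_N := \sum_b J a b *: G b.
Let pull G a : 'M[A]_N := (J *m H G a + dmx d a J) *m Ji.

Let pull_torsion_free G : torsion_free G -> torsion_free (pull G).
Proof.
move=> Gs a b c; rewrite /pull ![(_ *m Ji) _ _]mxE; apply: eq_bigr => f _.
congr (_ * _); rewrite !addmxE !dmxE frame_closed; congr (_ + _).
have E x y : (J *m H G x) y f = \sum_e \sum_m J y e * J x m * G m e f.
  rewrite mxE; apply: eq_bigr => e _; rewrite summxE big_distrr /=.
  by apply: eq_bigr => m _; rewrite scalemxE mulrA.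
rewrite !E exchange_big /=; apply: eq_bigr => m _; apply: eq_bigr => e _.
by rewrite Gs (mulrC (J b e)).
Qed.

Let pull_metric G : metric_connection d' G g ->
  metric_connection d (pull G) (J *m g *m J^T).
Proof.
move=> Gg a; rewrite !dmxM dmx_frame /pull dmx_tr -dmx_frame.
have -> : dmx d a g = H G a *m g + g *m (H G a)^T.
  rewrite dmx_frame mulmx_suml linear_sum mulmx_sumr -big_split /=.
  apply: eq_bigr => b _; rewrite Gg linearZ /= -scalemxAl -scalemxAr.
  by rewrite scalerDr.
have -> : (J *m H G a + dmx d a J) *m Ji *m (J *m g *m J^T) =
    (J *m H G a + dmx d a J) *m g *m J^T.
  by rewrite !mulmxA -(mulmxA _ Ji J) JiK mulmx1.
have JT : J^T *m Ji^T = 1%:M by rewrite -trmx_mul JiK trmx1.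
rewrite trmx_mul trmxD trmx_mul !mulmxA -(mulmxA _ J^T) JT mulmx1.
rewrite !(mulmxDl, mulmxDr) !mulmxA; mxring.
Qed.

(** Gauge covariance of the curvature, the frame change acting on the
    connection matrices by G J = J H + dJ. *)
Let pull_curvature G a b :
  curvature d (pull G) a b *m J =
  J *m \sum_c \sum_e (J a c * J b e) *: curvature d' G c e.
Proof.
have pJ x : pull G x *m J = J *m H G x + dmx d x J.
  by rewrite /pull -mulmxA JiK mulmx1.
have -> : \sum_c \sum_e (J a c * J b e) *: curvature d' G c e =
    dmx d a (H G b) - dmx d b (H G a) - (H G a *m H G b - H G b *m H G a).
  have HH x y : H G x *m H G y = \sum_c \sum_e (J x c * J y e) *: (G c *m G e).
    rewrite /H mulmx_suml; apply: eq_bigr => c _; rewrite mulmx_sumr.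
    by apply: eq_bigr => e _; rewrite -scalemxAl -scalemxAr scalerA.
  have dH x y : dmx d x (H G y) = \sum_e d x (J y e) *: G e +
      \sum_c \sum_e (J x c * J y e) *: dmx d' c (G e).
    rewrite /H dmx_sum exchange_big -big_split /=; apply: eq_bigr => e _.
    rewrite dmxZ dmx_frame scaler_sumr; congr (_ + _).
    by apply: eq_bigr => c _; rewrite scalerA mulrC.
  have swap (F : 'I_N -> 'I_N -> 'M[A]_N) :
      \sum_c \sum_e (J b c * J a e) *: F c e = \sum_c \sum_e (J a c * J b e) *: F e c.
    rewrite exchange_big; apply: eq_bigr => c _; apply: eq_bigr => e _.
    by rewrite mulrC.
  rewrite !dH !HH !swap.
  rewrite (eq_bigr _ (fun e _ => congr1 (fun x => x *: G e) (frame_closed b a e))).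
  transitivity (\sum_c \sum_e (J a c * J b e) *: dmx d' c (G e)
      - \sum_c \sum_e (J a c * J b e) *: dmx d' e (G c)
      - (\sum_c \sum_e (J a c * J b e) *: (G c *m G e)
      - \sum_c \sum_e (J a c * J b e) *: (G e *m G c))); last mxring.
  rewrite -!sumrB; apply: eq_bigr => c _; rewrite -!sumrB; apply: eq_bigr => e _.
  by rewrite -!scalerBr.
have dpJ x y : dmx d x (pull G y) *m J = dmx d x J *m H G y +
    J *m dmx d x (H G y) + dmx d x (dmx d y J) - pull G y *m dmx d x J.
  by apply/eqP; rewrite eq_sym subr_eq -!dmxM pJ dmxD.
have ppJ x y : pull G x *m pull G y *m J =
    J *m H G x *m H G y + dmx d x J *m H G y + pull G x *m dmx d y J.
  by rewrite -mulmxA pJ mulmxDr mulmxA pJ mulmxDl.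
rewrite /curvature !(mulmxBl, mulmxBr) !ppJ !dpJ (dmxC d a b) !mulmxA.
move: (pull G) => P; mxring.
Qed.

Let ricci_pull G :
  ricci_mx d (pull G) = J *m ricci_mx d' G *m J^T.
Proof.
apply/matrixP => a b; rewrite mxE.
transitivity (\sum_c \sum_e \sum_f
    (J c e * J b f) * (J *m curvature d' G e f *m Ji) a c).
  apply: eq_bigr => c _.
  have -> : curvature d (pull G) c b = curvature d (pull G) c b *m J *m Ji.
    by rewrite -mulmxA JK mulmx1.
  rewrite pull_curvature mulmx_sumr mulmx_suml summxE; apply: eq_bigr => e _.
  rewrite mulmx_sumr mulmx_suml summxE; apply: eq_bigr => f _.
  by rewrite -scalemxAr -scalemxAl scalemxE.
rewrite exchange_big /=.
transitivity (\sum_e \sum_f J b f * (J *m curvature d' G e f) a e).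
  apply: eq_bigr => e _; rewrite exchange_big /=; apply: eq_bigr => f _.
  have -> : J *m curvature d' G e f = J *m curvature d' G e f *m Ji *m J.
    by rewrite -mulmxA JiK mulmx1.
  rewrite [in RHS]mxE big_distrr /=; apply: eq_bigr => c _.
  by rewrite -(mulmxA _ Ji J) JiK mulmx1; ring.
rewrite exchange_big /= mxE; apply: eq_bigr => f _.
rewrite -big_distrr /= mulrC trmxE; congr (_ * _).
under eq_bigr do rewrite mxE.
rewrite exchange_big mxE /=; apply: eq_bigr => h _.
by rewrite -big_distrr mxE.
Qed.

(** By uniqueness, the Levi-Civita connection of the pulled-back metric is the
    pulled-back connection. *)
Lemma ricci_mx_frame :
  ricci_mx d (levi_civita d half (J *m g *m J^T) (Ji^T *m gi *m Ji)) =
  J *m ricci_mx d' (levi_civita d' half g gi) *m J^T.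
Proof.
set G := levi_civita d' half g gi.
have Gs : torsion_free G := levi_civita_torsion_free d' half gi gS.
have Gg : metric_connection d' G g := levi_civita_metric d' halfE gS gK.
rewrite -ricci_pull /ricci_mx; apply/matrixP => a b; rewrite !mxE.
have E c : pull G c = levi_civita d half (J *m g *m J^T) (Ji^T *m gi *m Ji) c.
  apply: levi_civita_unique => //; last 2 first.
  - exact: pull_torsion_free.
  - exact: pull_metric.
  - by rewrite !trmx_mul trmxK gS mulmxA.
  exact: congruence_inverse.
by apply: eq_bigr => c _; rewrite /curvature !E.
Qed.

End ChangeOfFrame.

(** * Conformal change of metric *)

Section ConformalChange.
Variables (A : comPzRingType) (N : nat) (d : derivations A N).
Variables (half : A) (g gi : 'M[A]_N).
Hypothesis halfE : half + half = 1.
Hypothesis gS : g^T = g.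
Hypothesis gK : g *m gi = 1%:M.
Variable G : 'I_N -> 'M[A]_N.
Hypothesis Gs : torsion_free G.
Hypothesis Gg : metric_connection d G g.
Implicit Types y z : 'cV[A]_N.

Let giS : gi^T = gi := inv_metric_sym gS gK.
Let giK : gi *m g = 1%:M := inv_metricK gS gK.

Definition raise (gi : 'M[A]_N) z : 'rV[A]_N := z^T *m gi.

Definition sqnorm y : A := (raise gi y *m y) 0 0.

Definition grad_hess y (a : 'I_N) : 'cV[A]_N := dmx d a y - G a *m y.

(** delta^c_a z_b + delta^c_b z_a - g_{ab} z^c, the change of the Levi-Civita
    connection under g -> u g with d u = 2 u z. *)
Definition bump z (a : 'I_N) : 'M[A]_N :=
  z a 0 *: 1%:M + z *m row a 1%:M - col a g *m raise gi z.

Lemma bumpE z a b c :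
  bump z a b c = z a 0 * (b == c)%:R + z b 0 * (a == c)%:R - g a b * raise gi z 0 c.
Proof.
rewrite /bump !(addmxE, oppmxE) scalemxE !mxE !big_ord1 !mxE.
by rewrite -{1}gS mxE.
Qed.

Lemma sum_deltal (F : 'I_N -> A) a : \sum_c (a == c)%:R * F c = F a.
Proof.
rewrite (bigD1 a) //= eqxx mul1r big1 ?addr0 // => c ca.
by rewrite eq_sym (negPf ca) mul0r.
Qed.

Lemma sum_deltar (F : 'I_N -> A) a : \sum_c F c * (a == c)%:R = F a.
Proof. by rewrite -[RHS]sum_deltal; apply: eq_bigr => c _; rewrite mulrC. Qed.

Lemma lower_raise z a : \sum_c g a c * raise gi z 0 c = z a 0.
Proof.
transitivity ((g *m (raise gi z)^T) a 0).
  by rewrite mxE; apply: eq_bigr => c _; rewrite !mxE.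
by rewrite /raise trmx_mul trmxK giS mulmxA gK mul1mx.
Qed.

Lemma sqnormE y : sqnorm y = \sum_c y c 0 * raise gi y 0 c.
Proof. by rewrite /sqnorm mxE; apply: eq_bigr => c _; rewrite mulrC. Qed.

Lemma bump_torsion_free z : torsion_free (bump z).
Proof.
move=> a b c; rewrite !bumpE -[g b a]trmxE gS; ring.
Qed.

(** The metric and the identity being parallel, only y is differentiated; the sum
    accounts for the index b, on which the left-hand side does not act. It is
    symmetric in a and b and drops out of the curvature. *)
Lemma der_bump y a b :
  dmx d a (bump y b) - (G a *m bump y b - bump y b *m G a) =
  bump (grad_hess y a) b + \sum_f G a b f *: bump y f.
Proof.
have sumf k (F : 'M[A]_(N, k)) i j : (\sum_f G a b f *: row f F) i j = (row b (G a *m F)) i j.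
  rewrite summxE !mxE; apply: eq_bigr => f _; by rewrite !mxE.
have rowE : row b (1%:M : 'M[A]_N) *m G a = \sum_f G a b f *: row f 1%:M.
  by apply/matrixP => i j; rewrite sumf mulmx1 -row_mul mul1mx.
have colE : dmx d a (col b g) - G a *m col b g = \sum_f G a b f *: col f g.
  have cE : dmx d a (col b g) = col b (dmx d a g) by apply/matrixP => i j; rewrite !mxE.
  have -> : G a *m col b g = col b (G a *m g).
    by apply/matrixP => i j; rewrite !mxE; apply: eq_bigr => f _; rewrite mxE.
  rewrite cE Gg; apply/matrixP => i j.
  rewrite addmxE oppmxE [col _ (_ + _) i j]mxE addmxE [col b (_ *m g) i j]mxE.
  rewrite addrAC subrr add0r summxE mxE.
  by apply: eq_bigr => f _; rewrite !mxE mulrC.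
have raiseE : dmx d a (raise gi y) + raise gi y *m G a = raise gi (grad_hess y a).
  rewrite /raise dmxM (der_inv_metric gS gK Gg) dmx_tr /grad_hess !(trmxD, trmxN) trmx_mul.
  rewrite !(mulmxDl, mulmxDr, mulmxN, mulNmx) !mulmxA; mxring.
have yE : d a (y b 0) = grad_hess y a b 0 + \sum_f G a b f * y f 0.
  by rewrite /grad_hess addmxE oppmxE dmxE [(G a *m y) b 0]mxE subrK.
have -> : \sum_f G a b f *: bump y f = (\sum_f G a b f * y f 0) *: 1%:M +
    y *m (\sum_f G a b f *: row f 1%:M) - (\sum_f G a b f *: col f g) *m raise gi y.
  rewrite mulmx_sumr mulmx_suml scaler_suml -sumrN -!big_split /=.
  apply: eq_bigr => f _; rewrite /bump -scalemxAl -scalemxAr -scalerA; mxring.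
rewrite -rowE -colE /bump -raiseE !(dmxB, dmxD) !dmxM dmxZ dmx1 yE scaler0 addr0.
have -> : dmx d a (row b (1%:M : 'M[A]_N)) = 0.
  by apply/matrixP => i j; rewrite !mxE; case: (_ == _); rewrite ?der1 ?der0.
have dyE : dmx d a y = grad_hess y a + G a *m y by rewrite subrK.
rewrite dyE !(mulmxDl, mulmxDr, mulmxN, mulNmx) !mulmxA mulmx0 -!scalemxAl -!scalemxAr.
rewrite mulmx1 mul1mx !scalerDl addr0; mxring.
Qed.

Lemma curvature_bump y a b :
  curvature d (fun a => G a + bump y a) a b = curvature d G a b +
    bump (grad_hess y a) b - bump (grad_hess y b) a
    - (bump y a *m bump y b - bump y b *m bump y a).
Proof.
have Ea := der_bump y a b; have Eb := der_bump y b a.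
have S : \sum_f G b a f *: bump y f = \sum_f G a b f *: bump y f.
  by apply: eq_bigr => f _; rewrite Gs.
rewrite S in Eb.
apply/eqP; rewrite /curvature 2!(dmxD d _ (G _)).
have -> : bump (grad_hess y a) b = dmx d a (bump y b) -
    (G a *m bump y b - bump y b *m G a) - \sum_f G a b f *: bump y f.
  by rewrite Ea addrK.
have -> : bump (grad_hess y b) a = dmx d b (bump y a) -
    (G b *m bump y a - bump y a *m G b) - \sum_f G a b f *: bump y f.
  by rewrite Eb addrK.
move: (\sum_f _) (bump y a) (bump y b) => S0 Ba Bb; apply/eqP.
rewrite !(mulmxDl, mulmxDr). mxring.
Qed.

Lemma bump_mulE z (W : 'M[A]_N) a b c : (bump z a *m W) b c =
  z a 0 * W b c + z b 0 * W a c - g a b * (raise gi z *m W) 0 c.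
Proof.
rewrite mxE; under eq_bigr => f _ do rewrite bumpE mulrBl mulrDl -!mulrA.
rewrite sumrB big_split /= -!big_distrr /= !sum_deltal; congr (_ - _ * _).
by rewrite mxE.
Qed.

Lemma sum_bump z a : \sum_c bump z c a c = z a 0 *+ N.
Proof.
under eq_bigr => c _ do rewrite bumpE eqxx mulr1.
rewrite !big_split /= sumr_const card_ord.
rewrite sumrN; under [X in _ - X]eq_bigr => c _ do rewrite -{1}gS trmxE.
by rewrite lower_raise sum_deltar addrAC subrr add0r.
Qed.

Lemma trace_bump z b : \tr (bump z b) = z b 0 *+ N.
Proof.
rewrite -sum_bump; apply: eq_bigr => c _; exact: bump_torsion_free.
Qed.

Lemma raise_bump y b : raise gi y *m bump y b = sqnorm y *: row b 1%:M.
Proof.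
rewrite /bump mulmxDr mulmxN mulmxDr -scalemxAr mulmx1 !mulmxA.
have -> : raise gi y *m col b g = (y b 0)%:M.
  apply/matrixP => i j; rewrite !ord1 !mxE eqxx mulr1n.
  rewrite -[RHS]lower_raise; apply: eq_bigr => c _.
  by rewrite [col _ _ _ _]mxE mulrC -[g c b]trmxE gS.
rewrite mul_scalar_mx [_ *m y]mx11_scalar -/(sqnorm y) mul_scalar_mx.
by rewrite -scalemxAl addrAC subrr add0r.
Qed.

Lemma bump_self y a b :
  \sum_c bump y b a c * y c 0 = y a 0 * y b 0 + y a 0 * y b 0 - g a b * sqnorm y.
Proof.
under eq_bigr => c _ do rewrite bumpE mulrBl mulrDl -!mulrA.
rewrite sumrB big_split /= -!big_distrr /= !sum_deltal.
under [X in _ - _ * X]eq_bigr => c _ do rewrite mulrC.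
by rewrite -sqnormE -[g b a]trmxE gS; ring.
Qed.

(** For a symmetric nabla y this is the classical
    Ric - (N-2)(nabla y - y y) - (tr nabla y + (N-2)|y|^2) g. *)
Lemma ricci_bump y a b :
  ricci_mx d (fun a => G a + bump y a) a b = ricci_mx d G a b
  + grad_hess y a b 0 + grad_hess y b a 0
  - g a b * contract gi (\matrix_(c, e) grad_hess y c e 0)
  - grad_hess y b a 0 *+ N
  + (y a 0 * y b 0 - g a b * sqnorm y) *+ N
  - (y a 0 * y b 0 - g a b * sqnorm y) *+ 2.
Proof.
rewrite [LHS]mxE [ricci_mx d G a b]mxE.
transitivity (\sum_c (curvature d G c b a c + bump (grad_hess y c) b a c
    - bump (grad_hess y b) c a c - (bump y c *m bump y b) a c
    + (bump y b *m bump y c) a c)).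
  by apply: eq_bigr => c _; rewrite curvature_bump;
    move: (curvature d G c b) (bump y c) (bump y b) (bump (grad_hess y b) c)
     (bump (grad_hess y c) b) => *; rewrite !(addmxE, oppmxE); ring.
rewrite 4!big_split /= 2!sumrN sum_bump.
have -> : \sum_c bump (grad_hess y c) b a c = grad_hess y a b 0 +
    grad_hess y b a 0 - g a b * contract gi (\matrix_(c, e) grad_hess y c e 0).
  under eq_bigr => c _ do rewrite bumpE.
  rewrite sumrB big_split /= !sum_deltar; congr (_ - _).
  rewrite -big_distrr -[g b a]trmxE gS; congr (_ * _); apply: eq_bigr => c _.
  rewrite mxE; apply: eq_bigr => e _.
  by rewrite !mxE mulrC -{1}giS mxE.
have -> : \sum_c (bump y c *m bump y b) a c =
    (y a 0 * y b 0) *+ 2 - g a b * sqnorm y + (y a 0 * y b 0) *+ N - g a b * sqnorm y.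
  transitivity (\sum_c (bump y b a c * y c 0 + y a 0 * bump y b c c -
      g a c * (raise gi y *m bump y b) 0 c)).
    apply: eq_bigr => c _; rewrite bump_mulE -[g a c]trmxE gS; ring.
  rewrite sumrB big_split /= bump_self raise_bump -big_distrr /=.
  rewrite -[\sum_c bump y b c c]/(\tr _) trace_bump.
  under [X in _ - X]eq_bigr => c _ do rewrite !mxE mulrCA mulrA.
  rewrite sum_deltar; ring.
have -> : \sum_c (bump y b *m bump y c) a c =
    ((y a 0 * y b 0) *+ 2 - g a b * sqnorm y) *+ N.
  under eq_bigr => c _ do rewrite mxE.
  rewrite exchange_big /=; under eq_bigr => f _ do
    rewrite -big_distrr /= sum_bump mulrnAr.
  by rewrite sumrMnl bump_self -mulr2n.
ring.
Qed.

Lemma metric_bump (u : A) y : (forall a, d a u = (u * y a 0) *+ 2) ->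
  metric_connection d (fun a => G a + bump y a) (u *: g).
Proof.
move=> du a; rewrite dmxZ du Gg.
have -> : (G a + bump y a) *m (u *: g) + (u *: g) *m (G a + bump y a)^T =
  u *: (G a *m g + g *m (G a)^T) + u *: (bump y a *m g + g *m (bump y a)^T).
  rewrite -scalemxAl -scalemxAr -!scalerDr trmxD mulmxDl mulmxDr; congr (_ *: _); mxring.
have -> : bump y a *m g + g *m (bump y a)^T = (y a 0 *+ 2) *: g.
  have E : bump y a *m g = y a 0 *: g + y *m row a g - col a g *m y^T.
    rewrite /bump mulmxDl mulNmx mulmxDl -scalemxAl mul1mx -!mulmxA -row_mul mul1mx.
    by rewrite giK mulmx1.
  have -> : g *m (bump y a)^T = (bump y a *m g)^T by rewrite trmx_mul gS.
  rewrite E !(trmxD, trmxN) !trmx_mul trmxK linearZ /= gS tr_row tr_col gS; mxring.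
mxring.
Qed.

(** On trace-free tensors the divergence changes by N - 2 times a contraction
    with y only. *)
Lemma divergence_bump y (T : 'M[A]_N) a : T^T = T -> contract gi T = 0 ->
  divergence d gi (fun a => G a + bump y a) T a =
  divergence d gi G T a + (\sum_c T a c * raise gi y 0 c) *+ N
  - (\sum_c T a c * raise gi y 0 c) *+ 2.
Proof.
move=> TS T0; set w := \sum_c _ * _.
have tC i j : T i j = T j i by rewrite -[T i j]trmxE TS.
have giC i j : gi i j = gi j i by rewrite -[gi i j]trmxE giS.
have BT b i j : (bump y b *m T) i j =
    y b 0 * T i j + y i 0 * T b j - g b i * \sum_f T j f * raise gi y 0 f.
  rewrite bump_mulE [(raise gi y *m T) 0 j]mxE; congr (_ - _ * _).
  by apply: eq_bigr => f _; rewrite mulrC tC.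
have up c : \sum_b gi b c * y b 0 = raise gi y 0 c.
  by rewrite mxE; apply: eq_bigr => b _; rewrite mxE mulrC.
have C1 : \sum_b \sum_c gi b c * (bump y b *m T) a c = 0.
  transitivity (\sum_c \sum_b (gi b c * y b 0) * T a c
      + y a 0 * contract gi T - \sum_c (\sum_b gi b c * g b a) * (\sum_f T c f * raise gi y 0 f)).
    rewrite exchange_big /contract [X in _ + _ * X]exchange_big big_distrr -big_split -sumrB /=.
    apply: eq_bigr => c _; rewrite big_distrr big_distrl -big_split -sumrB /=.
    by apply: eq_bigr => b _; rewrite BT; ring.
  rewrite T0 mulr0 addr0 -/w.
  have -> : \sum_c (\sum_b gi b c * g b a) * (\sum_f T c f * raise gi y 0 f) = w.
    transitivity (\sum_c (a == c)%:R * (\sum_f T c f * raise gi y 0 f)); last exact: sum_deltal.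
    apply: eq_bigr => c _; congr (_ * _); transitivity ((gi *m g) c a).
      by rewrite mxE; apply: eq_bigr => b _; rewrite giC.
    by rewrite giK mxE eq_sym.
  rewrite (_ : \sum_c _ = w) ?subrr //; apply: eq_bigr => c _.
  by rewrite -big_distrl /= up mulrC.
have C2 : \sum_b \sum_c gi b c * (T *m (bump y b)^T) a c = w *+ 2 - w *+ N.
  have TB b c : (T *m (bump y b)^T) a c = (bump y b *m T) c a.
    by rewrite -[RHS]trmxE trmx_mul TS.
  transitivity (\sum_c \sum_b (gi b c * y b 0) * T a c + \sum_b \sum_c (gi c b * y c 0) * T a b
      - \sum_b (\sum_c gi b c * g c b) * w).
    rewrite [X in X + _ - _]exchange_big -big_split -sumrB /=.
    apply: eq_bigr => b _; rewrite big_distrl -big_split -sumrB /=.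
    apply: eq_bigr => c _; rewrite TB BT (tC c a) (tC b a) (giC c b) -/w.
    by rewrite -[g c b]trmxE gS; ring.
  have -> : \sum_c \sum_b gi b c * y b 0 * T a c = w.
    by apply: eq_bigr => c _; rewrite -big_distrl /= up mulrC.
  have -> : \sum_b (\sum_c gi b c * g c b) * w = w *+ N.
    rewrite -[RHS]mulr_natl; rewrite -big_distrl /=; congr (_ * _).
    transitivity (\tr (gi *m g)); last by rewrite giK mxtrace1.
    by apply: eq_bigr => b _; rewrite mxE.
  by rewrite mulr2n.
have E : divergence d gi (fun a => G a + bump y a) T a = divergence d gi G T a
    - \sum_b \sum_c gi b c * (bump y b *m T) a c
    - \sum_b \sum_c gi b c * (T *m (bump y b)^T) a c.
  rewrite /divergence -!sumrB; apply: eq_bigr => b _; rewrite -!sumrB.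
  apply: eq_bigr => c _; rewrite /cov trmxD mulmxDl mulmxDr !(addmxE, oppmxE); ring.
by rewrite E C1 C2; ring.
Qed.

End ConformalChange.

(** * Calculus in R^N *)

Lemma differentiable_near (R : realType) (V W : normedModType R) (f : V -> W)
    (df : {linear V -> W}) x : continuous df ->
  (forall eps : R, 0 < eps ->
     \forall h \near 0, `|f (h + x) - (f x + df h)| <= eps * `|h|) ->
  differentiable f x.
Proof.
move=> dfc H; suff E : f \o shift x = cst (f x) + df +o_ 0 id.
  by apply/diff_locallyP; rewrite (diff_unique dfc E).
by apply/eqaddoP => eps eps0; exact: H.
Qed.

Section Differentiability.
Context {R : realType} {N : nat}.
Implicit Types (f : 'rV[R]_N -> R) (x v : 'rV[R]_N) (U : set 'rV[R]_N).

Lemma line_is_derive f x v (t : R) : derivable f (x + t *: v) v ->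
  is_derive t 1 (fun s => f (x + s *: v)) ('D_v f (x + t *: v)).
Proof.
move=> df.
have E : (fun h : R => h^-1 *: (((fun s => f (x + s *: v)) \o shift t) (h *: 1) -
    f (x + t *: v))) =
    (fun h => h^-1 *: ((f \o shift (x + t *: v)) (h *: v) - f (x + t *: v))).
  apply/funext => h /=; congr (_ *: (f _ - _)).
  by rewrite [h *: 1]mulr1 scalerDl addrCA.
by apply: DeriveDef; rewrite /derivable /derive /= E.
Qed.

Lemma mean_value_line f x v (c : R) :
  (forall s : R, `|s| <= `|c| -> derivable f (x + s *: v) v) ->
  exists2 s : R, `|s| <= `|c| & f (x + c *: v) - f x = c * 'D_v f (x + s *: v).
Proof.
move=> df; pose phi (s : R) := f (x + s *: v).
pose dphi (s : R) : R := 'D_v f (x + s *: v).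
have phi0 : phi 0 = f x by rewrite /phi scale0r addr0.
have dphiE (s : R) : `|s| <= `|c| -> is_derive s (1 : R) phi (dphi s).
  by move=> sc; apply: line_is_derive; apply: df.
have cont (a b : R) : (forall s, s \in `[a, b] -> `|s| <= `|c|) ->
    {within `[a, b], continuous phi}.
  move=> ab; apply: derivable_within_continuous => s /ab /dphiE ds.
  exact: ex_derive.
have [c0|c0] := leP 0 c.
  have inc s : s \in `[0, c] -> `|s| <= `|c|.
    by rewrite in_itv /= => /andP[s0 sc]; rewrite !ger0_norm.
  have [||s sc E] := MVT_segment (f := phi) (df := dphi) c0.
  - move=> s sc; apply: dphiE; apply: inc; exact: subset_itv_oo_cc.
  - exact: cont.
  by exists s; [exact: inc | rewrite -phi0 -/(phi c) E subr0 mulrC].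
have inc s : s \in `[c, 0] -> `|s| <= `|c|.
  by rewrite in_itv /= => /andP[sc s0]; rewrite !ler0_norm ?lerN2 // ltW.
have [||s sc E] := MVT_segment (f := phi) (df := dphi) (ltW c0).
- move=> s sc; apply: dphiE; apply: inc; exact: subset_itv_oo_cc.
- exact: cont.
exists s; first exact: inc.
by rewrite -phi0 -/(phi c) -opprB E sub0r mulrN opprK mulrC.
Qed.

Lemma row_norm_le v (r : R) : 0 <= r -> (forall j, `|v 0 j| <= r) -> `|v| <= r.
Proof.
move=> r0 H; rewrite [leLHS]/Num.Def.normr /= mx_normrE.
by apply: bigmax_le => // -[i j] _ /=; rewrite (ord1 i).
Qed.

Lemma coord_norm_le v j : `|v 0 j| <= `|v|.
Proof.
rewrite [leRHS]/Num.Def.normr /= mx_normrE.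
exact: (le_bigmax _ (fun i : 'I_1 * 'I_N => `|v i.1 i.2|) (0, j)).
Qed.

Definition linear_form (c : 'I_N -> R) (h : 'rV[R]_N) : R := \sum_a h 0 a * c a.

Lemma linear_form_is_linear c : linear (linear_form c).
Proof.
move=> k u v; rewrite /linear_form scaler_sumr -big_split /=.
by apply: eq_bigr => a _; rewrite !mxE mulrDl -mulrA.
Qed.

HB.instance Definition _ c := GRing.isLinear.Build R 'rV[R]_N R _
  (linear_form c) (linear_form_is_linear c).

Lemma linear_form_continuous c : continuous (linear_form c).
Proof.
move=> x; rewrite /linear_form.
have -> : (fun h : 'rV[R]_N => \sum_a h 0 a * c a) =
    \sum_a (fun h : 'rV[R]_N => h 0 a * c a).
  by apply/funext => h; rewrite fct_sumE.
apply: (big_ind (fun g : 'rV[R]_N -> R => {for x, continuous g})).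
- exact: cst_continuous.
- by move=> g1 g2 c1 c2; apply: continuousD.
move=> a _; apply: continuousM; last exact: cst_continuous.
exact: matrix_normedtype.coord_continuous.
Qed.

(** The increment is a sum of increments parallel to the axes, to each of which
    the mean value theorem applies. *)
Lemma C1_differentiable U f x : open U -> U x ->
  (forall a y, U y -> derivable f y (delta_mx 0 a)) ->
  (forall a, {for x, continuous ('D_(delta_mx 0 a) f)}) ->
  differentiable f x.
Proof.
move=> Uo Ux df dc.
pose c (a : 'I_N) : R := 'D_(delta_mx 0 a) f x.
apply: (differentiable_near (@linear_form_continuous c)) => eps eps0.
have e0 : 0 < eps / N.+1%:R by rewrite divr_gt0.
have : \forall y \near x, U y /\ forall a : 'I_N, `|c a - 'D_(delta_mx 0 a) f y| <= eps / N.+1%:R.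
  apply: filterI; first exact: open_nbhs_nbhs.
  have H (a : 'I_N) : \forall y \near x, `|c a - 'D_(delta_mx 0 a) f y| <= eps / N.+1%:R.
    by have /cvgrPdist_le/(_ _ e0) := dc a.
  exact: (@filter_forall _ 'I_N _ _ _ H).
case/nbhs_ballP => r /= r0 Hr; apply/nbhs_ballP; exists r => //= h hr.
have {}hr : `|h| < r by rewrite -ball_normE /= sub0r normrN in hr.
(* the first k coordinates of the increment *)
pose tr k : 'rV[R]_N := \row_j (if (j < k)%N then h 0 j else 0).
have close k (s : R) (a : 'I_N) : nat_of_ord a = k -> `|s| <= `|h 0 a| ->
    ball x r (x + tr k + s *: delta_mx 0 a).
  move=> ak sa; rewrite -ball_normE /= -addrA opprD addrA subrr sub0r normrN.
  apply: le_lt_trans hr; apply: row_norm_le => // j; rewrite !mxE eqxx /=.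
  have [->|ja] := eqVneq j a.
    by rewrite ak ltnn add0r mulr1 (le_trans sa) // coord_norm_le.
  rewrite mulr0 addr0; case: ifP => _; rewrite ?normr0 //; exact: coord_norm_le.
have trS (a : 'I_N) : tr a.+1 = tr a + h 0 a *: delta_mx 0 a.
  apply/rowP => j; rewrite !mxE eqxx /= ltnS leq_eqVlt.
  have [/val_inj ->|ja] /= := eqVneq (j : nat) a.
    by rewrite eqxx ltnn add0r mulr1.
  by rewrite (_ : (j == a) = false) ?mulr0 ?addr0 //; apply/negP => /eqP ja'; rewrite ja' eqxx in ja.
have step (a : 'I_N) : `|f (x + tr a.+1) - f (x + tr a) - h 0 a * c a| <=
    eps / N.+1%:R * `|h|.
  have [s sa E] := @mean_value_line f (x + tr a) (delta_mx 0 a) (h 0 a)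
    (fun s sa => df a _ (Hr _ (close _ s a erefl sa)).1).
  rewrite trS addrA E -mulrBr normrM mulrC; apply: ler_pM => //.
    by have [_] := Hr _ (close _ s a erefl sa); rewrite distrC; apply.
  exact: coord_norm_le.
have trN : tr N = h by apply/rowP => j; rewrite mxE ltn_ord.
have tr0 : tr 0%N = 0 by apply/rowP => j; rewrite !mxE.
rewrite (_ : f (h + x) - (f x + linear_form c h) =
    \sum_(a < N) (f (x + tr a.+1) - f (x + tr a) - h 0 a * c a)); last first.
  rewrite sumrB -(big_mkord xpredT (fun k => f (x + tr k.+1) - f (x + tr k))).
  rewrite telescope_sumr // trN tr0 addr0 (addrC h).
  by rewrite opprD addrA.
apply: le_trans (ler_norm_sum _ _ _) _.
apply: le_trans (ler_sum _ (fun a _ => step a)) _.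
rewrite sumr_const card_ord -[leLHS]mulr_natr mulrAC.
have {2}-> : eps = eps / N.+1%:R * N.+1%:R by rewrite divfK.
rewrite ler_wpM2r //.
by rewrite ler_wpM2l ?ler_nat ?ltW.
Qed.


Lemma diff_partials f x v : differentiable f x ->
  'd f x v = \sum_b v 0 b * 'D_(delta_mx 0 b) f x.
Proof.
move=> df; rewrite [in LHS](row_sum_delta v) linear_sum; apply: eq_bigr => b _.
by rewrite linearZ /= deriveE.
Qed.

Lemma row_function_sum (phi : 'rV[R]_N -> 'rV[R]_N) :
  phi = \sum_b (fun x => phi x 0 b *: delta_mx 0 b).
Proof. by apply/funext => x; rewrite fct_sumE {1}(row_sum_delta (phi x)). Qed.

Lemma differentiable_row (phi : 'rV[R]_N -> 'rV[R]_N) x :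
  (forall b, differentiable (fun y => phi y 0 b) x) -> differentiable phi x.
Proof.
move=> dphi; rewrite (row_function_sum phi); apply: differentiable_sum => b.
exact: differentiableZl.
Qed.

Lemma derive_comp_row f (phi : 'rV[R]_N -> 'rV[R]_N) x v :
  (forall b, differentiable (fun y => phi y 0 b) x) -> differentiable f (phi x) ->
  'D_v (f \o phi) x =
    \sum_b 'D_v (fun y => phi y 0 b) x * 'D_(delta_mx 0 b) f (phi x).
Proof.
move=> dphi df; have dp := differentiable_row dphi.
rewrite deriveE; last exact: differentiable_comp.
rewrite diff_comp //= diff_partials //; apply: eq_bigr => b _; congr (_ * _).
by rewrite -deriveE // derive_mx ?mxE //; exact: diff_derivable.
Qed.

End Differentiability.

Section ContinuousDifferentiability.
Context {R : realType} {N : nat}.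
Implicit Types (f g : 'rV[R]_N -> R) (U V : set 'rV[R]_N).
Local Notation e_ a := (delta_mx 0 a : 'rV[R]_N).

Lemma Ck_continuous k U f x : Ck k U f -> U x -> {for x, continuous f}.
Proof. by case: k => [|k] [H _]; apply: H. Qed.

Lemma Ck_derivable k U f a x : Ck k.+1 U f -> U x -> derivable f x (e_ a).
Proof. by move=> [_ /(_ a)[H _]]; apply: H. Qed.

Lemma Ck_partial k U f a : Ck k.+1 U f -> Ck k U (fun x => 'D_(e_ a) f x).
Proof. by move=> [_ /(_ a)[]]. Qed.

Lemma CkW k U f : Ck k.+1 U f -> Ck k U f.
Proof.
elim: k f => [|k IH] f [fc fd]; first by split.
by split => // a; have [da /IH] := fd a.
Qed.

Lemma Ck_subset k U V f : V `<=` U -> Ck k U f -> Ck k V f.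
Proof.
move=> VU; elim: k f => [|k IH] f [fc fd]; split.
- by move=> x /VU /fc.
- by [].
- by move=> x /VU /fc.
- by move=> a; have [da /IH] := fd a; split => // x /VU /da.
Qed.

Lemma near_open U f g x : open U -> U x -> {in U, f =1 g} -> \near x, f x = g x.
Proof.
move=> Uo Ux fg; have : nbhs x U by exact: open_nbhs_nbhs.
by apply: filterS => y Uy; apply: fg; rewrite inE.
Qed.

Lemma Ck_ext k U f g : open U -> {in U, f =1 g} -> Ck k U f -> Ck k U g.
Proof.
move=> Uo; elim: k f g => [|k IH] f g fg [fc fd].
  split=> // x Ux; have Ng := near_open Uo Ux fg.
  rewrite /prop_for /continuous_at -(nbhs_singleton Ng).
  by apply: cvg_trans _ (fc x Ux); apply: near_eq_cvg Ng.
split.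
  move=> x Ux; have Ng := near_open Uo Ux fg.
  rewrite /prop_for /continuous_at -(nbhs_singleton Ng).
  by apply: cvg_trans _ (fc x Ux); apply: near_eq_cvg Ng.
move=> a; have [da Da] := fd a; split.
  by move=> x Ux; apply: near_eq_derivable (near_open Uo Ux fg) (da x Ux).
apply: IH Da => x; rewrite inE => Ux; apply: near_eq_derive.
exact: near_open Uo Ux fg.
Qed.

Lemma Ck_cst k U (c : R) : Ck k U (fun=> c).
Proof.
have cc (c' : R) (x : 'rV[R]_N) : {for x, continuous (fun _ : 'rV[R]_N => c')}.
  exact: cst_continuous.
elim: k c => [|k IH] c; split=> // a; split; first by move=> x _; exact: derivable_cst.
have -> : (fun x => 'D_(e_ a) (fun=> c) x) = (fun=> 0) => //.
by apply/funext => x; rewrite (derive_cst c).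
Qed.

Lemma CkD k U f g : open U -> Ck k U f -> Ck k U g -> Ck k U (fun x => f x + g x).
Proof.
move=> Uo; elim: k f g => [|k IH] f g [fc fd] [gc gd].
  by split=> // x Ux; apply: continuousD; [exact: fc | exact: gc].
split; first by move=> x Ux; apply: continuousD; [exact: fc | exact: gc].
move=> a; have [fda fDa] := fd a; have [gda gDa] := gd a; split.
  by move=> x Ux; apply: derivableD; [exact: fda | exact: gda].
apply: (Ck_ext (f := fun x => 'D_(e_ a) f x + 'D_(e_ a) g x)) => //.
  by move=> x; rewrite inE => Ux; rewrite deriveD //; [exact: fda | exact: gda].
exact: IH.
Qed.

Lemma CkM k U f g : open U -> Ck k U f -> Ck k U g -> Ck k U (fun x => f x * g x).
Proof.
move=> Uo; elim: k f g => [|k IH] f g Cf Cg.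
  by split=> // x Ux; apply: continuousM; [exact: Ck_continuous Cf Ux | exact: Ck_continuous Cg Ux].
split; first by move=> x Ux; apply: continuousM;
  [exact: Ck_continuous Cf Ux | exact: Ck_continuous Cg Ux].
move=> a; split.
  by move=> x Ux; apply: derivableM; [exact: Ck_derivable Cf Ux | exact: Ck_derivable Cg Ux].
apply: (Ck_ext (f := fun x => f x * 'D_(e_ a) g x + g x * 'D_(e_ a) f x)) => //.
  move=> x; rewrite inE => Ux; rewrite [RHS]deriveM //.
  - exact: Ck_derivable Cf Ux.
  - exact: Ck_derivable Cg Ux.
by apply: CkD => //; apply: IH; (exact: CkW || exact: Ck_partial).
Qed.

Lemma CkN k U f : open U -> Ck k U f -> Ck k U (fun x => - f x).
Proof.
move=> Uo Cf; apply: (Ck_ext (f := fun x => -1 * f x)) => //.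
  by move=> x _; rewrite mulN1r.
by apply: CkM => //; exact: Ck_cst.
Qed.

Lemma CkV k U f : open U -> (forall x, U x -> f x != 0) -> Ck k U f ->
  Ck k U (fun x => (f x)^-1).
Proof.
move=> Uo f0; elim: k => [|k IH] Cf.
  by split=> // x Ux; apply: continuousV; [exact: f0 | exact: Ck_continuous Cf Ux].
split; first by move=> x Ux; apply: continuousV; [exact: f0 | exact: Ck_continuous Cf Ux].
move=> a; split.
  by move=> x Ux; apply: derivableV; [exact: f0 | exact: Ck_derivable Cf Ux].
have Ci := IH (CkW Cf).
apply: (Ck_ext (f := fun x => - ((f x)^-1 * (f x)^-1) * 'D_(e_ a) f x)) => //.
  move=> x; rewrite inE => Ux; rewrite deriveV ?f0 //; last exact: Ck_derivable Cf Ux.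
  by rewrite -invfM -expr2.
by apply: CkM; [|apply: CkN => //; exact: CkM | exact: Ck_partial].
Qed.

Lemma Ck_differentiable k U f x : open U -> Ck k.+1 U f -> U x -> differentiable f x.
Proof.
move=> Uo Cf Ux; apply: (C1_differentiable Uo Ux).
  by move=> a y Uy; exact: Ck_derivable Cf Uy.
by move=> a; exact: Ck_continuous (Ck_partial a Cf) Ux.
Qed.

Lemma Ck_sum k U (I : finType) (P : pred I) (F : I -> 'rV[R]_N -> R) : open U ->
  (forall i, P i -> Ck k U (F i)) -> Ck k U (fun x => \sum_(i | P i) F i x).
Proof.
move=> Uo CF.
have -> : (fun x => \sum_(i | P i) F i x) = \sum_(i | P i) F i.
  by apply/funext => x; rewrite fct_sumE.
by elim/big_ind: _ => [|f g Cf Cg|//]; [exact: Ck_cst | exact: CkD].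
Qed.

Lemma Ck_comp k U V f (phi : 'rV[R]_N -> 'rV[R]_N) : open U -> open V ->
  (forall x, U x -> V (phi x)) -> (forall b, smooth U (fun x => phi x 0 b)) ->
  Ck k V f -> Ck k U (f \o phi).
Proof.
move=> Uo Vo UV sphi.
have dphi x b : U x -> differentiable (fun y => phi y 0 b) x.
  by move=> Ux; exact: Ck_differentiable Uo (sphi b 1%N) Ux.
have phic x : U x -> {for x, continuous phi}.
  by move=> Ux; apply/differentiable_continuous/differentiable_row => b; exact: dphi.
elim: k f => [|k IH] f Cf.
  split=> // x Ux; apply: continuous_comp; first exact: phic.
  by apply: Ck_continuous Cf _; exact: UV.
have df x : U x -> differentiable f (phi x).
  by move=> Ux; apply: Ck_differentiable Vo Cf _; exact: UV.
split.
  move=> x Ux; apply: continuous_comp; first exact: phic.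
  by apply: Ck_continuous Cf _; exact: UV.
move=> a; split.
  move=> x Ux; apply: diff_derivable; apply: differentiable_comp; last exact: df.
  by apply: differentiable_row => b; exact: dphi.
apply: (Ck_ext (f := fun x => \sum_b 'D_(e_ a) (fun y => phi y 0 b) x *
   ((fun y => 'D_(e_ b) f y) \o phi) x)) => //.
  move=> x; rewrite inE => Ux; rewrite derive_comp_row //; last exact: df.
  by move=> b; exact: dphi.
apply: Ck_sum => // b _; apply: CkM => //.
  exact: Ck_partial (sphi b k.+1).
by apply: IH; exact: Ck_partial.
Qed.

End ContinuousDifferentiability.

Section SecondDerivatives.
Context {R : realType} {N : nat}.
Implicit Types (f : 'rV[R]_N -> R) (U : set 'rV[R]_N) (x y v : 'rV[R]_N).
Local Notation e_ a := (delta_mx 0 a : 'rV[R]_N).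

Lemma shift_is_derive f y v w : derivable f (y + w) v ->
  is_derive y v (fun z => f (z + w)) ('D_v f (y + w)).
Proof.
move=> df; have E : (fun h : R => h^-1 *: (((fun z => f (z + w)) \o shift y) (h *: v) -
    f (y + w))) =
    (fun h => h^-1 *: ((f \o shift (y + w)) (h *: v) - f (y + w))).
  by apply/funext => h /=; rewrite addrA.
by apply: DeriveDef; rewrite /derivable /derive /= E.
Qed.

Lemma norm_axis (s : R) a : `|s *: e_ a| <= `|s|.
Proof.
apply: row_norm_le => // j; rewrite !mxE eqxx /=.
by case: (_ == _); rewrite ?mulr1 ?mulr0 ?normr0.
Qed.

(** The second difference of [f] over a square of side [t] is t^2 times a
    second derivative at a point of the square: two applications of the mean
    value theorem, the order of which gives the order of the derivatives. *)
Lemma second_difference U f x a b (r t : R) :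
  (forall y, `|y - x| < r -> U y) -> Ck 2 U f -> `|t| < r / 2 ->
  exists2 y, `|y - x| <= `|t| *+ 2 &
    f (x + t *: e_ a + t *: e_ b) - f (x + t *: e_ a) - (f (x + t *: e_ b) - f x) =
    t * (t * 'D_(e_ b) (fun z => 'D_(e_ a) f z) y).
Proof.
move=> rU Cf tr; pose psi z := f (z + t *: e_ b) - f z.
have near2 (s s' : R) : `|s| <= `|t| -> `|s'| <= `|t| ->
    `|x + s *: e_ a + s' *: e_ b - x| <= `|t| *+ 2.
  move=> st st'; rewrite addrAC (addrAC x) subrr add0r; apply: le_trans (ler_normD _ _) _.
  by rewrite mulr2n lerD // (le_trans (norm_axis _ _)).
have t2r : `|t| *+ 2 < r by rewrite -mulr_natr -ltr_pdivlMr.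
have inU (s s' : R) : `|s| <= `|t| -> `|s'| <= `|t| -> U (x + s *: e_ a + s' *: e_ b).
  by move=> st st'; apply: rU; apply: le_lt_trans t2r; exact: near2.
have inU0 (s : R) : `|s| <= `|t| -> U (x + s *: e_ a).
  move=> st; have := inU s 0 st; rewrite scale0r addr0 normr0; exact.
have dpsi (s : R) : `|s| <= `|t| -> is_derive (x + s *: e_ a) (e_ a) psi
    ('D_(e_ a) f (x + s *: e_ a + t *: e_ b) - 'D_(e_ a) f (x + s *: e_ a)).
  move=> st; apply: is_deriveB.
    apply: shift_is_derive; exact: Ck_derivable Cf (inU s t st (lexx _)).
  apply: derivableP; exact: Ck_derivable Cf (inU0 _ st).
have [s st Es] := @mean_value_line _ _ psi x (e_ a) t (fun s st => @ex_derive _ _ _ _ _ _ _ (dpsi s st)).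
have [s' st' Es'] := @mean_value_line _ _ (fun z => 'D_(e_ a) f z) (x + s *: e_ a) (e_ b) t
  (fun s' st' => Ck_derivable (Ck_partial a Cf) (inU s s' st st')).
exists (x + s *: e_ a + s' *: e_ b); first exact: near2.
rewrite -Es' -[LHS]/(psi (x + t *: e_ a) - psi x) Es; congr (_ * _).
exact: (@derive_val _ _ _ _ _ _ _ (dpsi s st)).
Qed.

Lemma schwarz U f x a b : open U -> Ck 2 U f -> U x ->
  'D_(e_ a) (fun z => 'D_(e_ b) f z) x = 'D_(e_ b) (fun z => 'D_(e_ a) f z) x.
Proof.
move=> Uo Cf Ux.
pose A z := 'D_(e_ b) (fun z => 'D_(e_ a) f z) z.
pose B z := 'D_(e_ a) (fun z => 'D_(e_ b) f z) z.
have cA : {for x, continuous A} := Ck_continuous (Ck_partial b (Ck_partial a Cf)) Ux.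
have cB : {for x, continuous B} := Ck_continuous (Ck_partial a (Ck_partial b Cf)) Ux.
apply/eqP; rewrite -subr_eq0 -normr_le0 -/(A x) -/(B x).
apply/ler_addgt0Pr => eps eps0; rewrite add0r.
have e0 : 0 < eps / 2 by rewrite divr_gt0.
have : \forall y \near x, [/\ U y, `|A x - A y| <= eps / 2 & `|B x - B y| <= eps / 2].
  have NA : \forall y \near x, `|A x - A y| <= eps / 2 by move/cvgrPdist_le: cA; apply.
  have NB : \forall y \near x, `|B x - B y| <= eps / 2 by move/cvgrPdist_le: cB; apply.
  have NU : nbhs x U by exact: open_nbhs_nbhs.
  by apply: filterS3 NU NA NB => y; split.
case/nbhs_ballP => r /= r0 Hr.
have {}Hr y : `|y - x| < r -> [/\ U y, `|A x - A y| <= eps / 2 & `|B x - B y| <= eps / 2].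
  by move=> yx; apply: Hr; rewrite -ball_normE /= distrC.
have rU y : `|y - x| < r -> U y by case/Hr.
have t0 : 0 < r / 4 by rewrite divr_gt0.
have tr : `|r / 4| < r / 2 by rewrite gtr0_norm // ltr_pM2l // ltf_pV2 ?posrE // ltr_nat.
have tr2 : `|r / 4| *+ 2 < r by rewrite -[ltLHS]mulr_natr -ltr_pdivlMr.
have [y yx Ey] := @second_difference U f x a b r (r / 4) rU Cf tr.
have [z zx Ez] := @second_difference U f x b a r (r / 4) rU Cf tr.
have [_ Ay _] := Hr _ (le_lt_trans yx tr2); have [_ _ Bz] := Hr _ (le_lt_trans zx tr2).
have AB : A y = B z.
  apply: (mulfI (lt0r_neq0 t0)); apply: (mulfI (lt0r_neq0 t0)).
  have swap (k l m o : R) : k - l - (m - o) = k - m - (l - o) by ring.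
  by apply: etrans (esym Ey) (etrans _ Ez); rewrite (addrAC x (_ *: e_ a)); exact: swap.
have tri (a1 b1 a2 b2 e : R) : `|a1 - a2| <= e / 2 -> `|b1 - b2| <= e / 2 ->
    a2 = b2 -> `|b1 - a1| <= e.
  move=> ha hb E; have -> : b1 - a1 = (b1 - b2) - (a1 - a2) by rewrite E; ring.
  by apply: le_trans (ler_normB _ _) _; rewrite [leRHS]splitr lerD.
exact: tri Ay Bz AB.
Qed.

Lemma zero_gradient_constant U f x : open U -> Ck 1 U f -> U x ->
  (forall a y, U y -> 'D_(e_ a) f y = 0) -> \forall y \near x, f y = f x.
Proof.
move=> Uo Cf Ux f0; have : nbhs x U by exact: open_nbhs_nbhs.
case/nbhs_ballP => r /= r0 Hr; apply/nbhs_ballP; exists r => //= y xy.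
have inU (s : R) : `|s| <= `|1 : R| -> U (x + s *: (y - x)).
  rewrite normr1 => s1; apply: Hr; rewrite -ball_normE /= opprD addNKr normrN normrZ.
  apply: le_lt_trans (_ : `|y - x| < r); first by rewrite ler_piMl.
  by rewrite distrC; rewrite -ball_normE in xy.
have df (s : R) : `|s| <= `|1 : R| -> differentiable f (x + s *: (y - x)).
  by move=> s1; exact: Ck_differentiable Uo Cf (inU s s1).
have [s s1] := mean_value_line (fun s s1 => diff_derivable (v := y - x) (df s s1)).
rewrite scale1r subrKC deriveE ?diff_partials; try exact: df.
rewrite big1 ?mulr0 => [/eqP|b _]; first by rewrite subr_eq0 => /eqP.
by rewrite f0 ?mulr0 //; exact: inU.
Qed.

End SecondDerivatives.

(** * Smooth functions on coordinate patches *)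

Section Charts.
Context {R : realType} {N : nat} {M : oriented_manifold R N}.
Implicit Types (i j : chart M) (D W : set M) (f g : M -> R).
Local Notation e_ a := (delta_mx 0 a : 'rV[R]_N).

Lemma open_image i W : open W -> open (coord i @` (dom i `&` W)).
Proof.
move=> Wo; have -> : coord i @` (dom i `&` W) =
    coord i @` dom i `&` [set x | nbhs x (param i @^-1` W)].
  apply/seteqP; split => [x [p [ip Wp] <-]|x [[p ip <-]] /= Wp].
    split; first by exists p.
    apply: (@param_continuous _ _ M i p ip); rewrite coordK //.
    exact: open_nbhs_nbhs.
  by exists p => //; split => //; have := nbhs_singleton Wp; rewrite /= coordK.
by apply: openI; [exact: image_open | exact: open_interior].
Qed.

Lemma smooth_in_chart_subset D W i f : W `<=` D -> smooth_in_chart D i f ->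
  smooth_in_chart W i f.
Proof.
move=> WD sf k; apply: Ck_subset (sf k).
by move=> x [p [ip /WD Dp] <-]; exists p.
Qed.

Lemma smooth_change_chart W i j f : open W -> W `<=` dom i ->
  smooth_in_chart W i f -> smooth_in_chart W j f.
Proof.
move=> Wo Wi sf k.
have Uo : open (coord j @` (dom j `&` W)) by exact: open_image.
have Vo : open (coord i @` (dom i `&` W)) by exact: open_image.
apply: (Ck_ext (f := (f \o param i) \o (fun x => coord i (param j x)))) => //.
  move=> x; rewrite inE => -[p [jp Wp] <-] /=.
  by rewrite !coordK //; exact: Wi.
apply: (Ck_comp Uo Vo) (sf k).
  move=> x [p [jp Wp] <-]; rewrite coordK //.
  by exists p => //; split => //; exact: Wi.
move=> b l; apply: Ck_subset (@transition_smooth _ _ M j i b l).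
by move=> x [p [jp Wp] <-]; exists p => //; split => //; exact: Wi.
Qed.

Lemma near_pd i a f g p : dom i p -> (\forall q \near p, f q = g q) ->
  pd i a f p = pd i a g p.
Proof.
move=> ip fg; apply: near_eq_derive.
have := @param_continuous _ _ M i p ip; rewrite /prop_for /continuous_at coordK //.
by move=> /(_ _ fg).
Qed.

Lemma open_pd W i a f g p : dom i p -> open W -> W p ->
  (forall q, W q -> f q = g q) -> pd i a f p = pd i a g p.
Proof.
move=> ip Wo Wp fg; apply: near_pd => //.
by have : nbhs p W by [exact: open_nbhs_nbhs]; apply: filterS.
Qed.

Lemma smooth_in_chart_eq W i f g : open W -> (forall q, W q -> f q = g q) ->
  smooth_in_chart W i f -> smooth_in_chart W i g.
Proof.
move=> Wo fg sf k; apply: Ck_ext (sf k); first exact: open_image.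
by move=> x; rewrite inE => -[p [ip Wp] <-] /=; rewrite coordK // fg.
Qed.

Lemma smooth_in_chart_pd W i a f : open W -> smooth_in_chart W i f ->
  smooth_in_chart W i (pd i a f).
Proof.
move=> Wo sf k; apply: Ck_ext (Ck_partial a (sf k.+1)); first exact: open_image.
move=> x; rewrite inE => -[p [ip Wp] <-] /=.
by rewrite /pd coordK.
Qed.

Lemma smooth_in_chart_differentiable W i f p : open W -> smooth_in_chart W i f ->
  dom i p -> W p -> differentiable (f \o param i) (coord i p).
Proof.
move=> Wo sf ip Wp; apply: Ck_differentiable (sf 1%N) _; first exact: open_image.
by exists p.
Qed.

Lemma pd_derivable W i a f p : open W -> smooth_in_chart W i f ->
  dom i p -> W p -> derivable (f \o param i) (coord i p) (e_ a).
Proof.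
by move=> Wo sf ip Wp; apply: diff_derivable; exact: smooth_in_chart_differentiable sf ip Wp.
Qed.

Lemma pd_commute W i a b f p : open W -> smooth_in_chart W i f ->
  dom i p -> W p -> pd i a (pd i b f) p = pd i b (pd i a f) p.
Proof.
move=> Wo sf ip Wp; have Uo := @open_image i W Wo.
have Up : (coord i @` (dom i `&` W)) (coord i p) by exists p.
have loc c d : pd i c (pd i d f) p =
    'D_(e_ c) (fun z => 'D_(e_ d) (f \o param i) z) (coord i p).
  apply: near_eq_derive; have : nbhs (coord i p) (coord i @` (dom i `&` W)).
    exact: open_nbhs_nbhs.
  by apply: filterS => x [q [iq Wq] <-] /=; rewrite /pd coordK.
by rewrite !loc; exact: schwarz Uo (sf 2%N) Up.
Qed.

Lemma pd_chain W i j a f p : open W -> smooth_in_chart W i f ->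
  dom i p -> dom j p -> W p ->
  pd j a f p = \sum_b jacobian j i p a b * pd i b f p.
Proof.
move=> Wo sf ip jp Wp.
pose phi x := coord i (param j x).
have phip : phi (coord j p) = coord i p by rewrite /phi coordK.
have -> : pd j a f p = 'D_(e_ a) ((f \o param i) \o phi) (coord j p).
  apply: near_eq_derive.
  have : nbhs (coord j p) (coord j @` (dom j `&` dom i)).
    apply: open_nbhs_nbhs; split; first by apply: open_image; exact: dom_open.
    by exists p.
  by apply: filterS => x [q [jq iq] <-] /=; rewrite /phi !coordK.
rewrite derive_comp_row ?phip.
- by apply: eq_bigr => b _; rewrite mxE.
- move=> b; apply: Ck_differentiable (@transition_smooth _ _ M j i b 1%N) _.
    by apply: open_image; exact: dom_open.
  by exists p.
- exact: smooth_in_chart_differentiable sf ip Wp.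
Qed.

End Charts.

Record patch (R : realType) (N : nat) (M : oriented_manifold R N) := Patch {
  pset :> set M;
  pchart : chart M;
  pset_open : open pset;
  pset_dom : pset `<=` dom pchart
}.

(** Smooth functions on a patch, normalised to vanish off it so that
    functions with the same values on the patch are equal; the
    unit is the indicator function of the patch. *)
Record sfun (R : realType) (N : nat) (M : oriented_manifold R N) (W : patch M) :=
  Sfun {
    sfun_val :> M -> R;
    sfun_smooth : smooth_in_chart W (pchart W) sfun_val;
    sfun_off : forall p, ~ pset W p -> sfun_val p = 0
  }.

HB.instance Definition _ R N M W := gen_eqMixin (@sfun R N M W).
HB.instance Definition _ R N M W := gen_choiceMixin (@sfun R N M W).

Section SmoothFunctionRing.
Context {R : realType} {N : nat} {M : oriented_manifold R N} {W : patch M}.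
Implicit Types (F G H : sfun W) (f g : M -> R).
Let Wo := @pset_open _ _ _ W.
Let Wi := @pset_dom _ _ _ W.

Lemma sfun_ext F G : (forall p, pset W p -> F p = G p) -> F = G.
Proof.
case: F G => [f f1 f2] [g g1 g2] /= fg.
have {fg}E : f = g.
  by apply/funext => p; have [/fg//|Wp] := pselect (pset W p); rewrite f2 ?g2.
by subst g; congr Sfun; exact: Prop_irrelevance.
Qed.

Definition cutoff f : M -> R := fun p => if `[< pset W p >] then f p else 0.

Lemma cutoffE f p : pset W p -> cutoff f p = f p.
Proof. by rewrite /cutoff; case: asboolP. Qed.

Lemma cutoff_off f p : ~ pset W p -> cutoff f p = 0.
Proof. by rewrite /cutoff; case: asboolP. Qed.

Lemma cutoff_smooth f : smooth_in_chart W (pchart W) f ->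
  smooth_in_chart W (pchart W) (cutoff f).
Proof.
by move=> sf; apply: smooth_in_chart_eq sf => // p Wp; rewrite cutoffE.
Qed.

Lemma cst_smooth (i : chart M) (c : R) : smooth_in_chart W i (fun=> c).
Proof. move=> k; exact: Ck_cst. Qed.

(** Zero on functions that are not smooth, so that matrices of functions can be
    lifted without carrying proofs. *)
Definition sfun_of f : sfun W :=
  match pselect (smooth_in_chart W (pchart W) f) with
  | left sf => Sfun (cutoff_smooth sf) (@cutoff_off f)
  | right _ => Sfun (cutoff_smooth (cst_smooth _ 0)) (@cutoff_off (fun=> 0))
  end.

Lemma sfun_ofE f p : smooth_in_chart W (pchart W) f -> pset W p -> sfun_of f p = f p.
Proof. by rewrite /sfun_of; case: pselect => // sf _ Wp /=; rewrite cutoffE. Qed.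

Definition sfun0 : sfun W := sfun_of (fun=> 0).
Definition sfun1 : sfun W := sfun_of (fun=> 1).

Lemma sfun_add_subproof F G : smooth_in_chart W (pchart W) (fun p => F p + G p).
Proof.
by move=> k; apply: CkD; [exact: open_image | exact: sfun_smooth | exact: sfun_smooth].
Qed.
Definition sfun_add F G : sfun W := sfun_of (fun p => F p + G p).

Lemma sfun_opp_subproof F : smooth_in_chart W (pchart W) (fun p => - F p).
Proof. by move=> k; apply: CkN; [exact: open_image | exact: sfun_smooth]. Qed.
Definition sfun_opp F : sfun W := sfun_of (fun p => - F p).

Lemma sfun_mul_subproof F G : smooth_in_chart W (pchart W) (fun p => F p * G p).
Proof.
by move=> k; apply: CkM; [exact: open_image | exact: sfun_smooth | exact: sfun_smooth].
Qed.
Definition sfun_mul F G : sfun W := sfun_of (fun p => F p * G p).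

Let zE p : pset W p -> sfun0 p = 0.
Proof. by move=> Wp; rewrite sfun_ofE //; exact: cst_smooth. Qed.
Let oE p : pset W p -> sfun1 p = 1.
Proof. by move=> Wp; rewrite sfun_ofE //; exact: cst_smooth. Qed.
Let aE F G p : pset W p -> sfun_add F G p = F p + G p.
Proof. by move=> Wp; rewrite sfun_ofE //; exact: sfun_add_subproof. Qed.
Let nE F p : pset W p -> sfun_opp F p = - F p.
Proof. by move=> Wp; rewrite sfun_ofE //; exact: sfun_opp_subproof. Qed.
Let mE F G p : pset W p -> sfun_mul F G p = F p * G p.
Proof. by move=> Wp; rewrite sfun_ofE //; exact: sfun_mul_subproof. Qed.

Let addA : associative sfun_add.
Proof. by move=> F G H; apply: sfun_ext => p Wp; rewrite !aE // addrA. Qed.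
Let addC : commutative sfun_add.
Proof. by move=> F G; apply: sfun_ext => p Wp; rewrite !aE // addrC. Qed.
Let add0 : left_id sfun0 sfun_add.
Proof. by move=> F; apply: sfun_ext => p Wp; rewrite aE // zE // add0r. Qed.
Let addN : left_inverse sfun0 sfun_opp sfun_add.
Proof. by move=> F; apply: sfun_ext => p Wp; rewrite aE // nE // zE // addNr. Qed.

HB.instance Definition _ := GRing.isNmodule.Build (sfun W) addA addC add0.
HB.instance Definition _ := GRing.Nmodule_isZmodule.Build (sfun W) addN.

Let mulA : associative sfun_mul.
Proof. by move=> F G H; apply: sfun_ext => p Wp; rewrite !mE // mulrA. Qed.
Let mul1 : left_id sfun1 sfun_mul.
Proof. by move=> F; apply: sfun_ext => p Wp; rewrite mE // oE // mul1r. Qed.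
Let mul1' : right_id sfun1 sfun_mul.
Proof. by move=> F; apply: sfun_ext => p Wp; rewrite mE // oE // mulr1. Qed.
Let mulDl : left_distributive sfun_mul +%R.
Proof. by move=> F G H; apply: sfun_ext => p Wp; rewrite !(mE, aE) // mulrDl. Qed.
Let mulDr : right_distributive sfun_mul +%R.
Proof. by move=> F G H; apply: sfun_ext => p Wp; rewrite !(mE, aE) // mulrDr. Qed.
Let mulC : commutative sfun_mul.
Proof. by move=> F G; apply: sfun_ext => p Wp; rewrite !mE // mulrC. Qed.

HB.instance Definition _ := GRing.Zmodule_isPzRing.Build (sfun W)
  mulA mul1 mul1' mulDl mulDr.
HB.instance Definition _ := GRing.PzRing_hasCommutativeMul.Build (sfun W) mulC.

Definition eval (p : M) (Wp : pset W p) F : R := F p.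

Lemma eval_is_additive p (Wp : pset W p) : zmod_morphism (eval Wp).
Proof. by move=> F G; rewrite /eval aE // nE. Qed.

Lemma eval_is_multiplicative p (Wp : pset W p) : monoid_morphism (eval Wp).
Proof. by split; [exact: oE | move=> F G; exact: mE]. Qed.

HB.instance Definition _ p (Wp : pset W p) :=
  GRing.isZmodMorphism.Build (sfun W) R (eval Wp) (eval_is_additive Wp).
HB.instance Definition _ p (Wp : pset W p) :=
  GRing.isMonoidMorphism.Build (sfun W) R (eval Wp) (eval_is_multiplicative Wp).

Lemma sfun_eval F G : (forall p (Wp : pset W p), eval Wp F = eval Wp G) -> F = G.
Proof. by move=> FG; apply: sfun_ext => p Wp; exact: (FG p Wp). Qed.

Lemma eval_sfun_of p (Wp : pset W p) f : smooth_in_chart W (pchart W) f ->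
  eval Wp (sfun_of f) = f p.
Proof. by move=> sf; exact: sfun_ofE. Qed.

Lemma sfun_inverse F : (forall p, pset W p -> F p != 0) -> exists G, F * G = 1.
Proof.
move=> F0; exists (sfun_of (fun p => (F p)^-1)); apply: sfun_ext => p Wp.
rewrite mE // sfun_ofE ?oE ?mulfV //; first exact: F0.
move=> k; apply: CkV; [exact: open_image | | exact: sfun_smooth].
by move=> x [q [iq Wq] <-] /=; rewrite coordK // F0.
Qed.

End SmoothFunctionRing.

Section PartialDerivations.
Context {R : realType} {N : nat} {M : oriented_manifold R N} {W : patch M}.
Variable j : chart M.
Hypothesis Wj : W `<=` dom j.
Implicit Types (F G : sfun W).
Let Wo := @pset_open _ _ _ W.
Let Wi := @pset_dom _ _ _ W.

Lemma smooth_pchart f : smooth_in_chart W j f -> smooth_in_chart W (pchart W) f.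
Proof. exact: smooth_change_chart. Qed.

Lemma sfun_smooth_in F : smooth_in_chart W j F.
Proof. by apply: smooth_change_chart Wi _; [exact: Wo | exact: sfun_smooth]. Qed.

Lemma sfun_pd_smooth a F : smooth_in_chart W (pchart W) (pd j a F).
Proof. by apply/smooth_pchart/smooth_in_chart_pd => //; exact: sfun_smooth_in. Qed.

Definition pder a F : sfun W := sfun_of (pd j a F).

Lemma eval_pder p (Wp : pset W p) a F : eval Wp (pder a F) = pd j a F p.
Proof. by rewrite eval_sfun_of //; exact: sfun_pd_smooth. Qed.

Lemma pd_sfun p (Wp : pset W p) a F f : (forall q (Wq : pset W q), f q = eval Wq F) ->
  pd j a f p = eval Wp (pder a F).
Proof.
move=> fF; rewrite eval_pder; apply: (open_pd (W := W)) => //; exact: Wj.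
Qed.

Lemma pder_is_derivation :
  [/\ forall a F G, pder a (F + G) = pder a F + pder a G,
      forall a F G, pder a (F * G) = pder a F * G + F * pder a G &
      forall a b F, pder a (pder b F) = pder b (pder a F)].
Proof.
have dF p a F : pset W p -> derivable (F \o param j) (coord j p) (delta_mx 0 a).
  by move=> Wp; exact: pd_derivable Wo (sfun_smooth_in F) (Wj Wp) Wp.
split=> [a F G|a F G|a b F]; apply: sfun_eval => p Wp.
- rewrite rmorphD /= -(pd_sfun Wp a (f := fun q => F q + G q)); last first.
    by move=> q Wq; rewrite rmorphD.
  by rewrite !eval_pder /pd -deriveD //; exact: dF.
- rewrite rmorphD !rmorphM /= -(pd_sfun Wp a (f := fun q => F q * G q)); last first.
    by move=> q Wq; rewrite rmorphM.
  rewrite !eval_pder; have := deriveM (dF p a F Wp) (dF p a G Wp).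
  rewrite /= coordK; last exact: Wj.
  rewrite /pd => ->; rewrite addrC; congr (_ + _).
  exact: mulrC.
- have dd k l : pd j k (pd j l F) p = eval Wp (pder k (pder l F)).
    by apply: pd_sfun => q Wq; rewrite eval_pder.
  have E : pd j a (pd j b F) p = pd j b (pd j a F) p.
    exact: pd_commute Wo (sfun_smooth_in F) (Wj Wp) Wp.
  exact: etrans (esym (dd a b)) (etrans E (dd b a)).
Qed.

Definition pders : derivations (sfun W) N :=
  let: And3 D M C := pder_is_derivation in Derivations D M C.

Lemma pdersE a F : pders a F = pder a F.
Proof. by rewrite /pders; case: pder_is_derivation. Qed.

Definition sfun_half : sfun W := sfun_of (fun=> 2%:R^-1).

Lemma eval_half p (Wp : pset W p) : eval Wp sfun_half = 2%:R^-1.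
Proof. by rewrite eval_sfun_of //; exact: cst_smooth. Qed.

Lemma sfun_halfE : sfun_half + sfun_half = 1.
Proof.
by apply: sfun_eval => p Wp; rewrite rmorphD rmorph1 /= eval_half -mulr2n
  -[LHS]mulr_natr mulVf ?pnatr_eq0.
Qed.

Definition smooth_mx (T : M -> 'M[R]_N) :=
  forall a b, smooth_in_chart W j (fun q => T q a b).

Definition sfun_mx (T : M -> 'M[R]_N) : 'M[sfun W]_N :=
  \matrix_(a, b) sfun_of (fun q => T q a b).

Lemma eval_sfun_mx p (Wp : pset W p) T a b : smooth_mx T ->
  eval Wp (sfun_mx T a b) = T p a b.
Proof.
by move=> sT; rewrite mxE eval_sfun_of //; apply: smooth_pchart; exact: sT.
Qed.

Lemma map_sfun_mx p (Wp : pset W p) T : smooth_mx T ->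
  map_mx (eval Wp) (sfun_mx T) = T p.
Proof. by move=> sT; apply/matrixP => a b; rewrite mxE eval_sfun_mx. Qed.

Lemma sfun_mx_eval (A B : 'M[sfun W]_N) :
  (forall p (Wp : pset W p), map_mx (eval Wp) A = map_mx (eval Wp) B) -> A = B.
Proof.
move=> AB; apply/matrixP => a b; apply: sfun_eval => p Wp.
by have /matrixP/(_ a b) := AB p Wp; rewrite !mxE.
Qed.

(** By Cramer's rule in the ring of smooth functions. *)
Lemma smooth_invmx T : smooth_mx T -> (forall p, pset W p -> T p \in unitmx) ->
  smooth_mx (fun p => invmx (T p)).
Proof.
move=> sT uT a b; set A := sfun_mx T.
have [u uE] : exists u, \det A * u = 1.
  apply: sfun_inverse => p Wp; rewrite -[_ p]/(eval Wp (\det A)) -det_map_mx.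
  by rewrite map_sfun_mx // -unitfE -unitmxE uT.
apply: (smooth_in_chart_eq (f := (u *: \adj A) a b)) => // [p Wp|]; last first.
  exact: sfun_smooth_in.
have E : A *m (u *: \adj A) = 1%:M.
  by rewrite -scalemxAr mul_mx_adj scale_scalar_mx mulrC uE.
have := congr1 (map_mx (eval Wp)) E; rewrite map_mxM map_mx1 map_sfun_mx // => E'.
rewrite -[LHS]/(eval Wp ((u *: \adj A) a b)) 
  -[LHS](mxE matrix_key (fun a b => eval Wp ((u *: \adj A) a b))).
have -> : invmx (T p) = map_mx (eval Wp) (u *: \adj A).
  by rewrite -[LHS]mulmx1 -E' mulmxA mulVmx ?uT // mul1mx.
by rewrite !mxE.
Qed.

Lemma sfun_mx_inverse T : smooth_mx T -> (forall p, pset W p -> T p \in unitmx) ->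
  sfun_mx T *m sfun_mx (fun p => invmx (T p)) = 1%:M.
Proof.
move=> sT uT; have sI := smooth_invmx sT uT.
apply: sfun_mx_eval => p Wp; rewrite map_mxM map_mx1 !map_sfun_mx // mulmxV //.
exact: uT.
Qed.

Lemma sfun_mx_sym T : smooth_mx T -> (forall p, pset W p -> (T p)^T = T p) ->
  (sfun_mx T)^T = sfun_mx T.
Proof.
move=> sT TS; apply: sfun_mx_eval => p Wp.
by rewrite -map_trmx map_sfun_mx // TS.
Qed.

Section Realization.
Variable g : tensor2 M.
Hypothesis sg : smooth_mx (g j).
Hypothesis ug : forall p, pset W p -> g j p \in unitmx.
Hypothesis symg : forall p, pset W p -> (g j p)^T = g j p.

Definition patch_inverse : 'M[sfun W]_N := sfun_mx (fun p => invmx (g j p)).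

Definition patch_connection : 'I_N -> 'M[sfun W]_N :=
  levi_civita pders sfun_half (sfun_mx (g j)) patch_inverse.

Let GS : (sfun_mx (g j))^T = sfun_mx (g j) := sfun_mx_sym sg symg.
Let GK : sfun_mx (g j) *m patch_inverse = 1%:M := sfun_mx_inverse sg ug.

Lemma patch_torsion_free : torsion_free patch_connection.
Proof. exact: levi_civita_torsion_free. Qed.

Lemma patch_metric : metric_connection pders patch_connection (sfun_mx (g j)).
Proof. exact: levi_civita_metric sfun_halfE GS GK. Qed.

Lemma eval_inverse p (Wp : pset W p) a b :
  eval Wp (patch_inverse a b) = inv_metric g j a b p.
Proof. by rewrite eval_sfun_mx //; exact: smooth_invmx. Qed.

(** The component formulas are values of the formulas for derivations, since all
    derivatives are taken on the open set where both agree. *)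
Lemma eval_connection p (Wp : pset W p) a b c :
  eval Wp (patch_connection a b c) = christoffel g j c a b p.
Proof.
rewrite mxE rmorphM /= eval_half rmorph_sum; congr (_ * _).
apply: eq_bigr => e _; rewrite rmorphM /= eval_inverse rmorphB rmorphD /= !pdersE.
by congr (_ * (_ + _ - _)); apply/esym/pd_sfun => q Wq; rewrite eval_sfun_mx.
Qed.

Lemma eval_cov p (Wp : pset W p) (T : tensor2 M) c a b : smooth_mx (T j) ->
  eval Wp (cov pders patch_connection (sfun_mx (T j)) c a b) = cov_deriv2 g T j p c a b.
Proof.
move=> sT; rewrite !(addmxE, oppmxE) !rmorphB /= dmxE pdersE; congr (_ - _ - _).
- by apply/esym/pd_sfun => q Wq; rewrite eval_sfun_mx.
- rewrite mxE rmorph_sum; apply: eq_bigr => d _.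
  by rewrite rmorphM /= eval_connection eval_sfun_mx.
- rewrite mxE rmorph_sum; apply: eq_bigr => d _.
  by rewrite rmorphM /= trmxE eval_connection eval_sfun_mx // mulrC.
Qed.

Lemma eval_hessian p (Wp : pset W p) F f a b :
  (forall q (Wq : pset W q), f q = eval Wq F) ->
  eval Wp (grad_hess pders patch_connection (\col_c pders c F) a b 0) =
  hessian g f j p a b.
Proof.
move=> fF; rewrite [RHS]mxE addmxE oppmxE rmorphB /= dmxE mxE !pdersE; congr (_ - _).
  by apply/esym/pd_sfun => q Wq; exact: pd_sfun.
rewrite mxE rmorph_sum; apply: eq_bigr => c _.
by rewrite rmorphM /= eval_connection mxE pdersE -(pd_sfun Wp c fF).
Qed.

Lemma eval_ricci p (Wp : pset W p) a b :
  eval Wp (ricci_mx pders patch_connection a b) = ricci g j p a b.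
Proof.
have Ts := patch_torsion_free.
have dC k x y z q (Wq : pset W q) :
    pd j k (christoffel g j z x y) q = eval Wq (pder k (patch_connection x y z)).
  by apply: pd_sfun => r Wr; rewrite eval_connection.
rewrite ricci_mxE // [RHS]mxE rmorphD !rmorph_sum /=; congr (_ + _).
  apply: eq_bigr => c _; rewrite rmorphB !pdersE.
  congr (_ - _); exact: esym (dC _ _ _ _ _ Wp).
apply: eq_bigr => c _; rewrite rmorph_sum; apply: eq_bigr => e _.
by rewrite rmorphB !rmorphM /=; congr (_ * _ - _ * _); exact: eval_connection.
Qed.

End Realization.

End PartialDerivations.

(** * The Ricci tensor of a Lorentzian metric *)

Section LorentzForms.
Context {R : realType} {N : nat}.

Lemma lorentz_form_unit (g : 'M[R]_N) : lorentz_form g -> g \in unitmx.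
Proof.
case=> P [uP E]; have : P *m g *m P^T \in unitmx.
  rewrite E unitmxE det_diag unitfE; apply/prodf_neq0 => a _.
  by rewrite mxE; case: ifP; rewrite ?oppr_eq0 oner_eq0.
by rewrite !unitmx_mul => /andP[/andP[]].
Qed.

Lemma lorentz_form_sym (g : 'M[R]_N) : lorentz_form g -> g^T = g.
Proof.
case=> P [uP E].
have -> : g = invmx P *m (P *m g *m P^T) *m (invmx P)^T.
  by rewrite trmx_inv !mulmxA mulVmx // mul1mx -mulmxA mulmxV ?mulmx1 ?unitmx_tr.
by rewrite E !trmx_mul trmxK tr_diag_mx mulmxA.
Qed.

Lemma lorentz_formZ (g : 'M[R]_N) (c : R) : c != 0 -> lorentz_form g ->
  lorentz_form (c ^- 2 *: g).
Proof.
move=> c0 [P [uP E]]; exists (c *: P); split; first by rewrite unitmxZ ?unitfE.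
have -> : (c *: P)^T = c *: P^T by rewrite linearZ.
rewrite -!scalemxAl -!scalemxAr -!scalemxAl !scalerA E.
by rewrite mulrA -expr2 mulfV ?expf_neq0 // scale1r.
Qed.

End LorentzForms.

Section RicciTensor.
Context {R : realType} {N : nat} {M : oriented_manifold R N}.
Implicit Types (i j : chart M) (D : set M) (g : tensor2 M).

Lemma jacobian_smooth (W : patch M) i j : W `<=` dom i -> W `<=` dom j ->
  forall a b, smooth_in_chart W i (fun q => jacobian i j q a b).
Proof.
move=> Wi Wj a b; have Wo := @pset_open _ _ _ W.
apply: (smooth_in_chart_eq (f := pd i a (fun q => coord j q 0 b))) => //.
  by move=> q _; rewrite mxE.
apply: smooth_in_chart_pd => // k; apply: Ck_subset (@transition_smooth _ _ M i j b k).
by move=> x [q [iq Wq] <-]; exists q => //; split=> //; exact: Wj.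
Qed.

Lemma coord_smooth (W : patch M) i j b : W `<=` dom j ->
  smooth_in_chart W i (fun q => coord j q 0 b).
Proof.
move=> Wj k; apply: Ck_subset (@transition_smooth _ _ M i j b k).
by move=> x [q [iq Wq] <-]; exists q => //; split=> //; exact: Wj.
Qed.

Lemma pd_coord i a b p : dom i p -> pd i a (fun q => coord i q 0 b) p = (a == b)%:R.
Proof.
move=> ip; rewrite /pd.
transitivity ('D_(delta_mx 0 a) (fun x : 'rV[R]_N => x 0 b) (coord i p)).
  apply: near_eq_derive.
  have : nbhs (coord i p) (coord i @` dom i).
    by apply: open_nbhs_nbhs; split; [exact: image_open | exists p].
  by apply: filterS => x [q iq <-] /=; rewrite coordK.
have -> : (fun x : 'rV[R]_N => x 0 b) = linear_form (fun c => (c == b)%:R).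
  apply/funext => x; rewrite /linear_form (bigD1 b) //= eqxx mulr1 big1 ?addr0 // => c cb.
  by rewrite (negPf cb) mulr0.
rewrite deriveE; last exact: linear_differentiable (@linear_form_continuous _ _ _).
rewrite diff_lin /=; last exact: linear_form_continuous.
rewrite /linear_form (bigD1 a) //= !mxE !eqxx mul1r big1 ?addr0 // => c ca.
by rewrite mxE eqxx /= (negPf ca) mul0r.
Qed.

Lemma jacobianK i j p : dom i p -> dom j p ->
  jacobian i j p *m jacobian j i p = 1%:M.
Proof.
move=> ip jp; pose V := dom i `&` dom j.
have Vo : open V by apply: openI; exact: dom_open.
pose W := Patch Vo (fun q => @proj1 (dom i q) (dom j q)).
apply/matrixP => a c; rewrite !mxE -(pd_coord a c ip).
rewrite (pd_chain (W := V) (i := j) a Vo _ jp ip) //.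
  by apply: eq_bigr => b _; congr (_ * _); rewrite mxE.
by apply: (coord_smooth (W := W)) => q [].
Qed.

Definition chart_patch D (Do : open D) i : patch M :=
  Patch (openI (@dom_open _ _ M i) Do) (fun q => @proj1 (dom i q) (D q)).

Lemma smooth_in_chart_patch D (Do : open D) i f :
  smooth_in_chart (chart_patch Do i) i f <-> smooth_in_chart D i f.
Proof.
by split=> H k; apply: Ck_subset (H k) => x [p Hp <-]; exists p => //=;
  case: Hp => ip; [split | case].
Qed.

Lemma is_tensor2_smooth_mx D (T : tensor2 M) (W : patch M) j : is_tensor2 D T ->
  W `<=` D -> smooth_mx (W := W) j (T j).
Proof. by move=> [_ sT] WD a b; apply: smooth_in_chart_subset WD (sT j a b). Qed.

Section Metric.
Variables (D : set M) (g : tensor2 M).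
Hypothesis Do : open D.
Hypothesis Hg : lorentzian_metric D g.

Lemma metric_unit i p : D p -> dom i p -> g i p \in unitmx.
Proof. by move=> Dp ip; apply: lorentz_form_unit; exact: Hg.2. Qed.

Lemma metric_sym i p : D p -> dom i p -> (g i p)^T = g i p.
Proof. by move=> Dp ip; apply: lorentz_form_sym; exact: Hg.2. Qed.

(** The derivatives along two charts are two frames of derivations of the smooth
    functions on the overlap, related by the Jacobian, whose columns are closed
    since they are differentials of coordinates. *)
Lemma ricci_change_chart i j p : D p -> dom i p -> dom j p ->
  ricci g i p = jacobian i j p *m ricci g j p *m (jacobian i j p)^T.
Proof.
move=> Dp ip jp; pose V := dom i `&` dom j `&` D.
have Vo : open V by do 2?apply: openI => //; exact: dom_open.
have Vi : V `<=` dom i by move=> q [[]].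
have Vj : V `<=` dom j by move=> q [[]].
have VD : V `<=` D by move=> q [].
pose W := Patch Vo Vi; have Wp : pset W p by [].
have Wi : W `<=` dom i := Vi; have Wj : W `<=` dom j := Vj; have WD : W `<=` D := VD.
have sg k : smooth_mx (W := W) k (g k) by exact: (is_tensor2_smooth_mx (W := W) k Hg.1 WD).
have ug k (Vk : W `<=` dom k) q : pset W q -> g k q \in unitmx.
  by move=> Wq; apply: metric_unit; [exact: WD | exact: Vk].
have yg k (Vk : W `<=` dom k) q : pset W q -> (g k q)^T = g k q.
  by move=> Wq; apply: metric_sym; [exact: WD | exact: Vk].
pose J : 'M[sfun W]_N := sfun_mx (jacobian i j).
pose Ji : 'M[sfun W]_N := sfun_mx (jacobian j i).
have sJ : smooth_mx (W := W) i (jacobian i j) by move=> a b; exact: (jacobian_smooth (W := W)).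
have sJi : smooth_mx (W := W) j (jacobian j i) by move=> a b; exact: (jacobian_smooth (W := W)).
have mJ q (Wq : pset W q) : map_mx (eval Wq) J = jacobian i j q := map_sfun_mx Wi Wq sJ.
have mJi q (Wq : pset W q) : map_mx (eval Wq) Ji = jacobian j i q := map_sfun_mx Wj Wq sJi.
have JK : J *m Ji = 1%:M.
  apply: sfun_mx_eval => q Wq.
  by rewrite map_mxM map_mx1 mJ mJi jacobianK //; [exact: Wi | exact: Wj].
have JiK : Ji *m J = 1%:M.
  apply: sfun_mx_eval => q Wq.
  by rewrite map_mxM map_mx1 mJ mJi jacobianK //; [exact: Wj | exact: Wi].
have dJ a (F : sfun W) : pders Wi a F = \sum_b J a b * pders Wj b F.
  apply: sfun_eval => q Wq; rewrite [RHS]rmorph_sum pdersE (eval_pder Wi) /=.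
  rewrite (pd_chain a Vo (sfun_smooth_in j F) (Wj q Wq) (Wi q Wq) Wq).
  apply: eq_bigr => b _; rewrite rmorphM /= pdersE (eval_pder Wj).
  by rewrite (eval_sfun_mx Wi).
have cJ a b c : pders Wi a (J b c) = pders Wi b (J a c).
  pose F : sfun W := sfun_of (fun q => coord j q 0 c).
  have FE k : J k c = pders Wi k F.
    apply: sfun_eval => q Wq; rewrite pdersE (eval_sfun_mx Wi) // mxE.
    apply: (pd_sfun Wi Wq) => r Wr; rewrite eval_sfun_of //.
    by apply: (smooth_pchart Wi); exact: (coord_smooth (W := W)).
  by rewrite !FE derC.
have GS := sfun_mx_sym Wj (sg j) (yg j Wj).
have GK := sfun_mx_inverse Wj (sg j) (ug j Wj).
have := ricci_mx_frame JK JiK dJ cJ sfun_halfE GS GK.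
have gE : J *m sfun_mx (g j) *m J^T = sfun_mx (g i).
  apply: sfun_mx_eval => q Wq; rewrite !map_mxM -map_trmx mJ.
  rewrite (map_sfun_mx Wj Wq (sg j)) (map_sfun_mx Wi Wq (sg i)).
  by rewrite (Hg.1.1 i j q) //; [exact: (WD _ Wq) | exact: (Wi _ Wq) | exact: (Wj _ Wq)].
have giE : Ji^T *m sfun_mx (fun q => invmx (g j q)) *m Ji = patch_inverse (W := W) i g.
  have K := sfun_mx_inverse Wi (sg i) (ug i Wi).
  have K' := inv_metricK (sfun_mx_sym Wi (sg i) (yg i Wi)) K.
  apply/esym/(mulmx_inverse_unique K'); rewrite -gE.
  exact: congruence_inverse JK JiK GK.
rewrite gE giE => E; apply/matrixP => a b.
rewrite -[LHS](eval_ricci Wi (sg i) (ug i Wi) (yg i Wi) Wp).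
rewrite /patch_connection E.
have -> : jacobian i j p *m ricci g j p *m (jacobian i j p)^T =
    map_mx (eval Wp) (J *m ricci_mx (pders Wj) (patch_connection Wj g) *m J^T).
  rewrite !map_mxM -map_trmx mJ; congr (_ *m _ *m _).
  by apply/matrixP => c d; rewrite -(eval_ricci Wj (sg j) (ug j Wj) (yg j Wj) Wp) [RHS]mxE.
by rewrite [RHS]mxE.
Qed.

Lemma ricci_smooth i a b : smooth_in_chart D i (fun p => ricci g i p a b).
Proof.
apply/(smooth_in_chart_patch Do); set W := chart_patch Do i.
have Wi : W `<=` dom i by move=> q [].
have WD : W `<=` D by move=> q [].
have sg := is_tensor2_smooth_mx (W := W) i Hg.1 WD.
apply: (smooth_in_chart_eq (f := (ricci_mx (pders Wi) (patch_connection Wi g) a b : sfun W))).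
- exact: pset_open.
- move=> q Wq; rewrite -(eval_ricci Wi sg _ _ Wq) //.
    by move=> r Wr; apply: metric_unit; [exact: WD | exact: Wi].
  by move=> r Wr; apply: metric_sym; [exact: WD | exact: Wi].
- exact: sfun_smooth_in.
Qed.

Lemma ricci_sym i p : D p -> dom i p -> (ricci g i p)^T = ricci g i p.
Proof.
move=> Dp ip; pose W := chart_patch Do i; have Wp : pset W p by [].
have Wi : W `<=` dom i by move=> q [].
have WD : W `<=` D by move=> q [].
have sg := is_tensor2_smooth_mx (W := W) i Hg.1 WD.
have ug q : pset W q -> g i q \in unitmx by move=> Wq; apply: metric_unit; [exact: WD | exact: Wi].
have yg q : pset W q -> (g i q)^T = g i q by move=> Wq; apply: metric_sym; [exact: WD | exact: Wi].
have S := ricci_mx_sym sfun_halfE (sfun_mx_sym Wi sg yg) (sfun_mx_inverse Wi sg ug)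
  (patch_torsion_free Wi sg yg) (patch_metric Wi sg ug yg).
apply/matrixP => a b; rewrite mxE -!(eval_ricci Wi sg ug yg Wp).
by congr (eval Wp _); rewrite -[in LHS]S mxE.
Qed.

End Metric.

End RicciTensor.

(** * Rescaling by a scale *)

Section ScaledMetric.
Variables (A : comPzRingType) (n : nat) (d : derivations A n.+2).
Variables (half : A) (g gi : 'M[A]_n.+2).
Hypothesis halfE : half + half = 1.
Hypothesis gS : g^T = g.
Hypothesis gK : g *m gi = 1%:M.
Variable G : 'I_n.+2 -> 'M[A]_n.+2.
Hypothesis Gs : torsion_free G.
Hypothesis Gg : metric_connection d G g.
Variables s t : A.
Hypothesis st : s * t = 1.

Let giS : gi^T = gi := inv_metric_sym gS gK.
Let giK : gi *m g = 1%:M := inv_metricK gS gK.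

Definition gradient : 'cV[A]_n.+2 := \col_c d c s.

Definition hessian_mx : 'M[A]_n.+2 := \matrix_(a, b) grad_hess d G gradient a b 0.

Definition scaled_connection (a : 'I_n.+2) : 'M[A]_n.+2 :=
  G a + bump g gi (- t *: gradient) a.

Let ts2 : t ^+ 2 * s ^+ 2 = 1.
Proof. by rewrite -exprMn mulrC st expr1n. Qed.

Lemma der_inverse_scale a : d a t = - (t ^+ 2 * d a s).
Proof.
have e : d a s * t + s * d a t = 0 by rewrite -derM st der1.
have -> : d a t = t * (s * d a t) by rewrite mulrA (mulrC t) st mul1r.
by move/eqP: e; rewrite addrC addr_eq0 => /eqP ->; ring.
Qed.

Lemma scaled_torsion_free : torsion_free scaled_connection.
Proof. by move=> a b c; rewrite [LHS]addmxE [RHS]addmxE Gs bump_torsion_free. Qed.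

Lemma scaled_metric : metric_connection d scaled_connection (t ^+ 2 *: g).
Proof.
apply: metric_bump => // a; rewrite scalemxE mxE expr2 derM der_inverse_scale; ring.
Qed.

Lemma scaled_metric_sym : (t ^+ 2 *: g)^T = t ^+ 2 *: g.
Proof. by rewrite linearZ /= gS. Qed.

Lemma scaled_metricK : (t ^+ 2 *: g) *m (s ^+ 2 *: gi) = 1%:M.
Proof. by rewrite -scalemxAl -scalemxAr scalerA ts2 scale1r gK. Qed.

Lemma hessian_mx_sym a b : hessian_mx a b = hessian_mx b a.
Proof.
rewrite !mxE derC; congr (_ - _); apply: eq_bigr => c _; by rewrite Gs.
Qed.

Lemma contract_metric : contract gi g = n.+2%:R.
Proof. by rewrite contract_tr gS giK mxtrace1. Qed.

Lemma contract_outer (z : 'cV[A]_n.+2) : contract gi (z *m z^T) = sqnorm gi z.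
Proof.
rewrite sqnormE; apply: eq_bigr => a _; rewrite [raise _ _ _ _]mxE big_distrr /=.
apply: eq_bigr => b _; rewrite mxE big_ord1 !mxE -{1}giS mxE; ring.
Qed.

(** The scale enters the connection through y = - ds / s, so that the second
    derivatives of s survive while the terms quadratic in ds cancel outside
    the trace. *)
Lemma scaled_ricci a b : ricci_mx d scaled_connection a b =
  ricci_mx d G a b + (t * hessian_mx a b) *+ n
  + g a b * (t * contract gi hessian_mx - (t ^+ 2 * sqnorm gi gradient) *+ n.+1).
Proof.
have Y c e : grad_hess d G (- t *: gradient) c e 0 =
    - t * hessian_mx c e + t ^+ 2 * (d c s * d e s).
  rewrite /grad_hess addmxE oppmxE dmxZ derN der_inverse_scale -scalemxAr.
  rewrite addmxE !scalemxE [hessian_mx _ _]mxE /grad_hess addmxE oppmxE [gradient _ _]mxE; ring.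
have Y2 : contract gi (\matrix_(c, e) grad_hess d G (- t *: gradient) c e 0) =
    - t * contract gi hessian_mx + t ^+ 2 * sqnorm gi gradient.
  have -> : \matrix_(c, e) grad_hess d G (- t *: gradient) c e 0 =
      - t *: hessian_mx + t ^+ 2 *: (gradient *m gradient^T).
    apply/matrixP => c e; rewrite mxE Y addmxE !scalemxE; congr (_ + _ * _).
    by rewrite mxE big_ord1 !mxE.
  by rewrite contractD !contractZ contract_outer.
have Y3 : sqnorm gi (- t *: gradient) = t ^+ 2 * sqnorm gi gradient.
  rewrite /sqnorm /raise (_ : (- t *: gradient)^T = - t *: gradient^T); last by rewrite linearZ.
  by rewrite -!scalemxAl -scalemxAr scalerA scalemxE mulrNN -expr2.
rewrite (ricci_bump gS gK Gs Gg) Y2 Y3 (Y a b) (Y b a) (hessian_mx_sym b a).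
rewrite !scalemxE ![gradient _ _]mxE.
move: (contract _ _) (sqnorm _ _) (hessian_mx _ _) => L Q H.
have N2 (x : A) : x *+ n.+2 = x *+ n + x *+ 2 by rewrite -mulrnDr addn2.
have N1 (x : A) : x *+ n.+1 = x *+ n + x by rewrite mulrSr.
rewrite !N2 !N1; ring.
Qed.

Lemma scaled_scalar :
  contract (s ^+ 2 *: gi) (ricci_mx d scaled_connection) =
  s ^+ 2 * contract gi (ricci_mx d G) + (s * contract gi hessian_mx) *+ (2 * n.+1)
  - sqnorm gi gradient *+ (n.+2 * n.+1).
Proof.
have cZ T : contract (s ^+ 2 *: gi) T = s ^+ 2 * contract gi T.
  by rewrite !contract_tr -scalemxAl mxtraceZ.
rewrite cZ.
have -> : ricci_mx d scaled_connection = ricci_mx d G + (t *+ n) *: hessian_mx +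
   (t * contract gi hessian_mx - (t ^+ 2 * sqnorm gi gradient) *+ n.+1) *: g.
  apply/matrixP => a b; rewrite scaled_ricci !addmxE !scalemxE; ring.
rewrite !contractD !contractZ contract_metric.
move: (contract gi hessian_mx) (contract gi _) (sqnorm _ _) => L r Q.
have E1 : s ^+ 2 * t = s by rewrite expr2 -mulrA st mulr1.
have E2 : s ^+ 2 * t ^+ 2 = 1 by rewrite mulrC ts2.
have -> : s ^+ 2 * (r + t *+ n * L + (t * L - t ^+ 2 * Q *+ n.+1) * n.+2%:R) =
    s ^+ 2 * r + (s ^+ 2 * t) * L * (n%:R + n.+2%:R)
     - (s ^+ 2 * t ^+ 2) * Q * (n.+2%:R * n.+1%:R).
  by rewrite -[_ *+ n.+1]mulr_natr -[t *+ n]mulr_natr; ring.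
rewrite E1 E2 mul1r -natrD -natrM !mulr_natr.
by congr (_ + _ *+ _ - _); rewrite addnS mul2n -addnn addSn addnS.
Qed.

Definition scaled_curvature : A :=
  contract (s ^+ 2 *: gi) (ricci_mx d scaled_connection).

Variable ninv : A.
Hypothesis ninvE : ninv * n.+2%:R = 1.

Definition scaled_tracefree : 'M[A]_n.+2 :=
  ricci_mx d scaled_connection - (ninv * scaled_curvature) *: (t ^+ 2 *: g).

Lemma scaled_ricci_sym :
  (ricci_mx d scaled_connection)^T = ricci_mx d scaled_connection.
Proof.
exact: (ricci_mx_sym halfE scaled_metric_sym scaled_metricK scaled_torsion_free scaled_metric).
Qed.

Lemma scaled_tracefree_sym : scaled_tracefree^T = scaled_tracefree.
Proof.
by rewrite /scaled_tracefree trmxD trmxN scaled_ricci_sym linearZ /= scaled_metric_sym.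
Qed.

Lemma scaled_tracefree_trace : contract gi scaled_tracefree = 0.
Proof.
rewrite /scaled_tracefree scalerA -scaleNr contractD contractZ contract_metric.
rewrite /scaled_curvature (_ : contract (s ^+ 2 *: gi) _ =
  s ^+ 2 * contract gi (ricci_mx d scaled_connection)).
  move: (contract gi _) => r.
  have -> : r + - (ninv * (s ^+ 2 * r) * t ^+ 2) * n.+2%:R =
    r - (ninv * n.+2%:R) * (t ^+ 2 * s ^+ 2) * r by ring.
  by rewrite ninvE ts2 !mul1r subrr.
by rewrite !contract_tr -scalemxAl mxtraceZ.
Qed.

(** Conformal covariance of the divergence on trace-free tensors turns the
    left-hand side into the divergence for the rescaled metric, to which the
    contracted Bianchi identity applies. *)
Lemma scaled_divergence a :
  (s * (s * divergence d gi G scaled_tracefree a -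
     (\sum_c scaled_tracefree a c * raise gi gradient 0 c) *+ n)) *+ 2 =
  d a scaled_curvature - (ninv * d a scaled_curvature) *+ 2.
Proof.
have := divergence_bump d gS gK G (- t *: gradient) a scaled_tracefree_sym
  scaled_tracefree_trace.
have -> : \sum_c scaled_tracefree a c * raise gi (- t *: gradient) 0 c =
    - t * \sum_c scaled_tracefree a c * raise gi gradient 0 c.
  rewrite big_distrr /=; apply: eq_bigr => c _.
  rewrite /raise (_ : (- t *: gradient)^T = - t *: gradient^T); last by rewrite linearZ.
  by rewrite -scalemxAl [X in _ * X]scalemxE mulrCA.
move: (\sum_c _) => w E.
have D : s ^+ 2 * divergence d gi scaled_connection scaled_tracefree a =
    divergence d (s ^+ 2 *: gi) scaled_connection scaled_tracefree a.
  rewrite /divergence big_distrr /=; apply: eq_bigr => b _; rewrite big_distrr /=.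
  by apply: eq_bigr => c _; rewrite scalemxE mulrA.
have B := contracted_bianchi halfE scaled_metric_sym scaled_metricK
  scaled_torsion_free scaled_metric a.
have D' : divergence d (s ^+ 2 *: gi) scaled_connection scaled_tracefree a =
    divergence d (s ^+ 2 *: gi) scaled_connection (ricci_mx d scaled_connection) a
    - ninv * d a scaled_curvature.
  have cg b : cov d scaled_connection scaled_tracefree b =
     cov d scaled_connection (ricci_mx d scaled_connection) b -
       (ninv * d b scaled_curvature) *: (t ^+ 2 *: g).
    rewrite /scaled_tracefree covB covZ (cov_metric _ scaled_metric) scaler0 addr0 derM.
    have -> : d b ninv = 0.
      have : d b (ninv * n.+2%:R) = 0 by rewrite ninvE der1.
      rewrite derM der_natr mulr0 addr0 => e.
      by rewrite -[LHS]mulr1 -ninvE (mulrC ninv) mulrA e mul0r.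
    by rewrite mul0r add0r.
  rewrite /divergence.
  transitivity (\sum_b \sum_c ((s ^+ 2 *: gi) b c *
      cov d scaled_connection (ricci_mx d scaled_connection) b a c) -
      \sum_b ninv * d b scaled_curvature * (\sum_c (t ^+ 2 *: g) a c * (s ^+ 2 *: gi) c b)).
    rewrite -sumrB; apply: eq_bigr => b _; rewrite big_distrr -sumrB /=.
    apply: eq_bigr => c _; rewrite cg addmxE oppmxE !scalemxE -[gi c b]trmxE giS; ring.
  congr (_ - _); transitivity (\sum_b ninv * d b scaled_curvature * (a == b)%:R).
    apply: eq_bigr => b _; congr (_ * _).
    by have /matrixP/(_ a b) K := scaled_metricK; rewrite mxE [RHS]mxE in K.
  exact: sum_deltar.
rewrite -/scaled_connection in E.
have F : s ^+ 2 * divergence d gi scaled_connection scaled_tracefree a =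
    s * (s * divergence d gi G scaled_tracefree a - w *+ n).
  rewrite -/(divergence d gi scaled_connection scaled_tracefree a) in E.
  have -> : divergence d gi scaled_connection scaled_tracefree a =
    divergence d gi G scaled_tracefree a + (- t * w) *+ n.+2 - (- t * w) *+ 2 by exact: E.
  have -> : (- t * w) *+ n.+2 = (- t * w) *+ n + (- t * w) *+ 2 by rewrite -mulrnDr addn2.
  transitivity (s ^+ 2 * divergence d gi G scaled_tracefree a - (s * t) * (s * w) *+ n).
    ring.
  rewrite st mul1r; ring.
rewrite -F D D' mulrnBl; congr (_ - _).
by rewrite /scaled_curvature B mulr2n.
Qed.

End ScaledMetric.

Definition tracefree_mx (R : realType) N (g X : 'M[R]_N) : 'M[R]_N :=
  X - (N%:R^-1 * contract (invmx g) X) *: g.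

Section TracefreeMatrix.
Context {R : realType} {n : nat}.
Variable g : 'M[R]_n.+2.
Hypothesis gU : g \in unitmx.
Hypothesis gS : g^T = g.
Implicit Types X Y : 'M[R]_n.+2.

Lemma tracefree_mxD X Y : tracefree_mx g (X + Y) = tracefree_mx g X + tracefree_mx g Y.
Proof. by rewrite /tracefree_mx contractD mulrDr scalerDl; mxring. Qed.

Lemma tracefree_mxZ c X : tracefree_mx g (c *: X) = c *: tracefree_mx g X.
Proof. by rewrite /tracefree_mx contractZ scalerBr scalerA mulrCA. Qed.

Lemma contract_inv_metric : contract (invmx g) g = n.+2%:R.
Proof. by rewrite contract_metric // mulmxV. Qed.

Lemma tracefree_mx_metric : tracefree_mx g g = 0.
Proof.
by rewrite /tracefree_mx contract_inv_metric mulVf ?pnatr_eq0 // scale1r subrr.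
Qed.

Lemma tracefree_mx_trace X : contract (invmx g) (tracefree_mx g X) = 0.
Proof.
rewrite /tracefree_mx -scaleNr contractD contractZ contract_inv_metric.
by rewrite mulNr mulrAC mulVf ?pnatr_eq0 // mul1r subrr.
Qed.

Lemma tracefree_mx_sym X : X^T = X -> (tracefree_mx g X)^T = tracefree_mx g X.
Proof.
by move=> XS; rewrite /tracefree_mx trmxD trmxN XS linearZ /= gS.
Qed.

Lemma contract_invZ (c : R) X : c != 0 ->
  contract (invmx (c *: g)) X = c^-1 * contract (invmx g) X.
Proof. by move=> c0; rewrite invmxZ ?unitmxZ ?unitfE // !contract_tr -scalemxAl mxtraceZ. Qed.

Lemma tracefree_mx_scale (c : R) X : c != 0 -> tracefree_mx (c *: g) X = tracefree_mx g X.
Proof.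
move=> c0; rewrite /tracefree_mx contract_invZ // scalerA; congr (_ - _ *: _).
by rewrite -mulrA mulrAC mulVf // mul1r.
Qed.

End TracefreeMatrix.

(** Where s does not vanish this is the scalar curvature of s^-2 g; it is
    smooth across the zeros of s. *)
Definition scalar_ext (R : realType) (n : nat) (M : oriented_manifold R n.+2)
    (g : tensor2 M) (s : M -> R) (i : chart M) (p : M) : R :=
  s p ^+ 2 * scalar_curvature g i p
  + (s p * trace g (hessian g s) i p) *+ (2 * n.+1)
  - (\sum_c (\sum_e pd i e s p * inv_metric g i e c p) * pd i c s p) *+ (n.+2 * n.+1).

Section ScalarExtension.
Context {R : realType} {n : nat} {M : oriented_manifold R n.+2} {W : patch M}.
Variables (g : tensor2 M) (s : M -> R) (i : chart M).
Hypothesis Wi : W `<=` dom i.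
Hypothesis sg : smooth_mx (W := W) i (g i).
Hypothesis ug : forall q, pset W q -> g i q \in unitmx.
Hypothesis yg : forall q, pset W q -> (g i q)^T = g i q.
Variable S : sfun W.
Hypothesis evS : forall p (Wp : pset W p), eval Wp S = s p.

Let d := pders Wi.
Let Gi := patch_inverse (W := W) i g.
Let Gc := patch_connection Wi g.

Definition scalar_ext_sfun : sfun W :=
  S ^+ 2 * contract Gi (ricci_mx d Gc)
  + (S * contract Gi (hessian_mx d Gc S)) *+ (2 * n.+1)
  - sqnorm Gi (gradient d S) *+ (n.+2 * n.+1).

Lemma eval_scalar_ext p (Wp : pset W p) : eval Wp scalar_ext_sfun = scalar_ext g s i p.
Proof.
have gi a b : eval Wp (Gi a b) = inv_metric g i a b p := eval_inverse Wi sg ug Wp a b.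
have ds a : eval Wp (gradient d S a 0) = pd i a s p.
  rewrite mxE pdersE.
  exact (esym (pd_sfun Wi Wp a (F := S) (fun q Wq => esym (evS Wq)))).
have e1 : eval Wp (contract Gi (ricci_mx d Gc)) = scalar_curvature g i p.
  rewrite rmorph_sum; apply: eq_bigr => a _; rewrite rmorph_sum; apply: eq_bigr => b _.
  rewrite rmorphM; congr (_ * _); first exact (gi a b).
  exact (eval_ricci Wi sg ug yg Wp a b).
have e2 : eval Wp (contract Gi (hessian_mx d Gc S)) = trace g (hessian g s) i p.
  rewrite rmorph_sum; apply: eq_bigr => a _; rewrite rmorph_sum; apply: eq_bigr => b _.
  rewrite rmorphM; congr (_ * _); first exact (gi a b).
  rewrite [hessian_mx _ _ _ _ _]mxE.
  exact (eval_hessian Wi sg ug Wp a b (fun q Wq => esym (evS Wq))).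
have e3 : eval Wp (sqnorm Gi (gradient d S)) =
    \sum_c (\sum_e pd i e s p * inv_metric g i e c p) * pd i c s p.
  rewrite /sqnorm mxE rmorph_sum; apply: eq_bigr => c _; rewrite rmorphM.
  congr (_ * _); last exact (ds c).
  rewrite [raise _ _ _ _]mxE rmorph_sum; apply: eq_bigr => e _; rewrite rmorphM.
  by congr (_ * _); [rewrite trmxE; exact (ds e) | exact (gi e c)].
by rewrite rmorphB rmorphD rmorphM rmorphXn !rmorphMn rmorphM /= e1 e2 e3 evS.
Qed.

End ScalarExtension.

Section ScaledMetricLocal.
Context {R : realType} {n : nat} {M : oriented_manifold R n.+2}.
Variables (g : tensor2 M) (s : M -> R) (D : set M).
Hypothesis Hg : lorentzian_metric setT g.
Hypothesis ss : smooth_fun setT s.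
Hypothesis Do : open D.
Hypothesis s0 : forall p, D p -> s p != 0.

Definition rescaled : tensor2 M := fun i p => s p ^- 2 *: g i p.

Section Patch.
Variable i : chart M.
Let W := chart_patch Do i.
Let Wi : W `<=` dom i. Proof. by move=> q []. Qed.
Let WD : W `<=` D. Proof. by move=> q []. Qed.

Let sg : smooth_mx (W := W) i (g i).
Proof. by apply: is_tensor2_smooth_mx Hg.1 _. Qed.
Let ug q : pset W q -> g i q \in unitmx.
Proof. by move=> Wq; exact: (metric_unit (D := setT) Hg I (Wi Wq)). Qed.
Let yg q : pset W q -> (g i q)^T = g i q.
Proof. by move=> Wq; exact: (metric_sym (D := setT) Hg I (Wi Wq)). Qed.

Let S : sfun W := sfun_of s.

Let s_smooth : smooth_in_chart W (pchart W) s.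
Proof. exact: smooth_in_chart_subset (@subsetT _ W) (ss i). Qed.

Let evS p (Wp : pset W p) : eval Wp S = s p.
Proof. exact: eval_sfun_of. Qed.

Let S_inverse : {t : sfun W | S * t = 1}.
Proof.
apply: cid; apply: sfun_inverse => p Wp; rewrite -[S p]/(eval Wp S) evS.
by apply: s0; exact: WD.
Qed.

Let t := sval S_inverse.
Let St : S * t = 1 := svalP S_inverse.

Let evt p (Wp : pset W p) : eval Wp t = (s p)^-1.
Proof.
have := congr1 (eval Wp) St; rewrite rmorphM rmorph1 /= evS => E.
by rewrite -[LHS]mul1r -(mulVf (s0 (WD Wp))) -mulrA E mulr1.
Qed.

Let Gm := sfun_mx (W := W) (g i).
Let Gi := patch_inverse (W := W) i g.
Let Gc := patch_connection Wi g.
Let GS : Gm^T = Gm := sfun_mx_sym Wi sg yg.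
Let GK : Gm *m Gi = 1%:M := sfun_mx_inverse Wi sg ug.
Let Gs : torsion_free Gc := patch_torsion_free Wi sg yg.
Let Gg : metric_connection (pders Wi) Gc Gm := patch_metric Wi sg ug yg.

Let Gh := scaled_connection (pders Wi) Gm Gi Gc S t.

Let evGm p (Wp : pset W p) : map_mx (eval Wp) Gm = g i p := map_sfun_mx Wi Wp sg.

Let ev_rescaled p (Wp : pset W p) a b : eval Wp ((t ^+ 2 *: Gm) a b) = rescaled i p a b.
Proof.
rewrite scalemxE rmorphM rmorphXn /= evt [RHS]mxE exprVn; congr (_ * _).
by rewrite -(evGm Wp) [RHS]mxE.
Qed.

Lemma rescaled_smooth : smooth_mx (W := W) i (rescaled i).
Proof.
move=> a b; apply: (smooth_in_chart_eq (f := (t ^+ 2 *: Gm) a b)).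
- exact: pset_open.
- by move=> q Wq; exact: ev_rescaled.
- exact: sfun_smooth_in.
Qed.

Let sgh := rescaled_smooth.

Let ugh q : pset W q -> rescaled i q \in unitmx.
Proof.
move=> Wq; rewrite unitmxZ ?ug // unitfE invr_eq0 expf_neq0 //; apply: s0; exact: WD.
Qed.

Let ygh q : pset W q -> (rescaled i q)^T = rescaled i q.
Proof. by move=> Wq; rewrite /rescaled linearZ /= yg. Qed.

Let GmhE : sfun_mx (W := W) (rescaled i) = t ^+ 2 *: Gm.
Proof.
apply: sfun_mx_eval => p Wp; rewrite (map_sfun_mx Wi) //.
by apply/matrixP => a b; rewrite -(ev_rescaled Wp) [RHS]mxE.
Qed.

Let GihE : patch_inverse (W := W) i rescaled = S ^+ 2 *: Gi.
Proof.
have K := sfun_mx_inverse Wi sgh ugh; have y := sfun_mx_sym Wi sgh ygh.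
rewrite GmhE in K y.
exact: mulmx_inverse_unique (inv_metricK y K) (scaled_metricK GK St).
Qed.

Let GhE : patch_connection Wi rescaled = Gh.
Proof.
apply/funext => a; rewrite /patch_connection GihE GmhE.
apply/esym/levi_civita_unique.
- exact: sfun_halfE.
- exact: scaled_metric_sym.
- exact: scaled_metricK.
- exact: scaled_torsion_free.
- exact: scaled_metric.
Qed.

Let ev_ricci p (Wp : pset W p) : map_mx (eval Wp) (ricci_mx (pders Wi) Gh) = ricci rescaled i p.
Proof.
by apply/matrixP => a b; rewrite mxE -GhE; have := eval_ricci Wi sgh ugh ygh Wp a b; exact.
Qed.

Let ev_ricci0 p (Wp : pset W p) : map_mx (eval Wp) (ricci_mx (pders Wi) Gc) = ricci g i p.
Proof. by apply/matrixP => a b; rewrite mxE; have := eval_ricci Wi sg ug yg Wp a b; exact. Qed.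

Let ev_hessian p (Wp : pset W p) :
  map_mx (eval Wp) (hessian_mx (pders Wi) Gc S) = hessian g s i p.
Proof.
apply/matrixP => a b; rewrite mxE [hessian_mx _ _ _ _ _]mxE.
by apply: (eval_hessian Wi sg ug Wp) => q Wq; rewrite evS.
Qed.

Lemma rescaled_ricci p : D p -> dom i p -> exists c : R,
  ricci rescaled i p = ricci g i p + (n%:R * (s p)^-1) *: hessian g s i p + c *: g i p.
Proof.
move=> Dp ip; have Wp : pset W p by [].
exists (eval Wp (t * contract Gi (hessian_mx (pders Wi) Gc S)
  - (t ^+ 2 * sqnorm Gi (gradient (pders Wi) S)) *+ n.+1)).
apply/matrixP => a b; have E := scaled_ricci GS GK Gs Gg St a b.
have entry (B : 'M[sfun W]_n.+2) (C : 'M[R]_n.+2) :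
    map_mx (eval Wp) B = C -> C a b = eval Wp (B a b) by move=> <-; rewrite mxE.
have aux (x y z w l u : sfun W) (X Y Z K : 'M[R]_n.+2) (c : R) :
    x = y + (u * z) *+ n + w * l -> eval Wp u = c -> X a b = eval Wp x ->
    Y a b = eval Wp y -> Z a b = eval Wp z -> K a b = eval Wp w ->
    X a b = (Y + (n%:R * c) *: Z + eval Wp l *: K) a b.
  move=> -> <- -> r2 r3 r4; rewrite !(addmxE, scalemxE) r2 r3 r4.
  rewrite 2!rmorphD rmorphMn 2!rmorphM /= -[_ *+ n]mulr_natl mulrA.
  by congr (_ + _); rewrite mulrC.
exact (aux _ _ _ _ _ _ _ _ _ _ _ E (evt Wp) (entry _ _ (ev_ricci Wp))
  (entry _ _ (ev_ricci0 Wp)) (entry _ _ (ev_hessian Wp)) (entry _ _ (evGm Wp))).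
Qed.

Let N0 : n.+2%:R != 0 :> R. Proof. by rewrite pnatr_eq0. Qed.

Let ninv : sfun W := sfun_of (fun=> n.+2%:R^-1).

Let evninv p (Wp : pset W p) : eval Wp ninv = n.+2%:R^-1.
Proof. by rewrite eval_sfun_of //; exact: cst_smooth. Qed.

Let ninvE : ninv * n.+2%:R = 1.
Proof.
by apply: sfun_eval => p Wp; rewrite rmorphM rmorph1 rmorph_nat /= evninv mulVf.
Qed.

Let Sc := scaled_curvature (pders Wi) Gm Gi Gc S t.
Let Tf := scaled_tracefree (pders Wi) Gm Gi Gc S t ninv.

Let entry p (Wp : pset W p) (B : 'M[sfun W]_n.+2) (C : 'M[R]_n.+2) a b :
  map_mx (eval Wp) B = C -> eval Wp (B a b) = C a b.
Proof. by move=> <-; rewrite mxE. Qed.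

Let ev_curvature p (Wp : pset W p) : eval Wp Sc = scalar_curvature rescaled i p.
Proof.
rewrite /Sc /scaled_curvature -GihE rmorph_sum; apply: eq_bigr => a _.
rewrite rmorph_sum; apply: eq_bigr => b _; rewrite rmorphM /=.
congr (_ * _); first exact (eval_inverse Wi sgh ugh Wp a b).
exact (entry a b (ev_ricci Wp)).
Qed.

Let ev_tracefree p (Wp : pset W p) : map_mx (eval Wp) Tf = tracefree rescaled (ricci rescaled) i p.
Proof.
apply/matrixP => a b; rewrite mxE /Tf /scaled_tracefree addmxE oppmxE scalemxE.
rewrite rmorphB rmorphM rmorphM /= ev_rescaled ev_curvature evninv.
have r := entry a b (ev_ricci Wp).
have aux (X Y Z : 'M[R]_n.+2) (c : R) : Y a b = X a b ->
    Y a b - c * Z a b = (X - c *: Z) a b by move=> ->; rewrite !(addmxE, oppmxE, scalemxE).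
by rewrite r; exact: aux.
Qed.

Let T := tracefree rescaled (ricci rescaled).

Lemma tracefree_ricci_smooth : smooth_mx (W := W) i (T i).
Proof.
move=> a b; apply: (smooth_in_chart_eq (f := Tf a b)).
- exact: pset_open.
- by move=> q Wq; exact (entry a b (ev_tracefree Wq)).
- exact: sfun_smooth_in.
Qed.

Let TfE : sfun_mx (W := W) (T i) = Tf.
Proof.
apply: sfun_mx_eval => p Wp; rewrite (map_sfun_mx Wi Wp tracefree_ricci_smooth).
by rewrite ev_tracefree.
Qed.

(** In dimension n + 2 the trace-free Ricci tensor of a metric has divergence
    (1/2 - 1/(n+2)) dSc = n/(2(n+2)) dSc. *)
Lemma second_equation (n_gt0 : (0 < n)%N) p a : D p -> dom i p ->
  \sum_c \sum_b inv_metric g i c b p * T i p a c * pd i b s p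
  - n%:R^-1 * s p * \sum_b \sum_c inv_metric g i b c p * cov_deriv2 g T i p b a c =
  - (2 * n.+2%:R * s p)^-1 * pd i a (scalar_curvature rescaled i) p.
Proof.
move=> Dp ip; have Wp : pset W p by [].
have E := congr1 (eval Wp) (scaled_divergence sfun_halfE GS GK Gs Gg St ninvE a).
have e1 : eval Wp (divergence (pders Wi) Gi Gc Tf a) =
    \sum_b \sum_c inv_metric g i b c p * cov_deriv2 g T i p b a c.
  rewrite rmorph_sum; apply: eq_bigr => b _; rewrite rmorph_sum; apply: eq_bigr => c _.
  rewrite rmorphM /= (eval_inverse Wi sg ug) -TfE; congr (_ * _).
  exact (eval_cov Wi sg ug Wp b a c tracefree_ricci_smooth).
have e2 : eval Wp (\sum_c Tf a c * raise Gi (gradient (pders Wi) S) 0 c) =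
    \sum_c \sum_b inv_metric g i c b p * T i p a c * pd i b s p.
  rewrite rmorph_sum; apply: eq_bigr => c _; rewrite rmorphM /= [raise _ _ _ _]mxE.
  rewrite rmorph_sum big_distrr /=; apply: eq_bigr => b _; rewrite rmorphM /=.
  have gC : inv_metric g i c b p = eval Wp (Gi b c).
    rewrite -[in RHS](inv_metric_sym GS GK) trmxE.
    exact (esym (eval_inverse Wi sg ug Wp c b)).
  have gb : eval Wp ((gradient (pders Wi) S)^T 0 b) = pd i b s p.
    rewrite trmxE mxE pdersE.
    exact (esym (pd_sfun Wi Wp b (F := S) (fun q Wq => esym (evS Wq)))).
  have Tb : eval Wp (Tf a c) = T i p a c := entry a c (ev_tracefree Wp).
  have com (x y z : R) : x * (y * z) = z * x * y by ring.
  by rewrite gC gb Tb; exact: com.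
have e3 : eval Wp (pders Wi a Sc) = pd i a (scalar_curvature rescaled i) p.
  rewrite pdersE.
  exact (esym (pd_sfun Wi Wp a (F := Sc) (fun q Wq => esym (ev_curvature Wq)))).
move: E; rewrite rmorphMn rmorphM rmorphB rmorphM rmorphMn /= e1 e2 evS.
rewrite rmorphB rmorphMn rmorphM /= e3 evninv.
move: (\sum_b _) (\sum_c _) (pd i a _ p) => w dv dS E.
have sp0 : s p != 0 by exact: s0.
have n0 : n%:R != 0 :> R by rewrite pnatr_eq0 -lt0n.
have nN : n.+2%:R = n%:R + 2 :> R by rewrite -natrD addn2.
have n2 : n%:R + 2 != 0 :> R by rewrite -nN.
have -> : w - n%:R^-1 * s p * dv =
    - (2 * n%:R * s p)^-1 * ((s p * (s p * dv - w *+ n)) *+ 2).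
  by rewrite -[w *+ n]mulr_natr; field; rewrite n0 sp0.
by rewrite E nN; field; rewrite n0 sp0 n2.
Qed.

Lemma scalar_curvature_ext p : D p -> dom i p ->
  scalar_curvature rescaled i p = scalar_ext g s i p.
Proof.
move=> Dp ip; have Wp : pset W p by [].
rewrite -(ev_curvature Wp) -(eval_scalar_ext Wi sg ug yg evS Wp).
exact (congr1 (eval Wp) (scaled_scalar GS GK Gs Gg St)).
Qed.

End Patch.

Lemma tracefreeE (h T : tensor2 M) i p : tracefree h T i p = tracefree_mx (h i p) (T i p).
Proof. by []. Qed.

(** Trace-free parts do not see the multiples of the metric in the Schouten tensor
    and in the conformal change of the Ricci tensor. *)
Lemma first_equation (n_gt0 : (0 < n)%N) i p : D p -> dom i p ->
  tracefree g (fun j q => hessian g s j q + s q *: schouten g j q) i p =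
  (n%:R^-1 * s p) *: tracefree rescaled (ricci rescaled) i p.
Proof.
move=> Dp ip; have [c E] := rescaled_ricci Dp ip.
have gU : g i p \in unitmx := metric_unit (D := setT) Hg I ip.
have gS : (g i p)^T = g i p := metric_sym (D := setT) Hg I ip.
have sp0 := s0 Dp; have n0 : n%:R != 0 :> R by rewrite pnatr_eq0 -lt0n.
rewrite !tracefreeE E tracefree_mx_scale ?invr_eq0 ?expf_neq0 // /schouten.
move: (hessian g s i p) (ricci g i p) (_ * scalar_curvature _ _ _) => H Rc c'.
rewrite /= -scaleNr !(tracefree_mxD, tracefree_mxZ) tracefree_mx_metric // !scaler0 !addr0.
move: (tracefree_mx _ H) (tracefree_mx _ Rc) => x y.
rewrite scalerDr !scalerA addrC mulrC; congr (_ + _); rewrite -[LHS]scale1r.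
by congr (_ *: _); field; rewrite n0 sp0.
Qed.

Lemma rescaled_lorentzian : lorentzian_metric D rescaled.
Proof.
split; last first.
  move=> i p Dp ip; apply: lorentz_formZ; first exact: s0.
  by apply: Hg.2.
split=> [i j p Dp ip jp|i a b].
  by rewrite /rescaled (Hg.1.1 i j p) // -scalemxAr -scalemxAl.
by apply/(smooth_in_chart_patch Do); exact: rescaled_smooth.
Qed.

Lemma contract_congruence (J h X : 'M[R]_n.+2) : J \in unitmx -> h \in unitmx ->
  contract (invmx (J *m h *m J^T)) (J *m X *m J^T) = contract (invmx h) X.
Proof.
move=> uJ uh; rewrite !contract_tr !trmx_mul trmxK.
have -> : invmx (J *m h *m J^T) = (invmx J)^T *m invmx h *m invmx J.
  apply: (mulmx_inverse_unique (Y := J *m h *m J^T)).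
    by rewrite mulVmx // !unitmx_mul uJ uh unitmx_tr.
  by apply: congruence_inverse; rewrite ?mulmxV ?mulVmx.
rewrite !mulmxA mxtrace_mulC !mulmxA -(mulmxA _ (invmx J) J) mulVmx // mulmx1.
by rewrite trmx_inv mulmxV ?unitmx_tr // mul1mx.
Qed.

Lemma jacobian_unit (i j : chart M) p : dom i p -> dom j p -> jacobian i j p \in unitmx.
Proof. by move=> ip jp; case/mulmx1_unit: (jacobianK ip jp). Qed.

Lemma tracefree_ricci_is_tensor2 : is_tensor2 D (tracefree rescaled (ricci rescaled)).
Proof.
have L := rescaled_lorentzian.
split=> [i j p Dp ip jp|i a b]; last first.
  by apply/(smooth_in_chart_patch Do); exact: tracefree_ricci_smooth.
rewrite !tracefreeE (ricci_change_chart Do L Dp ip jp) (L.1.1 i j p) //.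
have uh := metric_unit L Dp jp.
rewrite /tracefree_mx contract_congruence ?jacobian_unit //.
move: (rescaled j p) (_ * contract _ _) => h c.
by rewrite mulmxBr mulmxBl -scalemxAr -scalemxAl.
Qed.

Lemma scalar_ext_smooth i : smooth_in_chart setT i (scalar_ext g s i).
Proof.
apply/(smooth_in_chart_patch openT); set W := chart_patch openT i.
have Wi : W `<=` dom i by move=> q [].
have sg : smooth_mx (W := W) i (g i) by apply: is_tensor2_smooth_mx Hg.1 _.
have ug q : pset W q -> g i q \in unitmx.
  by move=> Wq; exact: (metric_unit (D := setT) Hg I (Wi _ Wq)).
have yg q : pset W q -> (g i q)^T = g i q.
  by move=> Wq; exact: (metric_sym (D := setT) Hg I (Wi _ Wq)).
pose S : sfun W := sfun_of s.
have evS q (Wq : pset W q) : eval Wq S = s q.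
  by apply: eval_sfun_of; exact: smooth_in_chart_subset (@subsetT _ W) (ss i).
apply: (smooth_in_chart_eq (f := scalar_ext_sfun g Wi S)).
- exact: pset_open.
- by move=> q Wq; exact (eval_scalar_ext Wi sg ug yg evS Wq).
- exact: sfun_smooth_in.
Qed.

End ScaledMetricLocal.

(** * Functions with vanishing derivative on a dense set *)

Section LocalSmoothness.
Context {R : realType} {N : nat}.

Lemma Ck_local k (U : set 'rV[R]_N) f :
  (forall x, U x -> exists V : set 'rV[R]_N, [/\ V x, V `<=` U & Ck k V f]) -> Ck k U f.
Proof.
elim: k f => [|k IH] f loc; split=> //.
- by move=> x /loc[V [Vx _ CV]]; exact: Ck_continuous CV Vx.
- by move=> x /loc[V [Vx _ CV]]; exact: Ck_continuous CV Vx.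
move=> a; split; first by move=> x /loc[V [Vx _ CV]]; exact: Ck_derivable CV Vx.
apply: IH => x /loc[V [Vx VU CV]]; exists V; split=> //; exact: Ck_partial.
Qed.

Context {M : oriented_manifold R N}.
Implicit Types (i : chart M) (D W : set M) (f : M -> R).

Lemma smooth_in_chart_local D i f :
  (forall p, D p -> dom i p -> exists U : set M, [/\ U p, U `<=` D & smooth_in_chart U i f]) ->
  smooth_in_chart D i f.
Proof.
move=> loc k; apply: Ck_local => x [p [ip Dp] <-].
have [U [Up UD sU]] := loc p Dp ip; exists (coord i @` (dom i `&` U)); split.
- by exists p.
- by move=> y [q [iq Uq] <-]; exists q => //; split=> //; exact: UD.
- exact: sU.
Qed.

Lemma smooth_in_chart_continuous W i f p : open W -> smooth_in_chart W i f ->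
  W p -> dom i p -> {for p, continuous f}.
Proof.
move=> Wo sf Wp ip.
have c1 : {for coord i p, continuous (f \o param i)}.
  by apply: Ck_continuous (sf 0%N) _; exists p.
have c2 : {for p, continuous (coord i)} by exact: coord_continuous.
have c3 : {for p, continuous ((f \o param i) \o coord i)} by exact: continuous_comp.
have E : \forall q \near p, ((f \o param i) \o coord i) q = f q.
  have : nbhs p (dom i) by apply: open_nbhs_nbhs; split=> //; exact: dom_open.
  by apply: filterS => q iq /=; rewrite coordK.
rewrite /prop_for /continuous_at -(nbhs_singleton E).
by apply: cvg_trans _ c3; apply: near_eq_cvg; apply: filterS E.
Qed.

Lemma pd_cst i a (c : R) p : pd i a (fun=> c) p = 0.
Proof. exact: (derive_cst c). Qed.

Lemma dense_eq D (f h : M -> R) p : dense D ->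
  {for p, continuous f} -> {for p, continuous h} ->
  (\forall q \near p, D q -> f q = h q) -> f p = h p.
Proof.
move=> dD cf ch E; apply/eqP; apply: contrapT => /negP ne.
have c : {for p, continuous (f - h)} by exact: continuousB.
have nz : \forall q \near p, f q - h q != 0.
  have : nbhs (f p - h p) [set x : R | x != 0].
    by apply: open_nbhs_nbhs; split; [exact: open_neq | rewrite /= subr_eq0].
  by move/c.
have [V [[Vo Vp] VE]] : exists V : set M, open_nbhs p V /\
    V `<=` [set q | (D q -> f q = h q) /\ f q - h q != 0].
  have : nbhs p [set q | (D q -> f q = h q) /\ f q - h q != 0] by exact: filterI.
  by rewrite nbhsE => -[V [Vo Vp] VE]; exists V.
have [q [Vq Dq]] := dD V (ex_intro _ p Vp) Vo.
by have [/(_ Dq) -> /=] := VE q Vq; rewrite subrr eqxx.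
Qed.

(** A function given chart by chart on a dense open set, where its derivative
    vanishes, and extending smoothly to each chart is constant: the extensions
    agree on overlaps and are locally constant by continuity. *)
Lemma dense_locally_constant D (F : chart M -> M -> R) : open D -> dense D ->
  (forall i, smooth_in_chart setT i (F i)) ->
  (forall i j p, D p -> dom i p -> dom j p -> F i p = F j p) ->
  (forall i a p, D p -> dom i p -> pd i a (F i) p = 0) ->
  exists c, forall i p, dom i p -> F i p = c.
Proof.
move=> Do dD sF FE dF.
have Fc i p : dom i p -> {for p, continuous (F i)}.
  by move=> ip; exact: smooth_in_chart_continuous openT (sF i) I ip.
have {}FE i j p : dom i p -> dom j p -> F i p = F j p.
  move=> ip jp; apply: (dense_eq dD (Fc i p ip) (Fc j p jp)).
  have : nbhs p (dom i `&` dom j).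
    by apply: open_nbhs_nbhs; split=> //; apply: openI; exact: dom_open.
  by apply: filterS => q [iq jq] Dq; exact: FE.
have {}dF i a p : dom i p -> pd i a (F i) p = 0.
  move=> ip; apply: (dense_eq (h := fun=> 0) dD) => //.
  - have := smooth_in_chart_pd a openT (sF i).
    by move=> s; exact: smooth_in_chart_continuous openT s I ip.
  - exact: cst_continuous.
  - have : nbhs p (dom i) by apply: open_nbhs_nbhs; split=> //; exact: dom_open.
    by apply: filterS => q iq Dq; exact: dF.
have loc i p : dom i p -> \forall q \near p, F i q = F i p.
  move=> ip; have Uo := @open_image _ _ M i setT openT.
  have Up : (coord i @` (dom i `&` setT)) (coord i p) by exists p.
  have := zero_gradient_constant Uo (sF i 1%N) Up.
  have z a x : (coord i @` (dom i `&` setT)) x -> 'D_(delta_mx 0 a) (F i \o param i) x = 0.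
    by move=> [q [iq _] <-]; exact: dF.
  move=> /(_ z) H; have c2 : {for p, continuous (coord i)} by exact: coord_continuous.
  have {}H := c2 _ H.
  have Ni : nbhs p (dom i) by apply: open_nbhs_nbhs; split=> //; exact: dom_open.
  by apply: filterS2 Ni H => q iq /=; rewrite !coordK.
have [[p0 _]|none] := pselect (exists p : M, True); last first.
  by exists 0 => i p; case: none; exists p.
have [i0 ip0] := @chart_cover _ _ M p0; exists (F i0 p0).
pose A := [set p : M | exists2 i, dom i p & F i p = F i0 p0].
have nearF p i : dom i p -> \forall q \near p, dom i q /\ F i q = F i p.
  move=> ip; apply: filterI; last exact: loc.
  by apply: open_nbhs_nbhs; split=> //; exact: dom_open.
have Ao : open A.
  rewrite openE => p [i ip E]; rewrite /interior; apply: filterS (nearF p i ip) => q [iq Eq].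
  by exists i => //; rewrite Eq.
have Ac : open (~` A).
  rewrite openE => p nA; have [i ip] := @chart_cover _ _ M p.
  rewrite /interior; apply: filterS (nearF p i ip) => q [iq Eq] [j jq Ej].
  by apply: nA; exists i => //; rewrite -Eq -Ej; exact: FE.
have AT : A = setT.
  apply: (@manifold_connected _ _ M); first by exists p0; exists i0.
    by exists A => //; rewrite setTI.
  by exists A; rewrite ?setTI // -openC.
move=> i p ip; have [j jp <-] : A p by rewrite AT.
exact: FE.
Qed.

End LocalSmoothness.

(** * Null directions *)

Section LorentzAlgebra.
Context {R : realType} {N : nat}.
Implicit Types (g : 'M[R]_N.+1) (u v w : 'rV[R]_N.+1).

Lemma pairingDl g u v w : pairing g (u + v) w = pairing g u w + pairing g v w.
Proof. by rewrite /pairing !mulmxDl mxE. Qed.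

Lemma pairingZl g c u w : pairing g (c *: u) w = c * pairing g u w.
Proof. by rewrite /pairing -!scalemxAl mxE. Qed.

Lemma pairing_sym g u v : g^T = g -> pairing g u v = pairing g v u.
Proof.
move=> gS; rewrite /pairing -[LHS]trmxE !trmx_mul trmxK gS mulmxA //.
Qed.

Lemma pairingDr g u v w : pairing g w (u + v) = pairing g w u + pairing g w v.
Proof. by rewrite /pairing linearD mulmxDr mxE. Qed.

Lemma pairingZr g c u w : pairing g w (c *: u) = c * pairing g w u.
Proof. by rewrite /pairing linearZ /= -scalemxAr mxE. Qed.

Lemma pairing_scale g c u v : pairing (c *: g) u v = c * pairing g u v.
Proof. by rewrite /pairing -scalemxAr -scalemxAl mxE. Qed.

(** With k_0 and T_0 the first coordinates in an orthonormal basis, the vector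
    k_0 T - T_0 k is spacelike or zero, while its square is k_0^2 g(T, T). *)
Lemma timelike_null_pairing g u k : lorentz_form g -> pairing g u u < 0 ->
  pairing g k k = 0 -> pairing g u k = 0 -> k = 0.
Proof.
move=> L uu kk uk; have gS := lorentz_form_sym L.
case: L => P [uP E]; pose Q := invmx P.
have QP : Q *m P = 1%:M by exact: mulVmx.
have QE v w : pairing g v w = pairing (P *m g *m P^T) (v *m Q) (w *m Q).
  rewrite /pairing trmx_mul !mulmxA -(mulmxA v Q P) QP mulmx1.
  by rewrite -(mulmxA _ P^T Q^T) -trmx_mul QP trmx1 mulmx1.
have eta v w : pairing g v w =
    - ((v *m Q) 0 0 * (w *m Q) 0 0) + \sum_(a < N) (v *m Q) 0 (lift ord0 a) * (w *m Q) 0 (lift ord0 a).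
  rewrite QE E /pairing mxE big_ord_recl; congr (_ + _).
    rewrite [X in X * _]mxE (bigD1 0) //= big1 ?addr0 => [|b b0]; last first.
      by rewrite !mxE (negPf b0) mulr0n mulr0.
    by rewrite !mxE /= mulr1n mulrN1 mulNr.
  apply: eq_bigr => a _; rewrite [X in X * _]mxE (bigD1 (lift ord0 a)) //=
    big1 ?addr0 => [|b ba]; last first.
    by rewrite !mxE (negPf ba) mulr0n mulr0.
  by rewrite !mxE eqxx mulr1n mulr1.
set k0 := (k *m Q) 0 0; set u0 := (u *m Q) 0 0.
pose w := k0 *: u - u0 *: k.
have ww : pairing g w w = k0 ^+ 2 * pairing g u u.
  rewrite /w -scaleNr !(pairingDl, pairingDr, pairingZl, pairingZr).
  by rewrite (pairing_sym k u gS) uk kk; ring.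
have w0 : (w *m Q) 0 0 = 0.
  by rewrite /w mulmxBl -!scalemxAl addmxE oppmxE !scalemxE -/k0 -/u0 mulrC subrr.
have wpos : 0 <= pairing g w w.
  by rewrite eta w0 mul0r oppr0 add0r; apply: sumr_ge0 => a _; rewrite -expr2 sqr_ge0.
have k00 : k0 = 0.
  apply/eqP; apply: contraLR wpos => k0n; rewrite ww -ltNge.
  by rewrite pmulr_rlt0 // exprn_even_gt0.
have kQ : k *m Q = 0.
  have := eta k k; rewrite kk -/k0 k00 mul0r oppr0 add0r => /esym/eqP.
  rewrite psumr_eq0 => [/allP z|a _]; last by rewrite -expr2 sqr_ge0.
  apply/rowP => b; rewrite [RHS]mxE; case: (unliftP ord0 b) => [a ->|->]; last exact: k00.
  have := z a (mem_index_enum a); rewrite /= mulf_eq0 orbb => /eqP; exact.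
by rewrite -[k]mulmx1 -(mulVmx uP) mulmxA kQ mul0mx.
Qed.

End LorentzAlgebra.

Section Radiation.
Context {R : realType} {N : nat}.
Implicit Types (A : 'M[R]_N) (kap v : 'rV[R]_N).

(** A component of kap that does not vanish can be divided by. *)
Lemma radiation_annihilates A kap v : A^T = A -> kap != 0 ->
  (forall a b c, kap 0 a * A b c = kap 0 b * A a c) ->
  (v *m kap^T) 0 0 = 0 -> A *m v^T = 0.
Proof.
move=> AS k0 H vk; have [a0 ka0] : exists a, kap 0 a != 0.
  apply: contrapT => none; case/eqP: k0; apply/rowP => a; rewrite mxE.
  by apply/eqP; apply: contrapT => /negP ka; apply: none; exists a.
apply/colP => c; rewrite [RHS]mxE; apply: (mulfI ka0); rewrite mulr0.
rewrite mxE big_distrr /=.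
transitivity (A a0 c * (v *m kap^T) 0 0); last by rewrite vk mulr0.
rewrite mxE big_distrr /=; apply: eq_bigr => b _.
by rewrite !mxE -[A c b]trmxE AS [LHS]mulrA H; ring.
Qed.

(** The vectors kap_a e_b - kap_b e_a are annihilated by kap. *)
Lemma annihilates_radiation A kap : A^T = A ->
  (forall v, (v *m kap^T) 0 0 = 0 -> A *m v^T = 0) ->
  forall a b c, kap 0 a * A b c = kap 0 b * A a c.
Proof.
move=> AS H a b c.
have := H (kap 0 a *: delta_mx 0 b - kap 0 b *: delta_mx 0 a).
have dE x : ((delta_mx 0 x : 'rV[R]_N) *m kap^T) 0 0 = kap 0 x.
  by rewrite -rowE !mxE.
have cE x : (A *m (delta_mx 0 x : 'rV[R]_N)^T) c 0 = A c x.
  by rewrite trmx_delta -colE mxE.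
rewrite mulmxBl -!scalemxAl addmxE oppmxE !scalemxE !dE mulrC subrr => /(_ erefl) /colP/(_ c).
have tr (u w : 'rV[R]_N) (x y : R) :
    A *m (x *: u - y *: w)^T = x *: (A *m u^T) - y *: (A *m w^T).
  have Z (z : R) (t : 'rV[R]_N) : (z *: t)^T = z *: t^T by rewrite linearZ.
  by rewrite trmxD trmxN !Z mulmxBr -!scalemxAr.
rewrite tr addmxE oppmxE !scalemxE !cE [RHS]mxE => /eqP.
by rewrite subr_eq0 -[A c b]trmxE -[A c a]trmxE AS => /eqP.
Qed.

End Radiation.

Section Optical.
Context {R : realType} {n : nat} {X : optical_geometry R n}.
Implicit Types (g h : tensor2 X) (i j : chart X) (p : X).

Lemma smooth_in_chartM (W : set X) i f1 f2 : open W -> smooth_in_chart W i f1 ->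
  smooth_in_chart W i f2 -> smooth_in_chart W i (fun q => f1 q * f2 q).
Proof. by move=> Wo s1 s2 k; apply: CkM; [exact: open_image | exact: s1 | exact: s2]. Qed.

Lemma metrics_lorentzian g : metrics g -> lorentzian_metric setT g.
Proof.
have [g0 L0 ->] := @metricsP _ _ X; move=> [Om [sOm Om0 gE]].
split=> [|i p _ ip]; last first.
  rewrite gE // (_ : Om p ^+ 2 = (Om p)^-1 ^- 2); last by rewrite exprVn invrK.
  by apply: lorentz_formZ; [rewrite invr_eq0 gt_eqF | exact: L0.2].
split=> [i j p _ ip jp|i a b].
  by rewrite !gE // (L0.1.1 i j p) // -scalemxAr -scalemxAl.
apply/(smooth_in_chart_patch openT).
apply: (smooth_in_chart_eq (f := fun q => Om q * Om q * g0 i q a b)).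
- exact: pset_open.
- by move=> q [iq _]; rewrite gE // mxE expr2.
- apply/(smooth_in_chart_patch openT).
  by do 2?[apply: smooth_in_chartM; first exact: openT]; [exact: sOm | exact: sOm | exact: L0.1.2].
Qed.

Lemma metrics_conformal g h : metrics g -> metrics h ->
  exists2 Om : X -> R, (forall p, 0 < Om p) & conformal_rescaling Om g h.
Proof.
have [g0 L0 ->] := @metricsP _ _ X; move=> [Om1 [_ O10 gE]] [Om2 [_ O20 hE]].
exists (fun p => Om2 p / Om1 p) => [p|i p ip]; first exact: divr_gt0.
rewrite gE // hE // scalerA; congr (_ *: _).
by have n1 := lt0r_neq0 (O10 p); field.
Qed.

Lemma density_rescale (sigma : density X 1) g h Om : metrics g -> metrics h ->
  (forall p, 0 < Om p) -> conformal_rescaling Om g h ->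
  forall p, sigma h p = Om p * sigma g p.
Proof. by move=> mg mh O0 gh p; rewrite (density_equivariant sigma mg mh O0 gh) expr1z. Qed.

Lemma zero_setE (sigma : density X 1) g p : metrics g ->
  zero_set sigma p <-> sigma g p = 0.
Proof.
move=> mg; split=> [[h mh h0]|g0]; last by exists g.
have [Om O0 hg] := metrics_conformal mh mg.
by rewrite (density_rescale sigma mh mg O0 hg) h0 mulr0.
Qed.

Lemma scale_metricE (sigma : density X 1) g h i p : metrics g -> metrics h ->
  dom i p -> scale_metric sigma g i p = scale_metric sigma h i p.
Proof.
move=> mg mh ip; have [Om O0 gh] := metrics_conformal mg mh.
rewrite /scale_metric (density_rescale sigma mg mh O0 gh) gh // scalerA; congr (_ *: _).
have O2 : Om p ^+ 2 != 0 by rewrite expf_neq0 // gt_eqF.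
by rewrite exprMn; move: (Om p ^+ 2) (sigma g p ^+ 2) O2 => a b a0;
  rewrite invfM mulrAC mulVf // mul1r.
Qed.

Lemma scale_continuous (sigma : density X 1) g p : metrics g ->
  {for p, continuous (sigma g)}.
Proof.
move=> mg; have [i ip] := @chart_cover _ _ X p.
exact: smooth_in_chart_continuous openT (density_smooth sigma mg i) I ip.
Qed.

Lemma scale_domain_open (sigma : density X 1) g : metrics g -> open (~` zero_set sigma).
Proof.
move=> mg; rewrite openE => p /= np; rewrite /interior.
have sp : sigma g p != 0 by apply/eqP => /(zero_setE sigma p mg).
have N0 : nbhs (sigma g p) [set x : R | x != 0].
  by apply: open_nbhs_nbhs; split; [exact: open_neq | ].
have : nbhs p (sigma g @^-1` [set x : R | x != 0]) := scale_continuous (p := p) mg N0.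
by apply: filterS => q /eqP sq /(zero_setE sigma q mg).
Qed.

(** Where the scale vanishes on an open set its derivative vanishes too. *)
Lemma scale_domain_dense (sigma : density X 1) :
  almost_lorentzian_scale sigma -> dense (~` zero_set sigma).
Proof.
move=> [g mg nd] V [p Vp] Vo; apply: contrapT => none.
have sV q : V q -> sigma g q = 0.
  move=> Vq; apply/(zero_setE sigma q mg); apply: contrapT => nq.
  by apply: none; exists q.
have [i ip] := @chart_cover _ _ X p.
have zp : zero_set sigma p by apply/(zero_setE sigma p mg); exact: sV.
have [a /eqP] := nd p zp i ip; apply.
by rewrite (open_pd a ip Vo Vp sV) pd_cst.
Qed.

Lemma ricci_local g h i p : (forall j q, dom j q -> g j q = h j q) -> dom i p ->
  ricci g i p = ricci h i p.
Proof.
move=> gh ip; have io := @dom_open _ _ X i.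
have Gam c a b q : dom i q -> christoffel g i c a b q = christoffel h i c a b q.
  move=> iq; rewrite /christoffel; congr (_ * _); apply: eq_bigr => d _.
  rewrite /inv_metric gh //; congr (_ * (_ + _ - _)); apply: (open_pd _ iq io iq) => r ir;
    by rewrite gh.
have dG k c a b : pd i k (christoffel g i c a b) p = pd i k (christoffel h i c a b) p.
  by apply: (open_pd _ ip io ip) => r ir; exact: Gam.
apply/matrixP => a b; rewrite [LHS]mxE [RHS]mxE; apply: (congr2 +%R).
  by apply: eq_bigr => c _; exact (congr2 (fun x y => x - y) (dG c c a b) (dG b c a c)).
apply: eq_bigr => c _; apply: eq_bigr => d _.
exact (congr2 (fun x y => x - y)
  (congr2 *%R (Gam c c d p ip) (Gam d a b p ip))
  (congr2 *%R (Gam c b d p ip) (Gam d a c p ip))).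
Qed.

Lemma scalar_curvature_local g h i p : (forall j q, dom j q -> g j q = h j q) ->
  dom i p -> scalar_curvature g i p = scalar_curvature h i p.
Proof.
move=> gh ip; rewrite /scalar_curvature /trace.
apply: eq_bigr => a _; apply: eq_bigr => b _.
by rewrite /inv_metric gh // (ricci_local gh ip).
Qed.

(** Components outside the chart domains are arbitrary: the metrics s^-2 g for two
    choices of g in the conformal class agree on the domains only. *)
Lemma pure_radiation_metric_local D g h : open D ->
  (forall j q, dom j q -> g j q = h j q) ->
  pure_radiation_metric D g -> pure_radiation_metric D h.
Proof.
move=> Do gh [[[gT gs] gL] [c gc] [k [ks k0 kr]]]; split.
- split; last by move=> i p Dp ip; rewrite -gh //; exact: gL.
  split=> [i j p Dp ip jp|i a b]; first by rewrite -!gh //; exact: gT.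
  apply/(smooth_in_chart_patch Do); apply: (smooth_in_chart_eq (f := fun p => g i p a b)).
  + exact: pset_open.
  + by move=> q [iq _]; rewrite gh.
  + by apply/(smooth_in_chart_patch Do); exact: gs.
- by exists c => i p Dp ip; rewrite -(scalar_curvature_local gh ip); exact: gc.
- exists k; split=> // i p Dp ip; rewrite -gh // /tracefree /trace /inv_metric -gh //.
  by rewrite -(ricci_local gh ip); exact: kr.
Qed.

End Optical.

(** * Null sections *)

Section NullSection.
Context {R : realType} {n : nat} {X : optical_geometry R n}.
Variable g : tensor2 X.
Hypothesis Hg : metrics g.
Implicit Types (i j : chart X) (p : X).

Let L : lorentzian_metric setT g := metrics_lorentzian Hg.

(** The vector of the null line whose product with the time field is 1; this
    normalisation does not depend on the local generator it is computed from. *)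
Definition null_section : vfield X := fun i p =>
  let u := xget 0 (ray i p) in (pairing (g i p) (time_field i p) u)^-1 *: u.

Lemma null_section_generator p : exists U : set X, exists k : vfield X,
  [/\ open U, U p, is_vfield U k & forall i q, U q -> dom i q ->
    [/\ ray i q = [set t *: k i q | t in [set t : R | 0 < t]],
        k i q != 0,
        pairing (g i q) (time_field i q) (k i q) != 0 &
        null_section i q = (pairing (g i q) (time_field i q) (k i q))^-1 *: k i q]].
Proof.
have [U [k [Uo Up kv kr]]] := ray_generated p; exists U, k; split=> // i q Uq iq.
have [k0 rE] := kr i q Uq iq.
have rk : ray i q (k i q) by rewrite rE; exists 1 => /=; rewrite ?scale1r ?ltr01.
have c0 : pairing (g i q) (time_field i q) (k i q) != 0.
  apply/eqP => z; case/eqP: k0.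
  apply: timelike_null_pairing z; first exact: L.2.
    exact: time_field_timelike.
  exact: ray_null Hg iq rk.
split=> //; rewrite /null_section.
have : ray i q (xget 0 (ray i q)) by apply: xgetPex; exists (k i q).
rewrite {1}rE => -[t /= t0 <-]; rewrite pairingZr invfM scalerA.
by rewrite mulrC mulrA mulfV ?mul1r // gt_eqF.
Qed.

Lemma null_section_neq0 i p : dom i p -> null_section i p != 0.
Proof.
move=> ip; have [U [k [Uo Up kv kr]]] := null_section_generator p.
have [_ k0 c0 ->] := kr i p Up ip.
by rewrite scaler_eq0 negb_or invr_eq0 c0.
Qed.

Lemma null_section_null_line i p : dom i p -> null_line i p (null_section i p).
Proof.
move=> ip; have [U [k [Uo Up kv kr]]] := null_section_generator p.
have [rE k0 c0 ->] := kr i p Up ip; rewrite /null_line /= rE.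
case: (ltgtP (pairing (g i p) (time_field i p) (k i p)) 0) c0 => // cs _.
  right; left; exists (- (pairing (g i p) (time_field i p) (k i p))^-1) => /=.
    by rewrite oppr_gt0 invr_lt0.
  by rewrite scaleNr.
by left; exists (pairing (g i p) (time_field i p) (k i p))^-1 => //=; rewrite invr_gt0.
Qed.

Lemma pairing_change_chart (U : set X) (u v : vfield X) i j p : is_vfield U u ->
  is_vfield U v -> U p -> dom i p -> dom j p ->
  pairing (g j p) (u j p) (v j p) = pairing (g i p) (u i p) (v i p).
Proof.
move=> [ut _] [vt _] Up ip jp; rewrite (ut i j p) // (vt i j p) // (L.1.1 i j p) //.
by rewrite /pairing trmx_mul !mulmxA.
Qed.

Lemma vfield_subset (U V : set X) u : V `<=` U -> is_vfield U u -> is_vfield V u.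
Proof.
move=> VU [ut us]; split=> [i j p /VU Up|i a]; first exact: ut.
exact: smooth_in_chart_subset VU (us i a).
Qed.

Lemma pairing_smooth (W : patch X) (u v : vfield X) i : W `<=` dom i ->
  is_vfield W u -> is_vfield W v ->
  smooth_in_chart W i (fun p => pairing (g i p) (u i p) (v i p)).
Proof.
move=> Wi [_ us] [_ vs].
pose uS : 'rV[sfun W]_n.+2 := \row_a sfun_of (fun q => u i q 0 a).
pose vS : 'rV[sfun W]_n.+2 := \row_a sfun_of (fun q => v i q 0 a).
have sg : smooth_mx (W := W) i (g i) by apply: is_tensor2_smooth_mx L.1 _.
apply: (smooth_in_chart_eq (f := (uS *m sfun_mx (g i) *m vS^T) 0 0)).
- exact: pset_open.
- move=> q Wq; rewrite -[LHS]/(eval Wq _).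
  have uE : map_mx (eval Wq) uS = u i q.
    apply/rowP => a; rewrite !mxE eval_sfun_of //.
    by apply: (smooth_pchart Wi); exact: us.
  have vE : map_mx (eval Wq) vS = v i q.
    apply/rowP => a; rewrite !mxE eval_sfun_of //.
    by apply: (smooth_pchart Wi); exact: vs.
  have E : map_mx (eval Wq) (uS *m sfun_mx (g i) *m vS^T) = u i q *m g i q *m (v i q)^T.
    by rewrite !map_mxM -map_trmx uE vE (map_sfun_mx Wi Wq sg).
  by rewrite /pairing -E [RHS]mxE.
- exact: sfun_smooth_in.
Qed.

Lemma null_section_vfield : is_vfield setT null_section.
Proof.
split=> [i j p _ ip jp|i a].
  have [U [k [Uo Up kv kr]]] := null_section_generator p.
  have [_ _ _ ->] := kr i p Up ip; have [_ _ _ ->] := kr j p Up jp.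
  rewrite (pairing_change_chart (vfield_subset (@subsetT _ U) (@time_fieldP _ _ X)) kv Up ip jp).
  by rewrite -scalemxAl (kv.1 i j p).
apply: smooth_in_chart_local => p _ ip.
have [U [k [Uo Up kv kr]]] := null_section_generator p.
pose W := chart_patch Uo i; have Wi : W `<=` dom i by move=> q [].
have WU : W `<=` U by move=> q [].
exists W; split=> //.
have ps := pairing_smooth Wi (vfield_subset (@subsetT _ W) (@time_fieldP _ _ X)) (vfield_subset WU kv).
have Wo := @pset_open _ _ _ W.
apply: (smooth_in_chart_eq (f := fun q =>
  (pairing (g i q) (time_field i q) (k i q))^-1 * k i q 0 a)) => //.
  by move=> q Wq; have [_ _ _ ->] := kr i q (WU q Wq) (Wi q Wq); rewrite mxE.
apply: smooth_in_chartM => //; last exact: smooth_in_chart_subset WU (kv.2 i a).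
move=> l; apply: CkV; [exact: open_image | | exact: ps].
move=> x [q [iq Wq] <-] /=; rewrite coordK //.
by have [_ _ ] := kr i q (WU q Wq) iq.
Qed.

Lemma null_section_is_section (D : set X) : is_section D null_section.
Proof.
split; first exact: vfield_subset (@subsetT _ D) null_section_vfield.
by move=> i p _; exact: null_section_null_line.
Qed.

Lemma null_line_multiple i p u v : dom i p -> null_line i p u -> u != 0 ->
  null_line i p v -> exists c, v = c *: u.
Proof.
move=> ip; have [U [k [Uo Up kv kr]]] := null_section_generator p.
have [rE k0 _ _] := kr i p Up ip.
have mult w : null_line i p w -> exists c, w = c *: k i p.
  rewrite /null_line /= rE => -[[t _ <-]|[[t _ E]|->]]; first by exists t.
    by exists (- t); rewrite scaleNr E opprK.
  by exists 0; rewrite scale0r.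
move=> /mult[b ->] u0 /mult[c ->]; exists (c / b); rewrite scalerA divfK //.
by apply: contraNneq u0 => ->; rewrite scale0r.
Qed.

Lemma null_line_perpE i p u v : dom i p -> null_line i p u -> u != 0 ->
  null_line_perp i p v <-> pairing (g i p) v u = 0.
Proof.
move=> ip nu u0; split=> [H|vu h w mh nw]; first exact: H Hg nu.
have [c ->] := null_line_multiple ip nu u0 nw.
have [Om O0 gh] := metrics_conformal Hg mh.
by rewrite gh // pairing_scale pairingZr vu !mulr0.
Qed.

End NullSection.

(** * Almost pure radiation scales *)

Lemma almost_pure_radiation_scale_subset (R : realType) n (X : optical_geometry R n)
    (D V : set X) (sigma : density X 1) : V `<=` D ->
  almost_pure_radiation_scale D sigma -> almost_pure_radiation_scale V sigma.
Proof.
move=> VD [g mg [Phi [[Pt Ps] Pa Pe Pd]]]; exists g => //; exists Phi; split.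
- split=> [i j p /VD Dp|i a b]; first exact: Pt.
  exact: smooth_in_chart_subset VD (Ps i a b).
- by move=> i p /VD Dp; exact: Pa.
- by move=> i p /VD Dp; exact: Pe.
- by move=> i p a /VD Dp; exact: Pd.
Qed.

Section Scale.
Context {R : realType} {n : nat} {X : optical_geometry R n}.
Variables (sigma : density X 1) (g : tensor2 X).
Hypothesis n_gt0 : (0 < n)%N.
Hypothesis Hg : metrics g.

Let s := sigma g.
Let D := ~` zero_set sigma.
Let gh := scale_metric sigma g.
Let T := tracefree gh (ricci gh).
Let L : lorentzian_metric setT g := metrics_lorentzian Hg.
Let ss : smooth_fun setT s := density_smooth sigma Hg.
Let Do : open D := scale_domain_open sigma Hg.
Let s0 p : D p -> s p != 0.
Proof. by move=> np; apply/eqP => /(zero_setE sigma p Hg). Qed.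
Let Lh : lorentzian_metric D gh := rescaled_lorentzian L ss Do s0.

Let T_sym i p : D p -> dom i p -> (T i p)^T = T i p.
Proof.
move=> Dp ip.
exact (tracefree_mx_sym (metric_sym Lh Dp ip) (ricci_sym Do Lh Dp ip)).
Qed.

Let kappa_pairing i p u v : D p -> dom i p ->
  (v *m (u *m gh i p)^T) 0 0 = s p ^- 2 * pairing (g i p) v u.
Proof.
move=> Dp ip; rewrite -pairing_scale /pairing trmx_mul mulmxA.
by rewrite (metric_sym Lh Dp ip).
Qed.

Let kappa_neq0 i p (u : 'rV[R]_n.+2) : D p -> dom i p -> u != 0 -> u *m gh i p != 0.
Proof.
move=> Dp ip u0; apply: contraNneq u0 => E.
by rewrite -[u]mulmx1 -(mulmxV (metric_unit Lh Dp ip)) mulmxA E mul0mx.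
Qed.

(** The tensor Phi is the trace-free Ricci tensor of the metric. *)
Lemma pure_radiation_scale_of_metric : pure_radiation_metric D gh ->
  almost_pure_radiation_scale D sigma.
Proof.
move=> [_ [c Sc] [k [[_ kn] k0 kr]]]; exists g => //; exists T; split.
- exact: tracefree_ricci_is_tensor2 L ss Do s0.
- move=> i p Dp ip; split; first exact: T_sym.
    have := tracefree_mx_trace (metric_unit Lh Dp ip) (metric_sym Lh Dp ip) (ricci gh i p).
    have uS : s p ^- 2 *: g i p \in unitmx := metric_unit Lh Dp ip.
    have sp2 : s p ^- 2 != 0 by rewrite invr_eq0 expf_neq0 ?s0.
    rewrite (contract_invZ (metric_unit (D := setT) L I ip) _ sp2) => /eqP.
    by rewrite mulf_eq0 invr_eq0 (negPf sp2) => /eqP.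
  move=> v nv; apply: (radiation_annihilates (T_sym Dp ip) (kappa_neq0 Dp ip (k0 i p Dp ip))).
    move=> a b d; have := kr i p Dp ip a b d => /eqP.
    by rewrite mulf_eq0 invr_eq0 pnatr_eq0 subr_eq0 => /eqP.
  rewrite kappa_pairing // ((null_line_perpE Hg v ip (kn i p Dp ip) (k0 i p Dp ip)).1 nv).
  exact: mulr0.
- by move=> i p Dp ip; exact (first_equation L ss Do s0 n_gt0 Dp ip).
- move=> i p a Dp ip; apply: (etrans (second_equation L ss Do s0 n_gt0 a Dp ip)).
  rewrite (open_pd (g := fun=> c) a ip (openI (@dom_open _ _ X i) Do) (conj ip Dp)).
    by rewrite pd_cst mulr0.
  by move=> q [iq Dq]; exact: Sc.
Qed.

Let scalar_change i j p : D p -> dom i p -> dom j p ->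
  scalar_curvature gh i p = scalar_curvature gh j p.
Proof.
move=> Dp ip jp; rewrite -[LHS]/(contract (invmx (gh i p)) (ricci gh i p)).
rewrite (ricci_change_chart Do Lh Dp ip jp) (Lh.1.1 i j p) //.
apply: contract_congruence; first exact: jacobian_unit.
exact (metric_unit Lh Dp jp).
Qed.

(** The two equations determine Phi as the trace-free Ricci tensor and force
    the scalar curvature to be locally constant off the zeros; they bear on
    Phi through its values and first derivatives on an open set. *)
Lemma pure_radiation_metric_of_scale (Hs : almost_lorentzian_scale sigma)
    (Phi : tensor2 X) :
  (forall i p, D p -> dom i p -> forall v, null_line_perp i p v -> Phi i p *m v^T = 0) ->
  (forall i p, D p -> dom i p ->
    tracefree g (fun j q => hessian g s j q + s q *: schouten g j q) i p
    = (n%:R^-1 * s p) *: Phi i p) ->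
  (forall i p a, D p -> dom i p ->
    \sum_c \sum_b inv_metric g i c b p * Phi i p a c * pd i b s p
    - n%:R^-1 * s p * \sum_b \sum_c inv_metric g i b c p * cov_deriv2 g Phi i p b a c = 0) ->
  pure_radiation_metric D gh.
Proof.
move=> Pann Peq Pdiv.
have n0 : n%:R != 0 :> R by rewrite pnatr_eq0 -lt0n.
have PT i p : D p -> dom i p -> Phi i p = T i p.
  move=> Dp ip; apply: (@scalerI _ _ (n%:R^-1 * s p)).
    by rewrite mulf_neq0 ?invr_eq0 ?s0.
  by rewrite -Peq //; exact (first_equation L ss Do s0 n_gt0 Dp ip).
have io i : open (dom i `&` D) by apply: openI => //; exact: dom_open.
have Scd i a p : D p -> dom i p -> pd i a (scalar_curvature gh i) p = 0.
  move=> Dp ip; have E := second_equation L ss Do s0 n_gt0 a Dp ip.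
  have covE b c : cov_deriv2 g Phi i p b a c = cov_deriv2 g T i p b a c.
    rewrite /cov_deriv2 PT //; apply: congr2 => //; apply: congr2 => //.
    by apply: (open_pd _ ip (io i)) => // q [iq Dq]; rewrite PT.
  have Z : - (2 * n.+2%:R * s p)^-1 * pd i a (scalar_curvature gh i) p = 0.
    apply: (etrans (esym E)); rewrite -[RHS](Pdiv i p a Dp ip).
    apply: (congr2 (fun x y => x - n%:R^-1 * s p * y)).
      by apply: eq_bigr => c _; apply: eq_bigr => b _; rewrite PT.
    by apply: eq_bigr => b _; apply: eq_bigr => c _; exact (congr1 _ (esym (covE b c))).
  move/eqP: Z.
  by rewrite mulf_eq0 oppr_eq0 invr_eq0 !mulf_eq0 !pnatr_eq0 (negPf (s0 Dp)) => /eqP.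
have ext i p : D p -> dom i p -> scalar_curvature gh i p = scalar_ext g s i p.
  by move=> Dp ip; exact (scalar_curvature_ext L ss Do s0 Dp ip).
split; first exact: Lh.
  have [||i a p Dp ip|c cE] := dense_locally_constant Do (scale_domain_dense Hs)
      (F := scalar_ext g s).
  - by move=> i; exact: scalar_ext_smooth.
  - move=> i j p Dp ip jp.
    exact (etrans (esym (ext i p Dp ip)) (etrans (scalar_change Dp ip jp) (ext j p Dp jp))).
  - apply: (etrans _ (Scd i a p Dp ip)).
    by apply: (open_pd _ ip (io i)) => // q [iq Dq]; exact (esym (ext i q Dq iq)).
  by exists c => i p Dp ip; exact (etrans (ext i p Dp ip) (cE i p ip)).
exists (null_section g); split; first exact: null_section_is_section.
  by move=> i p _ ip; exact: null_section_neq0.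
move=> i p Dp ip; cbv zeta => a b c.
have k0 := null_section_neq0 Hg ip; have kn := null_section_null_line Hg ip.
have H := annihilates_radiation (T_sym Dp ip) (kap := null_section g i p *m gh i p).
have -> := H _ a b c; first by rewrite subrr mulr0.
move=> v; rewrite kappa_pairing // => /eqP; rewrite mulf_eq0 invr_eq0 expf_eq0 /=.
rewrite (negPf (s0 Dp)) => /eqP vk; rewrite -PT //; apply: Pann => //.
exact/(null_line_perpE Hg v ip kn k0).
Qed.

End Scale.

Theorem proposition3p11 (R : realType) (n : nat) (n_gt0 : (0 < n)%N)
    (X : optical_geometry R n) (sigma : density X 1)
    (Hsigma : almost_lorentzian_scale sigma)
    (g : tensor2 X) (Hg : metrics g) :
  (almost_pure_radiation_scale setT sigma ->
     pure_radiation_metric (~` zero_set sigma) (scale_metric sigma g)) /\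
  (almost_pure_radiation_scale (~` zero_set sigma) sigma <->
     pure_radiation_metric (~` zero_set sigma) (scale_metric sigma g)).
Proof.
have Do := scale_domain_open sigma Hg.
have iffD : almost_pure_radiation_scale (~` zero_set sigma) sigma <->
    pure_radiation_metric (~` zero_set sigma) (scale_metric sigma g).
  split=> [[h Hh [Phi [_ Pa Pe Pd]]]|]; last exact: pure_radiation_scale_of_metric.
  (* the metric of the class in which the equations are written need not be g *)
  apply: (pure_radiation_metric_local (g := scale_metric sigma h) Do).
    by move=> i p ip; exact: scale_metricE.
  apply: (pure_radiation_metric_of_scale n_gt0 Hh Hsigma (Phi := Phi)) => //.
  by move=> i p Dp ip; case: (Pa i p Dp ip).
split=> // H; apply/iffD; apply: almost_pure_radiation_scale_subset H.
exact: subsetT.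
Qed.
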